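(* Assume the setting described in the context (with data $d,\epsilon,c,p,q,R,\omega,\mathsf a_{\mathrm h},\omega_{\mathrm h},\mathbf S,\mathbf M,\mathbf S^*,\mathbf D,\mathbf N$), let $u:\overline D_R\to\mathbb R$, and assume that $1/p+1/q\le 2/(d-1)$. Then (i) in the case $q\ge p$ it holds that $|\mathfrak B(u,\mathbf Du)|\le 8c^8R\,\epsilon^{\theta(p,q)}\,\overline\Lambda(u)$, and (ii) in the case $p\ge q$ it holds that $|\mathfrak B(u,\mathbf Nu)|\le 8c^8R\,\epsilon^{\theta(p,q)}\,\overline\Lambda(u)$.
   Context: General notation. $d\ge2$ is an integer; $\mathbb E^d=\{\{x,y\}: x,y\in\mathbb Z^d,|x-y|=1\}$, $\Omega=(0,\infty)^{\mathbb E^d}$; $\omega(x,y)=\omega_{xy}=\omega(\{x,y\})$ for oriented edges. $D_R=\{x\in\mathbb Z^d:|x|_\infty<R\}$, $\overline D_R=\{|x|_\infty\le R\}$, $\partial D_R=\{|x|_\infty=R\}$ (subsets of $\mathbb Z^d$); $E_R$ is the set of oriented nearest-neighbour edges $(x,y)$ with $\tfrac12|x+y|_\infty<R$; $E^\tau_R$ the set of oriented nearest-neighbour edges $(x,y)$ with $x,y\in\partial D_R$; $E^\nu_R$ the set of those with $x\in D_R,y\in\partial D_R$; $\tilde\partial D_R=\{y\in\partial D_R:\exists x\in D_R, |x-y|=1\}$; for $y\in\tilde\partial D_R$, $\mathbf n(y)$ is the unique edge $(x,y)\in E^\nu_R$. $\bar\nabla_{xy}u=u(y)-u(x)$; for a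 function $F$ on oriented edges, $F_{\mathbf n}$ is $y\mapsto F(\mathbf n(y))$ on $\tilde\partial D_R$. $(\nabla_iu)(x)=u(x+\mathsf e_i)-u(x)$, $(\nabla_i^*u)(x)=u(x-\mathsf e_i)-u(x)$, $\nabla^*\cdot F=\sum_i\nabla_i^*F_i$. For finite $A$, $|f|_{s,A}=(|A|^{-1}\sum_A|f|^s)^{1/s}$ for $s<\infty$, $|f|_{\infty,A}=\max_A|f|$. If $r=\infty$ then $r/(r\pm1)$ is read as $1$ and $1/r$ as $0$. Setting. $\epsilon\in(0,1)$, $c\in(1,\infty)$, $p,q\in(1,\infty]$, $R\in\mathbb N$, $\omega\in\Omega$; $\mathsf a_{\mathrm h}\in\mathbb R^{d\times d}$ is diagonal with $c^{-1}\le(\mathsf a_{\mathrm h})_{ii}\le c$; $\omega_{\mathrm h}\in\Omega$ is given by $\omega_{\mathrm h}(\{x,x+\mathsf e_i\})=(\mathsf a_{\mathrm h})_{ii}$; $|\partial D_R|/|\tilde\partial D_R|\le c$ and $|\tilde\partial D_R|/|E_R|\le c/R$. $\mathbf S,\mathbf M:\mathbb R^{\partial D_R}\to\mathbb R^{\partial D_R}$ are linear operators, $(\mathbf Mf)(x)=f(x)$ for all $x\in\tilde\partial D_R$, and for all $u:\partial D_R\to\mathbb R$: $|u-\mathbf Su|_{\frac{2r}{r-1},\partial D_R}\le c\epsilon R|\bar\nabla u|_{\frac{2r}{r-1},E^\tau_R}$ and $|\mathbf Su|_{\frac{2r}{r-1},\partial D_R}\le c|u|_{\frac{2r}{r-1},\partial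 D_R}$ for $r\in\{p,q\}$; $|\mathbf Su|_{\frac{2p}{p-1},\partial D_R}\le\epsilon^{-(d-1)\frac{p+1}{2p}}|u|_{1,\partial D_R}$; $|\mathbf Su|_{\infty,\partial D_R}\le\epsilon^{-(d-1)\frac{q+1}{2q}}|u|_{\frac{2q}{q+1},\partial D_R}$; $|\bar\nabla(\mathbf Su)|_{\frac{2q}{q+1},E^\tau_R}\le c|\bar\nabla u|_{\frac{2q}{q+1},E^\tau_R}$; $|\bar\nabla(\mathbf Mu)|_{\frac{2r}{r+1},E^\tau_R}\le c|\bar\nabla u|_{\frac{2r}{r+1},E^\tau_R}$ for $r\in\{p,q\}$; $|\mathbf Mu|_{\frac{2p}{p-1},\partial D_R}\le c|u|_{\frac{2p}{p-1},\tilde\partial D_R}$; $|\mathbf Mu|_{1,\partial D_R}\le c|u|_{1,\tilde\partial D_R}$. $\mathbf S^*:\mathbb R^{\tilde\partial D_R}\to\mathbb R^{\tilde\partial D_R}$ is $(\mathbf S^*h)(x)=\sum_{y\in\tilde\partial D_R}h(y)(\mathbf S\mathbf M\mathbf 1_{\{x\}})(y)$, with $\mathbf 1_{\{x\}}$ the indicator on $\partial D_R$. $\mathbf D:\mathbb R^{\overline D_R}\to\mathbb R^{\overline D_R}$ satisfies for all $u:\overline D_R\to\mathbb R$: $(\nabla^*\cdot\mathsf a_{\mathrm h}\nabla(\mathbf Du))(x)=0$ for $x\in D_R$ and $(\mathbf Du)(x)=(\mathbf S(u|_{\partial D_R}))(x)$ for $x\in\partial D_R$. $\mathbf N:\mathbb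 R^{\overline D_R}\to\mathbb R^{\overline D_R}$ satisfies for all $u:\overline D_R\to\mathbb R$: $(\nabla^*\cdot\mathsf a_{\mathrm h}\nabla(\mathbf Nu))(x)=0$ for $x\in D_R$; $(\omega_{\mathrm h}\bar\nabla(\mathbf Nu))_{\mathbf n(x)}=[\mathbf S^*((\omega\bar\nabla u)_{\mathbf n})](x)-|\tilde\partial D_R|^{-1}\sum_{y\in\tilde\partial D_R}[\mathbf S^*((\omega\bar\nabla u)_{\mathbf n})](y)$ for $x\in\tilde\partial D_R$; and $\sum_{y\in\tilde\partial D_R}(u(y)-(\mathbf Nu)(y))=0$. It is assumed that for all $u:\overline D_R\to\mathbb R$ and $s\in\{\frac{2p}{p+1},\frac{2q}{q+1}\}$: $|\bar\nabla(\mathbf Nu)|_{s,E^\tau_R}\le c|\bar\nabla(\mathbf Nu)|_{s,E^\nu_R}$ and $|\bar\nabla(\mathbf Du)|_{s,E^\nu_R}\le c|\bar\nabla(\mathbf Du)|_{s,E^\tau_R}$; and with $m=\max\{\frac{4p}{p-1},\frac{4q}{q-1}\}$: $|\bar\nabla(\mathbf Du)|_{m,E_R}\le c|\bar\nabla(\mathbf Du)|_{m,E^\tau_R}$, $|\bar\nabla(\mathbf Nu)|_{m,E_R}\le c|\bar\nabla(\mathbf Nu)|_{m,E^\nu_R}$. For $r\in\{p,q\}$, $\alpha(r)$ is defined by $\frac1{\alpha(r)}=\frac{r-1}{2r}+\frac1{d-1}$ if $d\ge3$ and $\alpha(r)=1$ if $d=2$; it is assumed that $\inf_{a\in\mathbb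 R}|u-a|_{\frac{2r}{r-1},\partial D_R}\le cR|\bar\nabla u|_{\alpha(r),E^\tau_R}$ for all $r\in\{p,q\}$, $u:\partial D_R\to\mathbb R$. Definitions. $\theta(p,q)=1-(d-1)\big(\frac1{2p}+\frac1{2q}\big)$ if $d>2$ and $\theta(p,q)=\frac{(q-1)p}{q(p+1)}=\frac{1-1/q}{1+1/p}$ if $d=2$. For $u:\overline D_R\to\mathbb R$, $$\overline\Lambda(u)=\Big(\max\big\{|\omega\bar\nabla u|_{\frac{2p}{p+1},E^\tau_R},|\omega\bar\nabla u|_{\frac{2p}{p+1},E^\nu_R},|\bar\nabla u|_{\frac{2q}{q+1},E^\tau_R},|\bar\nabla u|_{\frac{2q}{q+1},E^\nu_R}\big\}\Big)^2 .$$ For $u,v:\overline D_R\to\mathbb R$, $\mathfrak B(u,v)=|\tilde\partial D_R|^{-1}\sum_{x\in\tilde\partial D_R}(u(x)-v(x))\,(\omega\bar\nabla u-\omega_{\mathrm h}\bar\nabla v)_{\mathbf n(x)}$. *)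

(* Defs.v *)
From HB Require Import structures.
From mathcomp Require Import all_boot all_order all_algebra.
From mathcomp Require Import finmap.
From mathcomp Require Import mathcomp_extra boolp classical_sets reals.
From mathcomp Require Import constructive_ereal ereal exp.
From mathcomp Require Import zify.

Set Implicit Arguments.
Unset Strict Implicit.
Unset Printing Implicit Defensive.
Import Order.TTheory GRing.Theory Num.Theory.
Local Open Scope fset_scope.
Local Open Scope ring_scope.

Notation Zd d := 'rV[int]_d.
Notation oedge d := ('rV[int]_d * 'rV[int]_d)%type.

Definition unitv (d : nat) (i : 'I_d) : Zd d := delta_mx 0 i.

Definition supnorm (d : nat) (x : Zd d) : nat := (\max_(i < d) `|x 0%R i|)%N.

(* |x - y| = 1 for the Euclidean norm, squared so as to stay in nat. *)
Definition adjacent (d : nat) (x y : Zd d) : bool :=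
  (\sum_(i < d) `|(x - y)%R 0%R i| ^ 2 == 1)%N.

(* The closed box {|x|_oo <= n}, listed explicitly; see mem_box. *)
Definition box (d n : nat) : {fset Zd d} :=
  [fset \row_i (Posz (f i) - Posz n) |
    f : {ffun 'I_d -> 'I_(n.*2.+1)} in predT].

Definition obox (d n : nat) : {fset Zd d} :=
  [fset x in box d n | (supnorm x < n)%N].

Definition bdry (d n : nat) : {fset Zd d} :=
  [fset x in box d n | supnorm x == n].

(* |x + y|_oo / 2 < n, without halves.  All such edges join points of the
   closed box when 0 < n; see mem_edges. *)
Definition edges (d n : nat) : {fset oedge d} :=
  [fset e in box d n `*` box d n |
    adjacent e.1 e.2 && (supnorm (e.1 + e.2) < n.*2)%N].

Definition tedges (d n : nat) : {fset oedge d} :=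
  [fset e in bdry d n `*` bdry d n | adjacent e.1 e.2].

Definition nedges (d n : nat) : {fset oedge d} :=
  [fset e in obox d n `*` bdry d n | adjacent e.1 e.2].

Definition tbdry (d n : nat) : {fset Zd d} :=
  [fset y in bdry d n | [exists x : obox d n, adjacent (val x) y]].

(* The edge of [nedges d n] ending at [y], meaningful for y in [tbdry d n];
   see normalP and normal_uniq. *)
Definition normal (d n : nat) (y : Zd d) : oedge d :=
  if [pick e : nedges d n | (val e).2 == y] is Some e then val e else (y, y).

(* Functions on a finite set are finite functions, a real vector space (hence
   R^o); [ext] reads them as functions on the lattice.  The value 0 outside of
   the set is never relevant below. *)
Definition ext (R : realType) (d : nat) (A : {fset Zd d}) (f : {ffun A -> R^o})
  (x : Zd d) : R := oapp f 0 (insub x).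

Definition restr (R : realType) (d : nat) (A : {fset Zd d}) (f : Zd d -> R) :
  {ffun A -> R^o} := [ffun x : A => f (val x)].

Definition indic1 (R : realType) (d : nat) (A : {fset Zd d}) (x : Zd d) :
  {ffun A -> R^o} := [ffun z : A => (val z == x)%:R].

Definition anorm (R : realType) (T : choiceType) (s : R) (A : {fset T})
  (f : T -> R) : R :=
  ((#|` A|%:R)^-1 * \sum_(x <- A) `|f x| `^ s) `^ s^-1.

Definition maxnorm (R : realType) (T : choiceType) (A : {fset T})
  (f : T -> R) : R := \big[Num.max/0]_(x <- A) `|f x|.

Definition grad (R : realType) (d : nat) (u : Zd d -> R) (e : oedge d) : R :=
  u e.2 - u e.1.

(* Conductances are functions of the unordered edge {x, y}; values at sets
   that are not nearest-neighbour edges are never used. *)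
Definition environment (R : realType) (d : nat) (w : {fset Zd d} -> R) : Prop :=
  forall x y : Zd d, adjacent x y -> 0 < w [fset x; y].

Definition flux (R : realType) (d : nat) (w : {fset Zd d} -> R)
  (u : Zd d -> R) (e : oedge d) : R := w [fset e.1; e.2] * grad u e.

Definition along_normal (R : realType) (d n : nat) (F : oedge d -> R) :
  {ffun tbdry d n -> R^o} := restr (tbdry d n) (fun y => F (normal n y)).

Definition nabla (R : realType) (d : nat) (i : 'I_d) (u : Zd d -> R)
  (x : Zd d) : R := u (x + unitv i) - u x.

Definition nabla_star (R : realType) (d : nat) (i : 'I_d) (u : Zd d -> R)
  (x : Zd d) : R := u (x - unitv i) - u x.

Definition divgrad (R : realType) (d : nat) (a : 'M[R]_d) (u : Zd d -> R)
  (x : Zd d) : R :=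
  \sum_(i < d) nabla_star i (fun y => \sum_(j < d) a i j * nabla j u y) x.

(* r / (r + 1), r / (r - 1) and 1 / r, read as 1, 1 and 0 for r = +oo. *)
Definition over_p1 (R : realType) (r : \bar R) : R :=
  if r is EFin s then s / (s + 1) else 1.

Definition over_m1 (R : realType) (r : \bar R) : R :=
  if r is EFin s then s / (s - 1) else 1.

Definition einv (R : realType) (r : \bar R) : R :=
  if r is EFin s then s^-1 else 0.

Definition alpha (R : realType) (d : nat) (r : \bar R) : R :=
  if (3 <= d)%N then ((2 * over_m1 r)^-1 + (d%:R - 1)^-1)^-1 else 1.

Definition theta (R : realType) (d : nat) (p q : \bar R) : R :=
  if (2 < d)%N then 1 - (d%:R - 1) * (einv p / 2 + einv q / 2)
  else (1 - einv q) / (1 + einv p).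

Definition Sstar (R : realType) (d n : nat)
  (S M : {ffun bdry d n -> R^o} -> {ffun bdry d n -> R^o})
  (h : {ffun tbdry d n -> R^o}) : {ffun tbdry d n -> R^o} :=
  restr (tbdry d n) (fun x =>
    \sum_(y <- tbdry d n) ext h y * ext (S (M (indic1 R (bdry d n) x))) y).

Definition Lambda (R : realType) (d n : nat) (p q : \bar R)
  (w : {fset Zd d} -> R) (u : {ffun box d n -> R^o}) : R :=
  Num.max
    (Num.max (anorm (2 * over_p1 p) (tedges d n) (flux w (ext u)))
             (anorm (2 * over_p1 p) (nedges d n) (flux w (ext u))))
    (Num.max (anorm (2 * over_p1 q) (tedges d n) (grad (ext u)))
             (anorm (2 * over_p1 q) (nedges d n) (grad (ext u)))) ^+ 2.

Definition Bform (R : realType) (d n : nat) (w wh : {fset Zd d} -> R)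
  (u v : {ffun box d n -> R^o}) : R :=
  (#|` tbdry d n|%:R)^-1 *
  \sum_(x <- tbdry d n) (ext u x - ext v x) *
    (flux w (ext u) (normal n x) - flux wh (ext v) (normal n x)).

Lemma supnorm_le (d n : nat) (x : Zd d) :
  (supnorm x <= n)%N = [forall i, `|x 0%R i| <= n]%N.
Proof.
by apply/bigmax_leqP/forallP => [h i|h i _]; [exact: h|exact: h].
Qed.

Lemma mem_box (d n : nat) (x : Zd d) : (x \in box d n) = (supnorm x <= n)%N.
Proof.
rewrite supnorm_le; apply/imfsetP/forallP => [[f _ ->] i|h].
  by rewrite mxE; move: (nat_of_ord (f i)) (ltn_ord (f i)) => k; rewrite -addnn; lia.
have hb i : (`|(x 0%R i + Posz n)%R| < n.*2.+1)%N by have := h i; rewrite -addnn; lia.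
exists [ffun i => Ordinal (hb i)] => //.
by apply/rowP => i; rewrite mxE ffunE /=; have := h i; lia.
Qed.

Lemma mem_obox (d n : nat) (x : Zd d) : (x \in obox d n) = (supnorm x < n)%N.
Proof. rewrite !inE /= mem_box; lia. Qed.

Lemma mem_bdry (d n : nat) (x : Zd d) : (x \in bdry d n) = (supnorm x == n).
Proof. rewrite !inE /= mem_box; lia. Qed.

Lemma adjacentP (d : nat) (x y : Zd d) : adjacent x y ->
  exists2 i, (`|x 0%R i - y 0%R i|)%N = 1%N & forall j, j != i -> x 0%R j = y 0%R j.
Proof.
move=> /eqP h.
have [i hi] : exists i, (`|(x - y)%R 0%R i| ^ 2 != 0)%N.
  apply/existsP; apply: contra_eqT h => /existsPn h.
  by rewrite big1// => i _; apply/eqP; have := h i; rewrite negbK.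
move: h; rewrite (bigD1 i)//= => h.
have h0 : (\sum_(j < d | j != i) `|(x - y)%R 0%R j| ^ 2 = 0)%N.
  have aux (a b : nat) : (a + b = 1 -> a != 0 -> b = 0)%N by lia.
  exact: aux h hi.
have sq (a : nat) : (a ^ 2 = 1 -> a = 1)%N by nia.
exists i; first by move: h; rewrite h0 addn0 !mxE => /sq.
move=> j ji; move/eqP: h0; rewrite sum_nat_eq0 => /forallP/(_ j).
by rewrite ji /= expn_eq0 andbT !mxE absz_eq0 subr_eq0 => /eqP.
Qed.

Lemma mem_edges (d n : nat) (e : oedge d) : (0 < n)%N ->
  (e \in edges d n) = adjacent e.1 e.2 && (supnorm (e.1 + e.2) < n.*2)%N.
Proof.
case: e => x y n0; rewrite !inE /= !mem_box andbC.
case: (boolP (adjacent x y)) => //= /adjacentP[i hi hj].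
case: (ltnP (supnorm (x + y)) n.*2) => //= hs.
have {}hs : (supnorm (x + y) <= n.*2.-1)%N by lia.
move: hs; rewrite supnorm_le => /forallP hs.
have key j : (`|x 0%R j| <= n)%N && (`|y 0%R j| <= n)%N.
  have := hs j; rewrite mxE; have [->|ji] := eqVneq j i.
    move: hi; move: (x 0 i) (y 0 i) => a b; lia.
  by rewrite (hj _ ji); move: (y 0 j) => a; lia.
by rewrite !supnorm_le; apply/andP; split; apply/forallP => j;
  have /andP[] := key j.
Qed.

Lemma mem_tedges (d n : nat) (e : oedge d) : (e \in tedges d n) =
  [&& e.1 \in bdry d n, e.2 \in bdry d n & adjacent e.1 e.2].
Proof. by rewrite !inE /= -!andbA. Qed.

Lemma mem_nedges (d n : nat) (e : oedge d) : (e \in nedges d n) =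
  [&& e.1 \in obox d n, e.2 \in bdry d n & adjacent e.1 e.2].
Proof. by rewrite !inE /= -!andbA. Qed.

Lemma normal_uniq (d n : nat) (x x' y : Zd d) :
  (x, y) \in nedges d n -> (x', y) \in nedges d n -> x = x'.
Proof.
rewrite !mem_nedges /= !mem_obox !mem_bdry.
move=> /and3P[xn /eqP yn /adjacentP[i hi hj]].
move=> /and3P[x'n _ /adjacentP[k hk hl]].
have n0 : (0 < n)%N by lia.
have key (z : Zd d) l : (supnorm z < n)%N -> (`|z 0%R l - y 0%R l|)%N = 1%N ->
    (forall j, j != l -> z 0%R j = y 0%R j) -> (`|y 0%R l|)%N = n /\
    forall j, j != l -> (`|y 0%R j| < n)%N.
  move=> zn zl zj.
  have {}zn : (supnorm z <= n.-1)%N by lia.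
  move: zn; rewrite supnorm_le => /forallP zn.
  have yj j : j != l -> (`|y 0%R j| < n)%N.
    by move=> jl; rewrite -zj//; have := zn j; lia.
  split=> //; apply/eqP; rewrite eqn_leq; apply/andP; split.
    by have := zn l; lia.
  rewrite leqNgt; apply/negP => yl.
  have : (supnorm y <= n.-1)%N.
    rewrite supnorm_le; apply/forallP => j; have [->|jl] := eqVneq j l; first by lia.
    by have := yj _ jl; lia.
  by lia.
have [yi _] := key _ _ xn hi hj; have [yk ykj] := key _ _ x'n hk hl.
have ik : i = k by apply/eqP/negP => /negP /ykj; lia.
subst k; apply/rowP => j; have [->|ji] := eqVneq j i; last by rewrite hj// hl.
have {}xn : (supnorm x <= n.-1)%N by lia.
have {}x'n : (supnorm x' <= n.-1)%N by lia.
move: xn x'n; rewrite !supnorm_le => /forallP/(_ i) a /forallP/(_ i) b.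
lia.
Qed.

Lemma normalP (d n : nat) (y : Zd d) : y \in tbdry d n ->
  (normal n y \in nedges d n) && ((normal n y).2 == y).
Proof.
rewrite in_fset/= => /andP[yb /existsP[x xy]]; rewrite /normal.
case: pickP => [e ->|/= h]; first by rewrite fsvalP.
have xyn : (val x, y) \in nedges d n by rewrite mem_nedges /= fsvalP yb.
by have := h [` xyn]; rewrite /= eqxx.
Qed.

(* Main.v *)
Require Import Defs.
From HB Require Import structures.
From mathcomp Require Import all_boot all_order all_algebra.
From mathcomp Require Import finmap.
From mathcomp Require Import mathcomp_extra boolp classical_sets reals.
From mathcomp Require Import constructive_ereal ereal exp.
From mathcomp Require Import topology normedtype derive realfun interval_inference.
From mathcomp Require Import zify ring lra.

Set Implicit Arguments.
Unset Strict Implicit.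
Unset Printing Implicit Defensive.
Import Order.TTheory GRing.Theory Num.Theory.
Import numFieldNormedType.Exports.
Local Open Scope fset_scope.
Local Open Scope ring_scope.

(** Both forms pair a smoothing error with a flux. In case (i), [D u] has the boundary values of
    [S u], so the form pairs [u - S u] with the normal flux of [u] minus that of [D u]; Hölder is
    applied with exponents 2r/(r-1) and 2r/(r+1), for r = p with the first flux and r = q with the
    second. In case (ii), [Sstar] is adjoint to the composition of [S] and [M] ([Sstar_adjoint]) and
    [u - N u] has mean zero, so the form pairs the normal flux of [u] with [M f - S (M f)], where f
    = u - N u. The gradient of [N u] is then controlled by duality from the flux of [u].

    Everything rests on a smoothing bound on the boundary, [boundary_smoothing]: with P = 2p/(p-1)
    and s = 2q/(q+1), the L^P norm of f - S f is at most K c^2 R eps^theta times the L^s norm of the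
    tangential gradient. It interpolates between two properties of S: the error is at most c eps R
    |grad f|_P and at most (1 + c) |f|_P. To this end f is split into a part with gradient in L^P
    and a remainder that is small in L^P.

    For d >= 3 the regular part is the graph resolvent (1 + tau L)^(-1) f with tau of order (c R
    eps)^2. The boundary of a box is nonnegatively curved in the sense of [coupling]
    ([transport_coupling]), hence |grad res f| <= res |grad f| pointwise ([gradient_resolvent]), and
    gradients inherit the bounds of the resolvent from L^s to L^P; these follow from
    Gagliardo-Nirenberg inequalities and an energy argument ([energy_le], [resolvent_wnorm_le]). The
    remainder is of order sqrt tau in L^s ([pseudo_poincare]), its gradient is bounded in L^s
    ([enorm_sub_resolvent_le]), and Gagliardo-Nirenberg again leads to L^P. For d = 2 the boundary
    is a cycle, and it is enough to truncate the derivative at a suitable height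
    ([cutoff_smoothing]).

    The constant 8 c^8 can be reached because [c] cannot be close to 1: testing the Sobolev
    hypothesis with two opposite corners, or with two half cycles if d = 2, gives c >= 2, or at
    least c >= 17/10 when d >= 9. With this information [smoothing_regime] closes the numerical
    inequalities. *)

Section RealPowers.
Variable R : realType.
Implicit Types (a b c g h k s t x y z mu : R).

(** * Inequalities for real powers and signed powers *)

Lemma powR_leq a b s : 0 <= s -> 0 <= a -> a <= b -> a `^ s <= b `^ s.
Proof.
by move=> s0 a0 ab; apply: ge0_ler_powR => //; rewrite nnegrE// (le_trans a0).
Qed.

Lemma powRK a s : s != 0 -> 0 <= a -> (a `^ s) `^ s^-1 = a.
Proof. by move=> s0 a0; rewrite -powRrM divff// powRr1. Qed.

Lemma powRVK a s : s != 0 -> 0 <= a -> (a `^ s^-1) `^ s = a.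
Proof. by move=> s0 a0; rewrite -powRrM mulVf// powRr1. Qed.

Lemma powRV a s : 0 <= a -> a^-1 `^ s = (a `^ s)^-1.
Proof. by move=> a0; rewrite -powR_inv1// -powRrM mulN1r powRN. Qed.

Lemma powR_ge1 a s : 1 <= a -> 0 <= s -> 1 <= a `^ s.
Proof. by move=> a1 s0; rewrite -[leLHS](powRr0 a) ler_powR. Qed.

Lemma powR_le1 a s : 0 <= a <= 1 -> 0 <= s -> a `^ s <= 1.
Proof. by move=> /andP[a0 a1] s0; have := powR_leq s0 a0 a1; rewrite powR1. Qed.

Lemma powR_young a b t : 0 <= a -> 0 <= b -> 0 <= t <= 1 ->
  a `^ t * b `^ (1 - t) <= t * a + (1 - t) * b.
Proof.
move=> a0 b0 /andP[t0 t1].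
have [->|tn0] := eqVneq t 0.
  by rewrite powRr0 subr0 powRr1// mul0r !mul1r add0r.
have [->|tn1] := eqVneq t 1.
  by rewrite subrr powRr0 powRr1// mulr1 mul1r mul0r addr0.
have tp : 0 < t by rewrite lt_def tn0.
have tp' : 0 < 1 - t by rewrite subr_gt0 lt_def eq_sym tn1.
have := @conjugate_powR R (a `^ t) (b `^ (1 - t)) t^-1 (1 - t)^-1
  (powR_ge0 _ _) (powR_ge0 _ _).
rewrite !invr_gt0 tp tp' !invrK => /(_ isT isT).
rewrite addrC subrK => /(_ erefl); rewrite !powRK ?gt_eqF//.
by rewrite [a * t]mulrC [b * _]mulrC.
Qed.

Lemma bernoulli_ge s x : 1 <= s -> -1 <= x -> 1 + s * x <= (1 + x) `^ s.
Proof.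
move=> s1 x1; have s0 : 0 < s by exact: lt_le_trans s1.
have x0 : 0 <= 1 + x by rewrite addrC -lerBlDr sub0r.
have := @powR_young ((1 + x) `^ s) 1 s^-1 (powR_ge0 _ _) ler01.
rewrite invr_ge0 ltW//= invf_le1// s1 => /(_ isT).
rewrite powR1 mulr1 powRK ?gt_eqF// mulr1.
move=> key; have := ler_wpM2l (ltW s0) key.
have -> : s * (s^-1 * (1 + x) `^ s + (1 - s^-1)) = (1 + x) `^ s + s - 1.
  by field; rewrite gt_eqF.
by lra.
Qed.

Lemma bernoulli_le s x : 0 <= s <= 1 -> -1 <= x -> (1 + x) `^ s <= 1 + s * x.
Proof.
move=> s1 x1; have x0 : 0 <= 1 + x by lra.
by have := powR_young x0 ler01 s1; rewrite powR1 mulr1; lra.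
Qed.

(** After division by [a + b] both summands lie in [0, 1], where an exponent at least 1 only
    decreases them. *)
Lemma powR_superadd a b s : 1 <= s -> 0 <= a -> 0 <= b ->
  a `^ s + b `^ s <= (a + b) `^ s.
Proof.
move=> s1 a0 b0; have s0 : 0 < s by exact: lt_le_trans s1.
have [ab0|ab0] := eqVneq (a + b) 0.
  have -> : a = 0 by lra.
  have -> : b = 0 by lra.
  by rewrite addr0 powR0 ?gt_eqF// addr0.
have abp : 0 < a + b by rewrite lt_def ab0 addr_ge0.
have key c : 0 <= c -> c <= a + b -> c `^ s <= c / (a + b) * (a + b) `^ s.
  move=> c0 cab; have [->|cn0] := eqVneq c 0.
    by rewrite powR0 ?gt_eqF// mul0r mul0r.
  have -> : c `^ s = (c / (a + b)) `^ s * (a + b) `^ s.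
    by rewrite -powRM ?divr_ge0 ?(ltW abp)// divfK.
  apply: ler_wpM2r; first exact: powR_ge0.
  apply: ge1r_powR => //; rewrite divr_gt0 ?[0 < c]lt_def ?cn0//=.
  by rewrite ler_pdivrMr// mul1r.
have := lerD (key a a0 _) (key b b0 _); rewrite -mulrDl -mulrDl divff// mul1r.
by apply; lra.
Qed.

(* [y |-> y^(g-1)] is concave, so its mean over an interval is at most its
   value at the midpoint. *)
Lemma powR_midpoint g h : 1 <= g <= 2 -> 0 <= h <= 1 ->
  (1 + h) `^ g - (1 - h) `^ g <= 2 * g * h.
Proof.
move=> /andP[g1 g2] /andP[h0 h1].
have g0 : 0 < g by lra.
have [->|gn1] := eqVneq g 1; first by rewrite !powRr1; lra.
pose f (x : R) := (1 + x) `^ g - (1 - x) `^ g - 2 * g * x.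
pose df (x : R) := g * (1 + x) `^ (g - 1) + g * (1 - x) `^ (g - 1) - 2 * g.
have fder x : -1 < x < 1 -> is_derive x 1 f (df x).
  move=> /andP[xN x1].
  have p1 : 0 < 1 + x by lra.
  have p2 : 0 < 1 - x by lra.
  have D1 : is_derive x 1 (fun y : R => 1 + y) 1.
    by have := is_deriveD (is_derive_cst (1 : R) x 1) (is_derive_id x (1 : R)); rewrite add0r.
  have D2 : is_derive x 1 (fun y : R => 1 - y) (-1).
    by have := is_deriveB (is_derive_cst (1 : R) x 1) (is_derive_id x (1 : R)); rewrite sub0r.
  have E1 := is_derive1_powR g p1; have E2 := is_derive1_powR g p2.
  have F1 : is_derive x 1 (fun y : R => (1 + y) `^ g) (g * (1 + x) `^ (g - 1)).
    have := @is_derive1_comp R (fun y : R => y `^ g) (fun y : R => 1 + y) x _ _ E1 D1.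
    by rewrite mulr1.
  have F2 : is_derive x 1 (fun y : R => (1 - y) `^ g) (- (g * (1 - x) `^ (g - 1))).
    have := @is_derive1_comp R (fun y : R => y `^ g) (fun y : R => 1 - y) x _ _ E2 D2.
    by rewrite mulrN1.
  have F3 : is_derive x 1 (fun y : R => 2 * g * y) (2 * g).
    by have := is_deriveZ (2 * g) (is_derive_id x (1 : R)); rewrite /GRing.scale/= mulr1.
  rewrite /df -[X in _ + X - _](opprK (g * (1 - x) `^ (g - 1))).
  exact: is_deriveB (is_deriveB F1 F2) F3.
have [->|hn0] := eqVneq h 0; first by rewrite addr0 subr0 subrr mulr0.
have hp : 0 < h by rewrite lt_def hn0.
have fh k : 0 < k < 1 -> (1 + k) `^ g - (1 - k) `^ g <= 2 * g * k.
  move=> /andP[k0 k1].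
  have cont : {within `[0, k], continuous f}%classic.
    apply: derivable_within_continuous => x; rewrite in_itv/= => /andP[x0 xk].
    have xx : -1 < x < 1 by apply/andP; split; lra.
    by have [] := fder x xx.
  have der x : x \in `]0, k[%R -> is_derive x 1 f (df x).
    by rewrite in_itv/= => /andP[x0 xk]; apply: fder; apply/andP; split; lra.
  have [y] := MVT k0 der cont.
  rewrite in_itv/= => /andP[y0 yk].
  have -> : f 0 = 0 by rewrite /f addr0 subr0 powR1 mulr0 subr0 subrr.
  have dfy : df y <= 0.
    rewrite /df.
    have gg : 0 <= g - 1 <= 1 by apply/andP; split; lra.
    have b1 := bernoulli_le gg (_ : -1 <= y).
    have b2 := bernoulli_le gg (_ : -1 <= - y).
    have {}b1 : (1 + y) `^ (g - 1) <= 1 + (g - 1) * y by apply: b1; lra.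
    have {}b2 : (1 - y) `^ (g - 1) <= 1 + (g - 1) * - y by apply: b2; lra.
    have := ler_wpM2l (ltW g0) (lerD b1 b2); rewrite mulrDr; lra.
  move=> E; have : f k <= 0 by rewrite -[f k]subr0 E subr0 mulr_le0_ge0// ltW.
  by rewrite /f; lra.
(* At the endpoint the base [1 - h] vanishes and [fder] does not apply; what remains is 2^g <= 2 g,
   by Bernoulli with exponent g - 1. *)
have [->|hn1] := eqVneq h 1; last by apply: fh; rewrite hp lt_def eq_sym hn1.
rewrite subrr powR0 ?gt_eqF// subr0 mulr1.
have : (1 + 1) `^ (g - 1) <= 1 + (g - 1) * 1 by apply: bernoulli_le; [lra|lra].
move=> b; have -> : (1 + 1) `^ g = (1 + 1) * (1 + 1) `^ (g - 1) :> R.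
  by rewrite mulr_powRB1//; lra.
by lra.
Qed.

(** With exponent [s - 1] this is the unnormalised duality map of L^s: see [mul_sgpow]. *)
Definition sgpow s x : R := Num.sg x * `|x| `^ s.

Lemma sgpowN s x : sgpow s (- x) = - sgpow s x.
Proof. by rewrite /sgpow sgrN normrN mulNr. Qed.

Lemma norm_sgpow s x : s != 0 -> `|sgpow s x| = `|x| `^ s.
Proof.
move=> s0; rewrite /sgpow normrM normr_sg [X in _ * X]ger0_norm ?powR_ge0//.
by have [->|_] := eqVneq x 0; rewrite ?mul1r// normr0 powR0// mulr0.
Qed.

Lemma norm_sgpow_le s x : `|sgpow s x| <= `|x| `^ s.
Proof.
rewrite /sgpow normrM normr_sg [X in _ * X]ger0_norm ?powR_ge0//.
by rewrite ler_piMl ?powR_ge0//; case: (x != 0).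
Qed.

Lemma sgpow_ge0 s x : 0 <= x -> s != 0 -> sgpow s x = x `^ s.
Proof.
move=> x0 s0; rewrite /sgpow ger0_norm//; have [->|xn0] := eqVneq x 0.
  by rewrite powR0// mulr0.
by rewrite gtr0_sg ?mul1r// lt_def xn0.
Qed.

Lemma mul_sgpow s x : 0 < s -> x * sgpow (s - 1) x = `|x| `^ s.
Proof.
by move=> s0; rewrite /sgpow mulrA [x * _]mulrC -normrEsg mulr_powRB1.
Qed.

(** Sum of the two tangent line inequalities at the midpoint, each a rescaled Bernoulli inequality;
    the slopes cancel. *)
Lemma powR_half_convex a b s : 1 <= s -> 0 <= a -> 0 <= b ->
  ((a + b) / 2) `^ s <= (a `^ s + b `^ s) / 2.
Proof.
move=> s1 a0 b0; have s0 : 0 < s by lra.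
set m := (a + b) / 2; have [m0|m0] := eqVneq m 0.
  by rewrite m0 powR0 ?gt_eqF// divr_ge0// addr_ge0// powR_ge0.
have mp : 0 < m by rewrite lt_def m0 divr_ge0// addr_ge0.
have tangent c : 0 <= c -> m `^ s * (1 + s * (c / m - 1)) <= c `^ s.
  move=> c0; have -> : c `^ s = m `^ s * (1 + (c / m - 1)) `^ s.
    have cm : 0 <= c / m by apply: divr_ge0 => //; exact: ltW.
    by rewrite [1 + _]addrC subrK -(powRM _ (ltW mp) cm) mulrC divfK.
  rewrite ler_pM2l ?powR_gt0//; apply: bernoulli_ge => //.
  have : 0 <= c / m by rewrite divr_ge0// ltW.
  by lra.
have := lerD (tangent a a0) (tangent b b0); rewrite -mulrDr.
have -> : 1 + s * (a / m - 1) + (1 + s * (b / m - 1)) = 2.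
  have : a / m + b / m = 2 by rewrite -mulrDl /m invfM invrK mulrA divff ?mul1r//; move: m0; rewrite /m mulf_eq0 negb_or => /andP[].
  by nra.
by lra.
Qed.

(** For z = (G + W) / W and after multiplication by |W|^s this reads k |G|^s + mu G W |W|^(s-2) <=
    |G + W|^s. If the middle term has nonnegative integral, G is bounded by G + W in L^s with
    constant k^(-1/s). *)
Definition centering k mu s :=
  forall z, k * `|z - 1| `^ s + mu * (z - 1) <= `|z| `^ s.

Lemma centering_half s : 1 <= s <= 2 -> centering 2^-1 (s / 2) s.
Proof.
move=> /andP[s1 s2] z; have s0 : 0 < s by lra.
have [z1|z1] := leP 1 z.
  have z0 : 0 <= z by lra.
  have z10 : 0 <= z - 1 by lra.
  rewrite !ger0_norm//.
  have := powR_superadd s1 z10 ler01; rewrite subrK powR1.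
  have := @bernoulli_ge s (z - 1) s1 ltac:(lra); rewrite [1 + (z - 1)]addrC subrK.
  by lra.
have [z0|z0] := leP 0 z.
  rewrite ler0_norm; last by lra.
  rewrite opprB.
  have : (1 - z) `^ s <= 1 - z by apply: ge1r_powR => //; lra.
  have := powR_ge0 `|z| s; have : 0 <= (s - 1) * (1 - z) by apply: mulr_ge0; lra.
  by lra.
have y0 : 0 <= - z by lra.
rewrite !ltr0_norm//; last by lra.
set y := - z; have -> : - (z - 1) = 1 + y by rewrite /y; lra.
have {}y0 : 0 <= y by rewrite /y; lra.
have -> : z - 1 = - (1 + y) by rewrite /y; lra.
have h1 := powR_half_convex s1 ler01 y0; rewrite powR1 in h1.
have h2 : 2 `^ s <= 2 * s.
  rewrite -(mulr_powRB1 (ler0n R 2) s0).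
  have := @bernoulli_le (s - 1) 1; rewrite mulr1 => h; have := h ltac:(lra) ltac:(lra).
  by rewrite (_ : 1 + 1 = 2 :> R)//; lra.
have h3 : (1 + y) `^ s = 2 `^ s * ((1 + y) / 2) `^ s.
  by rewrite -powRM ?divr_ge0 ?addr_ge0// mulrC divfK.
have p0 := powR_ge0 ((1 + y) / 2) s; have p1 := powR_ge0 y s.
have h4 := ler_wpM2r p0 h2.
rewrite h3; have := ler_wpM2l (ltW s0) h1.
have : s * y `^ s <= 2 * y `^ s by apply: ler_wpM2r.
have : 0 <= s * y by apply: mulr_ge0 => //; lra.
by lra.
Qed.

(** A better [k] for s >= 4/3, that is s = 2/(1 + r) with r <= 1/2. It serves in the term of the
    final bound that carries the highest power of [c]. *)
Lemma centering_seven_tenths s : 4 / 3 <= s <= 2 -> centering (7 / 10) (23 / 25) s.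
Proof.
move=> /andP[s1 s2] z; have s0 : 0 < s by lra.
have [z1|z1] := ltP 1 z.
  have g0 : 0 < z - 1 by lra.
  rewrite !ger0_norm; [|lra|lra]; move: (z - 1) g0 (subrK 1 z) => g g0 <-.
  have y0 : 0 < g^-1 by rewrite invr_gt0.
  have gs0 : 0 < g `^ s by exact: powR_gt0.
  have -> : (g + 1) `^ s = g `^ s * (1 + g^-1) `^ s.
    rewrite -powRM ?(ltW g0)//; last by rewrite addr_ge0// ltW.
    by rewrite mulrDr divff ?gt_eqF// mulr1.
  have eg : g = g `^ s * g^-1 `^ (s - 1).
    rewrite powRV ?(ltW g0)// -{1}(mulr_powRB1 (ltW g0) s0) mulfK//.
    by rewrite gt_eqF// powR_gt0.
  move: (g^-1) y0 eg => y y0 eg.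
  suff key : 7 / 10 + 23 / 25 * y `^ (s - 1) <= (1 + y) `^ s.
    by have := ler_wpM2l (ltW gs0) key; lra.
  have [y1|y1] := leP y 1.
    have := @bernoulli_ge s y ltac:(lra) ltac:(lra).
    have h1 : y `^ (s - 1) <= y `^ (3^-1).
      by apply: ger_powR; [rewrite y0 y1|lra].
    have h2 : (y `^ 3^-1) ^+ 3 = y.
      by rewrite -powR_mulrn ?powR_ge0// powRVK// ltW.
    have t0 := powR_ge0 y (3^-1).
    have hs : 4 / 3 * y <= s * y by apply: ler_wpM2r; lra.
    suff : 7 / 10 + 23 / 25 * y `^ 3^-1 <= 1 + 4 / 3 * y by lra.
    rewrite -[X in 4 / 3 * X]h2; move: (y `^ 3^-1) t0 => t t0.
    (* The cubic with a double root at 12/25, close to the minimiser of 4/3 t^3 - 23/25 t. *)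
    have : 0 <= (t - 12 / 25) ^+ 2 * (t + 24 / 25) by rewrite mulr_ge0 ?sqr_ge0//; lra.
    by nra.
  have h1 : (1 + y) * y `^ (s - 1) <= (1 + y) `^ s.
    rewrite -[leRHS]mulr_powRB1//; last by lra.
    by apply: ler_wpM2l; [lra|apply: powR_leq; lra].
  have h2 : 1 <= y `^ (s - 1) by apply: powR_ge1; lra.
  by nra.
have [z0|z0] := leP 0 z.
  rewrite ler0_norm; last by lra.
  rewrite opprB.
  have : (1 - z) `^ s <= 1 - z.
    have [->|zn] := eqVneq z 1; first by rewrite subrr powR0// gt_eqF.
    by apply: ge1r_powR; lra.
  by have := powR_ge0 `|z| s; lra.
have y0 : 0 <= - z by lra.
rewrite !ltr0_norm//; last by lra.
set y := - z; have -> : - (z - 1) = 1 + y by rewrite /y; lra.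
have {}y0 : 0 <= y by rewrite /y; lra.
have -> : z - 1 = - (1 + y) by rewrite /y; lra.
have w0 : 0 < 1 + y by lra.
set v := (1 + y)^-1.
have v0 : 0 < v by rewrite invr_gt0.
have v1 : v <= 1 by rewrite invf_le1//; lra.
have ws0 : 0 < (1 + y) `^ s by exact: powR_gt0.
have e1 : y `^ s = (1 + y) `^ s * (1 - v) `^ s.
  rewrite -powRM//; [|exact: ltW|lra].
  by rewrite mulrBr mulr1 divff ?gt_eqF// addrC addKr.
have e2 : 1 + y = (1 + y) `^ s * v `^ (s - 1).
  rewrite powRV ?(ltW w0)// -{1}(mulr_powRB1 (ltW w0) s0) mulfK//.
  by rewrite gt_eqF// powR_gt0.
have h1 : v <= v `^ (s - 1) by apply: ger1_powR; [rewrite v0 v1|lra].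
have h2 : (1 - v) ^+ 2 <= (1 - v) `^ s.
  have [->|vn] := eqVneq v 1; first by rewrite subrr expr0n/= powR_ge0.
  rewrite -powR_mulrn; last by lra.
  by apply: ger_powR => //; lra.
suff key : 7 / 10 <= (1 - v) `^ s + 23 / 25 * v `^ (s - 1).
  by have := ler_wpM2l (ltW ws0) key; lra.
(* By [h1] and [h2] the right side is at least 1 - 27/25 v + v^2, which is minimal at v = 27/50 with
   value 0.7084. *)
have := sqr_ge0 (v - 27 / 50); rewrite !expr2 in h2 *; lra.
Qed.

Lemma centering_scaled k mu s G W : 1 < s -> 0 <= k <= 1 -> centering k mu s ->
  k * `|G| `^ s + mu * (G * sgpow (s - 1) W) <= `|G + W| `^ s.
Proof.
move=> s1 /andP[k0 k1] cent; have s0 : 0 < s by lra.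
have [->|W0] := eqVneq W 0.
  rewrite /sgpow sgr0 mul0r !mulr0 !addr0.
  by rewrite ler_piMl// powR_ge0.
have Wp : 0 < `|W| by rewrite normr_gt0.
have := cent (1 + G / W).
rewrite [1 + G / W]addrC addrK -(ler_pM2l (powR_gt0 s Wp)) mulrDr mulrCA.
rewrite -!powRM// -!normrM [W * (G / W)]mulrC divfK// => h.
have -> : G + W = W * (G / W + 1) by rewrite mulrDr mulr1 [W * (G / W)]mulrC divfK.
apply: le_trans h; rewrite -(mul_sgpow W s0).
suff -> : W * sgpow (s - 1) W * (mu * (G / W)) = mu * (G * sgpow (s - 1) W) by [].
by field.
Qed.
End RealPowers.

(* Locked: unification would otherwise compare real powers by computation. *)
HB.lock Definition wnorm (R : realType) (T : finType) (mu : T -> R) (s : R) (f : T -> R) : R :=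
  (\sum_t mu t * `|f t| `^ s) `^ s^-1.

(** * Weighted L^s norms on a finite set: Hölder, duality, removal of the mean *)

Section WeightedNorms.
Variable R : realType.

Lemma wnormE (T : finType) (mu : T -> R) (s : R) (f : T -> R) :
  wnorm mu s f = (\sum_t mu t * `|f t| `^ s) `^ s^-1.
Proof. by rewrite unlock. Qed.

Definition wsum (T : finType) (mu : T -> R) (f : T -> R) : R :=
  \sum_t mu t * f t.

Section Theory.
Variables (T : finType) (mu : T -> R).
Hypothesis mu_ge0 : forall t, 0 <= mu t.
Implicit Types (f g h : T -> R) (a b r s c : R).

Lemma wnorm_ge0 s f : 0 <= wnorm mu s f.
Proof. by rewrite wnormE powR_ge0. Qed.

Lemma wnorm_sum_ge0 s f : 0 <= \sum_t mu t * `|f t| `^ s.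
Proof. by apply: sumr_ge0 => t _; rewrite mulr_ge0// powR_ge0. Qed.

Lemma wnorm_powR s f : s != 0 ->
  wnorm mu s f `^ s = \sum_t mu t * `|f t| `^ s.
Proof. by move=> s0; rewrite wnormE powRVK// wnorm_sum_ge0. Qed.

Lemma wnorm_eq s f g : (forall t, mu t != 0 -> `|f t| = `|g t|) ->
  wnorm mu s f = wnorm mu s g.
Proof.
move=> fg; rewrite !wnormE; congr (_ `^ _); apply: eq_bigr => t _.
by have [->|mt] := eqVneq (mu t) 0; rewrite ?mul0r// fg.
Qed.

Lemma ler_wnorm s f g : 0 <= s -> (forall t, mu t != 0 -> `|f t| <= `|g t|) ->
  wnorm mu s f <= wnorm mu s g.
Proof.
move=> s0 fg; rewrite !wnormE; apply: powR_leq; [by rewrite invr_ge0|exact: wnorm_sum_ge0|].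
apply: ler_sum => t _; have [->|mt] := eqVneq (mu t) 0; first by rewrite !mul0r.
by apply: ler_wpM2l => //; apply: powR_leq => //; exact: fg.
Qed.

Lemma wnormZ s c f : s != 0 -> wnorm mu s (fun t => c * f t) = `|c| * wnorm mu s f.
Proof.
move=> s0; rewrite !wnormE.
have -> : \sum_t mu t * `|c * f t| `^ s = `|c| `^ s * \sum_t mu t * `|f t| `^ s.
  by rewrite mulr_sumr; apply: eq_bigr => t _; rewrite normrM powRM// mulrCA.
by rewrite powRM ?powR_ge0 ?wnorm_sum_ge0// powRK.
Qed.

Lemma wnormN s f : wnorm mu s (fun t => - f t) = wnorm mu s f.
Proof. by apply: wnorm_eq => t _; rewrite normrN. Qed.

Lemma wnorm_norm_powR s c f : 0 < c -> s != 0 ->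
  wnorm mu s (fun t => `|f t| `^ c) = wnorm mu (c * s) f `^ c.
Proof.
move=> c0 s0; have e : s^-1 = (c * s)^-1 * c by field; rewrite s0 gt_eqF.
have -> : wnorm mu s (fun t => `|f t| `^ c) = (\sum_t mu t * `|f t| `^ (c * s)) `^ s^-1.
  rewrite wnormE; congr (_ `^ _); apply: eq_bigr => t _.
  by rewrite ger0_norm ?powR_ge0// -powRrM.
by rewrite wnormE {1}e powRrM.
Qed.

Lemma wnorm_eq0 s f : 0 < s -> wnorm mu s f = 0 ->
  forall t, mu t != 0 -> f t = 0.
Proof.
rewrite wnormE => s0 /powR_eq0_eq0 /eqP.
rewrite psumr_eq0; last by move=> t _; rewrite mulr_ge0// powR_ge0.
move=> /allP h t mt; have := h t (mem_index_enum t) => /=.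
by rewrite mulf_eq0 (negbTE mt)/= powR_eq0 (gt_eqF s0) andbT normr_eq0 => /eqP.
Qed.

Lemma hoelder_sum a b f g : 0 < a -> 0 < b -> a^-1 + b^-1 = 1 ->
  \sum_t mu t * (`|f t| * `|g t|) <= wnorm mu a f * wnorm mu b g.
Proof.
move=> a0 b0 ab.
have [A0|A0] := eqVneq (wnorm mu a f) 0.
  rewrite A0 mul0r big1// => t _; have [->|mt] := eqVneq (mu t) 0.
    by rewrite mul0r.
  by rewrite (wnorm_eq0 a0 A0 mt) normr0 mul0r mulr0.
have [B0|B0] := eqVneq (wnorm mu b g) 0.
  rewrite B0 mulr0 big1// => t _; have [->|mt] := eqVneq (mu t) 0.
    by rewrite mul0r.
  by rewrite (wnorm_eq0 b0 B0 mt) normr0 !mulr0.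
have Ap : 0 < wnorm mu a f by rewrite lt_def A0 wnorm_ge0.
have Bp : 0 < wnorm mu b g by rewrite lt_def B0 wnorm_ge0.
have := wnorm_powR f (lt0r_neq0 a0); have := wnorm_powR g (lt0r_neq0 b0).
move: (wnorm mu a f) (wnorm mu b g) Ap Bp {A0 B0} => A B Ap Bp EB' EA'.
rewrite -[leRHS]mulr1 -ler_pdivrMl ?(mulr_gt0 Ap Bp)// -[leRHS]ab.
have EA : \sum_t mu t * (`|f t| / A) `^ a = 1.
  rewrite (eq_bigr (fun t => (A `^ a)^-1 * (mu t * `|f t| `^ a))); last first.
    by move=> t _; rewrite powRM ?invr_ge0 ?(ltW Ap)// powRV ?(ltW Ap)// mulrA mulrC.
  by rewrite -mulr_sumr -EA' mulVf// gt_eqF// powR_gt0.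
have EB : \sum_t mu t * (`|g t| / B) `^ b = 1.
  rewrite (eq_bigr (fun t => (B `^ b)^-1 * (mu t * `|g t| `^ b))); last first.
    by move=> t _; rewrite powRM ?invr_ge0 ?(ltW Bp)// powRV ?(ltW Bp)// mulrA mulrC.
  by rewrite -mulr_sumr -EB' mulVf// gt_eqF// powR_gt0.
have -> : a^-1 + b^-1 = \sum_t mu t * ((`|f t| / A) `^ a / a + (`|g t| / B) `^ b / b).
  have -> : \sum_t mu t * ((`|f t| / A) `^ a / a + (`|g t| / B) `^ b / b) =
      (\sum_t mu t * (`|f t| / A) `^ a) * a^-1 + (\sum_t mu t * (`|g t| / B) `^ b) * b^-1.
    by rewrite 2!mulr_suml -big_split/=; apply: eq_bigr => t _; rewrite mulrDr !mulrA.
  by rewrite EA EB !mul1r.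
rewrite mulr_sumr; apply: ler_sum => t _.
rewrite mulrCA; apply: ler_wpM2l => //.
have := @conjugate_powR R (`|f t| / A) (`|g t| / B) a b
  (divr_ge0 (normr_ge0 _) (ltW Ap)) (divr_ge0 (normr_ge0 _) (ltW Bp)) a0 b0 ab.
by rewrite invfM [X in _ -> X <= _]mulrC mulrACA.
Qed.

Lemma hoelder_wsum a b f g : 0 < a -> 0 < b -> a^-1 + b^-1 = 1 ->
  `|wsum mu (fun t => f t * g t)| <= wnorm mu a f * wnorm mu b g.
Proof.
move=> a0 b0 ab; apply: le_trans (hoelder_sum f g a0 b0 ab).
apply: le_trans (ler_norm_sum _ _ _) _; apply: ler_sum => t _.
by rewrite !normrM (ger0_norm (mu_ge0 t)).
Qed.

Lemma hoelder_wnorm r a b f g : 0 < r -> 0 < a -> 0 < b ->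
  r^-1 = a^-1 + b^-1 ->
  wnorm mu r (fun t => f t * g t) <= wnorm mu a f * wnorm mu b g.
Proof.
move=> r0 a0 b0 rab.
have rn0 : r != 0 by rewrite gt_eqF.
have key : \sum_t mu t * `|f t * g t| `^ r
    <= wnorm mu a f `^ r * wnorm mu b g `^ r.
  have := @hoelder_sum (a / r) (b / r) (fun t => `|f t| `^ r)
    (fun t => `|g t| `^ r) (divr_gt0 a0 r0) (divr_gt0 b0 r0).
  rewrite !invf_div -mulrDr -rab divff// => /(_ erefl).
  rewrite (@wnorm_norm_powR (a / r) r f r0 (lt0r_neq0 (divr_gt0 a0 r0))).
  rewrite (@wnorm_norm_powR (b / r) r g r0 (lt0r_neq0 (divr_gt0 b0 r0))).
  rewrite ![r * (_ / r)]mulrC !divfK//; apply: le_trans.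
  apply: ler_sum => t _; apply: ler_wpM2l => //.
  by rewrite normrM powRM// (ger0_norm (powR_ge0 `|f t| r)) (ger0_norm (powR_ge0 `|g t| r)).
rewrite -powRM ?wnorm_ge0// in key.
rewrite -[leRHS](powRK rn0) ?mulr_ge0 ?wnorm_ge0//.
by rewrite wnormE; apply: powR_leq => //; [rewrite invr_ge0 ltW|exact: wnorm_sum_ge0].
Qed.

Lemma wnorm_interp r a b l f : 0 < r -> 0 < a -> 0 < b -> 0 <= l <= 1 ->
  r^-1 = (1 - l) / a + l / b ->
  wnorm mu r f <= wnorm mu a f `^ (1 - l) * wnorm mu b f `^ l.
Proof.
move=> r0 a0 b0 /andP[l0 l1] rab.
have [le0|ln0] := eqVneq l 0.
  move: rab; rewrite le0 subr0 mul1r mul0r addr0 => /invr_inj ->.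
  by rewrite (powRr0 (wnorm mu b f)) mulr1 (powRr1 (wnorm_ge0 a f)).
have [le1|ln1] := eqVneq l 1.
  move: rab; rewrite le1 subrr mul1r mul0r add0r => /invr_inj ->.
  by rewrite (powRr0 (wnorm mu a f)) mul1r (powRr1 (wnorm_ge0 b f)).
have lp : 0 < l by rewrite lt_def ln0.
have lp' : 0 < 1 - l by rewrite subr_gt0 lt_def eq_sym ln1.
have := @hoelder_wnorm r (a / (1 - l)) (b / l) (fun t => `|f t| `^ (1 - l))
  (fun t => `|f t| `^ l) r0 (divr_gt0 a0 lp') (divr_gt0 b0 lp).
rewrite !invf_div => /(_ rab).
rewrite (@wnorm_norm_powR (a / (1 - l)) (1 - l) f lp' (lt0r_neq0 (divr_gt0 a0 lp'))).
rewrite (@wnorm_norm_powR (b / l) l f lp (lt0r_neq0 (divr_gt0 b0 lp))).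
rewrite [(1 - l) * _]mulrC [l * _]mulrC !divfK ?(gt_eqF lp) ?(gt_eqF lp')//.
apply: le_trans.
apply: ler_wnorm => [|t _]; first exact: ltW.
rewrite -powRD; last by rewrite subrK oner_eq0.
by rewrite subrK powRr1// normr_id.
Qed.

Lemma wnorm1 c s : s != 0 -> \sum_t mu t = 1 -> wnorm mu s (fun=> c) = `|c|.
Proof. by move=> s0 mu1; rewrite wnormE -mulr_suml mu1 mul1r powRK. Qed.

Lemma wnorm_mono a b f : \sum_t mu t = 1 -> 0 < a -> a <= b ->
  wnorm mu a f <= wnorm mu b f.
Proof.
move=> mu1 a0; rewrite le_eqVlt => /predU1P[->//|ab].
have b0 : 0 < b by exact: lt_trans ab.
have d0 : 0 < a^-1 - b^-1 by rewrite subr_gt0 ltf_pV2.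
have := @hoelder_wnorm a b (a^-1 - b^-1)^-1 f (fun=> 1) a0 b0.
rewrite invr_gt0 invrK => /(_ d0); rewrite addrC subrK => /(_ erefl).
rewrite wnorm1 ?invr_eq0 ?gt_eqF// normr1 mulr1; apply: le_trans.
by rewrite le_eqVlt (@wnorm_eq a _ f) ?eqxx// => t _; rewrite mulr1.
Qed.

(** Converse of Hölder: the test function is the duality map of [f], whose L^b norm is the L^a norm
    of [f] to the power [a - 1]. Minkowski's inequality and the bounds for adjoint operators below
    all go through it. *)
Lemma wnorm_dual a b K f : 1 < a -> 0 < b -> a^-1 + b^-1 = 1 -> 0 <= K ->
  (forall g, wsum mu (fun t => f t * g t) <= K * wnorm mu b g) ->
  wnorm mu a f <= K.
Proof.
move=> a1 b0 ab K0 fK; have a0 : 0 < a by lra.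
have ab1 : (a - 1) * b = a.
  have : a * b = a + b.
    rewrite -[RHS](mulfK (mulf_neq0 (lt0r_neq0 a0) (lt0r_neq0 b0))).
    have -> : (a + b) * (a * b) / (a * b) = (a^-1 + b^-1) * (a * b).
      by field; rewrite !gt_eqF.
    by rewrite ab mul1r.
  by move=> h; rewrite mulrBl mul1r h addrK.
have a10 : 0 < a - 1 by lra.
have := fK (fun t => sgpow (a - 1) (f t)).
have -> : wsum mu (fun t => f t * sgpow (a - 1) (f t)) = wnorm mu a f `^ a.
  rewrite wnorm_powR ?gt_eqF//; apply: eq_bigr => t _; by rewrite mul_sgpow.
have -> : wnorm mu b (fun t => sgpow (a - 1) (f t)) = wnorm mu a f `^ (a - 1).
  rewrite -{2}ab1 -wnorm_norm_powR ?gt_eqF//.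
  apply: wnorm_eq => t _; rewrite norm_sgpow ?gt_eqF//.
  by rewrite [RHS]ger0_norm ?powR_ge0.
have [->//|An0] := eqVneq (wnorm mu a f) 0.
have Ap : 0 < wnorm mu a f by rewrite lt_def An0 wnorm_ge0.
by rewrite -(mulr_powRB1 (ltW Ap) a0) ler_pM2r ?powR_gt0.
Qed.

Lemma conjugate_exponent a : 1 < a -> 1 < a / (a - 1) /\ a^-1 + (a / (a - 1))^-1 = 1.
Proof.
move=> a1; have a0 : a - 1 != 0 by rewrite gt_eqF//; lra.
split; first by rewrite ltr_pdivlMr; lra.
by rewrite invf_div; field; rewrite gt_eqF//; lra.
Qed.

Lemma minkowski_wnorm a f g : 1 < a ->
  wnorm mu a (fun t => f t + g t) <= wnorm mu a f + wnorm mu a g.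
Proof.
move=> a1; have [b1 ab] := conjugate_exponent a1.
have a0 : 0 < a by lra. have b0 : 0 < a / (a - 1) by lra.
apply: (wnorm_dual a1 b0 ab); first by rewrite addr_ge0 ?wnorm_ge0.
move=> h; rewrite /wsum (eq_bigr (fun t => mu t * (f t * h t) + mu t * (g t * h t))).
  rewrite big_split/= mulrDl lerD//;
    by apply: le_trans (ler_norm _) (hoelder_wsum _ _ a0 b0 ab).
by move=> t _; rewrite mulrDl mulrDr.
Qed.

(* If [F = G + W] and [G] pairs nonnegatively with the duality map of [W], then
   [G] is controlled by [F] with a constant better than the triangle inequality's. *)
Lemma centering_wnorm k nu s F G W : 1 < s -> 0 < k <= 1 -> 0 <= nu ->
  centering k nu s -> (forall t, mu t != 0 -> F t = G t + W t) ->
  0 <= wsum mu (fun t => G t * sgpow (s - 1) (W t)) ->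
  wnorm mu s G <= k^-1 `^ s^-1 * wnorm mu s F.
Proof.
move=> s1 /andP[k0 k1] nu0 cent FGW orth; have s0 : 0 < s by lra.
have k01 : 0 <= k <= 1 by rewrite ltW.
have h : k * \sum_t mu t * `|G t| `^ s <= \sum_t mu t * `|F t| `^ s.
  apply: le_trans (_ : k * (\sum_t mu t * `|G t| `^ s) +
     nu * wsum mu (fun t => G t * sgpow (s - 1) (W t)) <= _).
    by rewrite lerDl mulr_ge0.
  rewrite /wsum !mulr_sumr -big_split/=; apply: ler_sum => t _.
  have [->|mt] := eqVneq (mu t) 0; first by rewrite !mul0r !mulr0 addr0.
  rewrite mulrCA [X in _ + X]mulrCA -mulrDr; apply: ler_wpM2l => //.
  by rewrite FGW//; exact: centering_scaled.
rewrite !wnormE -powRM ?invr_ge0 ?(ltW k0) ?wnorm_sum_ge0//.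
apply: powR_leq; [by rewrite invr_ge0 ltW|exact: wnorm_sum_ge0|].
by rewrite ler_pdivlMl.
Qed.

(** [centering_wnorm] with W the constant mean: the duality map of a constant is constant, hence
    orthogonal to [f] minus its mean. For k = 1/2 the factor is 2^(1/s), against 2 from the triangle
    inequality. *)
Lemma wnorm_sub_mean k nu s f : 1 < s -> 0 < k <= 1 -> 0 <= nu ->
  centering k nu s -> \sum_t mu t = 1 ->
  wnorm mu s (fun t => f t - wsum mu f) <= k^-1 `^ s^-1 * wnorm mu s f.
Proof.
move=> s1 k1 nu0 cent mu1.
apply: (@centering_wnorm _ nu _ _ _ (fun=> wsum mu f)) => //.
  by move=> t _; rewrite subrK.
rewrite /wsum -/(wsum mu f).
rewrite (eq_bigr (fun t => (mu t * f t - mu t * wsum mu f) * sgpow (s - 1) (wsum mu f))).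
  by rewrite -mulr_suml sumrB -mulr_suml mu1 mul1r subrr mul0r.
by move=> t _; rewrite mulrA mulrBr.
Qed.

(** Removing the mean is self-adjoint and kills constants, so a bound for it on L^b passes to the
    conjugate L^a. This reaches exponents above 2, while the [centering] lemmas concern exponents up
    to 2. *)
Lemma wnorm_sub_mean_dual k nu a b f c : 1 < a -> 1 < b -> a^-1 + b^-1 = 1 ->
  0 < k <= 1 -> 0 <= nu -> centering k nu b -> \sum_t mu t = 1 ->
  wnorm mu a (fun t => f t - wsum mu f)
    <= k^-1 `^ b^-1 * wnorm mu a (fun t => f t - c).
Proof.
move=> a1 b1 ab k01 nu0 cent mu1.
have a0 : 0 < a by lra. have b0 : 0 < b by lra.
apply: (wnorm_dual a1 b0 ab).
  by rewrite mulr_ge0 ?powR_ge0 ?wnorm_ge0.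
move=> g.
have -> : wsum mu (fun t => (f t - wsum mu f) * g t) =
          wsum mu (fun t => (f t - c) * (g t - wsum mu g)).
  have E (u v : T -> R) x y : wsum mu (fun t => (u t - x) * (v t - y)) =
      wsum mu (fun t => u t * v t) - x * wsum mu v - y * wsum mu u + x * y.
    rewrite -[x * y]mul1r -mu1 mulr_suml /wsum !mulr_sumr -!sumrB -big_split/=.
    by apply: eq_bigr => t _; ring.
  have := E f g (wsum mu f) 0; rewrite (_ : (fun t => _ * (g t - 0)) =
     (fun t => (f t - wsum mu f) * g t)); last by apply/funext => t; rewrite subr0.
  by move=> ->; rewrite E; ring.
rewrite -mulrA mulrCA.
apply: le_trans (ler_norm _) _; apply: le_trans (hoelder_wsum _ _ a0 b0 ab) _.
apply: ler_wpM2l; first exact: wnorm_ge0.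
exact: (@wnorm_sub_mean _ nu).
Qed.

End Theory.

Lemma ler_wnorm_measure (T : finType) (mu nu : T -> R) (K s : R) (f : T -> R) :
  (forall t, 0 <= mu t) -> (forall t, 0 <= nu t) -> 0 <= K -> 0 < s ->
  (forall t, mu t <= K * nu t) -> wnorm mu s f <= K `^ s^-1 * wnorm nu s f.
Proof.
move=> mu0 nu0 K0 s0 munu; rewrite !wnormE -powRM ?wnorm_sum_ge0//.
apply: powR_leq; [by rewrite invr_ge0 ltW|exact: wnorm_sum_ge0|].
rewrite mulr_sumr; apply: ler_sum => t _; rewrite mulrA.
by apply: ler_wpM2r; rewrite ?powR_ge0.
Qed.

End WeightedNorms.

(** * The resolvent of the graph Laplacian *)

Section Resolvent.
Variables (R : realType) (V : finType) (e : rel V).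
Hypothesis e_sym : symmetric e.
Implicit Types (a b f g h u : V -> R) (x y z : V).

Definition degree x : R := \sum_(y | e x y) 1.

(** The operator 1 + tau L with the unnormalised graph Laplacian L; [resolvent] is its inverse. *)
Definition helmholtz (tau : R) a x : R := a x + tau * \sum_(y | e x y) (a x - a y).

Lemma helmholtzE tau a x : helmholtz tau a x =
  (1 + tau * degree x) * a x - tau * \sum_(y | e x y) a y.
Proof.
rewrite /helmholtz /degree sumrB mulrBr addrA; congr (_ - _).
by rewrite mulrDl mul1r -mulrA mulr_suml; under [in RHS]eq_bigr do rewrite mul1r.
Qed.

Lemma helmholtzD tau a b c x :
  helmholtz tau (fun y => a y + c * b y) x = helmholtz tau a x + c * helmholtz tau b x.
Proof.
rewrite /helmholtz (eq_bigr (fun y => (a x - a y) + c * (b x - b y))); last first.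
  by move=> y _; ring.
by rewrite big_split/= -mulr_sumr; ring.
Qed.

Lemma sum_edges_sym (F : V -> V -> R) :
  \sum_x \sum_(y | e x y) F x y = \sum_x \sum_(y | e x y) F y x.
Proof.
rewrite (exchange_big_dep predT)//=; apply: eq_bigr => y _.
by apply: eq_bigl => x; rewrite e_sym.
Qed.

Lemma sum_helmholtz tau a b : \sum_x a x * helmholtz tau b x =
  \sum_x a x * b x
  + tau / 2 * \sum_x \sum_(y | e x y) (a y - a x) * (b y - b x).
Proof.
rewrite /helmholtz; under eq_bigr do rewrite mulrDr mulrCA mulr_sumr.
rewrite big_split/=; congr (_ + _); rewrite -mulr_sumr -mulrA; congr (_ * _).
have h : \sum_x \sum_(y | e x y) a x * (b x - b y) =
    \sum_x \sum_(y | e x y) a y * (b y - b x) by rewrite sum_edges_sym.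
have : \sum_x \sum_(y | e x y) (a y - a x) * (b y - b x) =
    \sum_x \sum_(y | e x y) a y * (b y - b x) + \sum_x \sum_(y | e x y) a x * (b x - b y).
  rewrite -big_split/=; apply: eq_bigr => x _; rewrite -big_split/=.
  by apply: eq_bigr => y _; ring.
by rewrite -h => ->; field.
Qed.

Lemma helmholtz_sym tau a b :
  \sum_x a x * helmholtz tau b x = \sum_x b x * helmholtz tau a x.
Proof.
rewrite !sum_helmholtz; congr (_ + _ * _); first by apply: eq_bigr => x _; exact: mulrC.
by apply: eq_bigr => x _; apply: eq_bigr => y _; exact: mulrC.
Qed.

(** At a minimum of [a] the Laplacian term is nonpositive, so a negative minimum would make
    [helmholtz] negative there. *)
Lemma maximum_principle tau a : 0 <= tau ->
  (forall x, 0 <= helmholtz tau a x) -> forall x, 0 <= a x.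
Proof.
move=> tau0 h x.
have [x0 _ x0min] := @arg_minP _ R V x predT a isT.
apply: le_trans (x0min x isT); rewrite leNgt; apply/negP => a0.
have := h x0; rewrite leNgt => /negP; apply.
rewrite /helmholtz -[ltRHS](addr0 0) ltr_leD// mulr_ge0_le0//.
by apply: sumr_le0 => y _; rewrite subr_le0 x0min.
Qed.

Lemma helmholtz_inj tau a b : 0 <= tau ->
  helmholtz tau a =1 helmholtz tau b -> a =1 b.
Proof.
move=> tau0 ab x; apply/eqP; rewrite -subr_eq0 eq_le; apply/andP; split.
  rewrite -oppr_ge0 opprB; have : 0 <= b x + (-1) * a x; last by rewrite mulN1r.
  apply: (maximum_principle tau0 (a := fun y => b y + (-1) * a y)) => y.
  by rewrite helmholtzD ab mulN1r subrr.
have : 0 <= a x + (-1) * b x; last by rewrite mulN1r.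
apply: (maximum_principle tau0 (a := fun y => a y + (-1) * b y)) => y.
by rewrite helmholtzD ab mulN1r subrr.
Qed.

(** The same operator as an endomorphism of a finite-dimensional space, where injectivity
    ([helmholtz_inj]) yields the inverse that defines [green]. *)
Definition helmholtz_ffun tau (a : {ffun V -> R^o}) : {ffun V -> R^o} :=
  [ffun x => helmholtz tau a x].

Lemma helmholtz_ffun_linear tau : linear (helmholtz_ffun tau).
Proof.
move=> c a b; apply/ffunP => x; rewrite !ffunE.
have -> : (c *: a + b : {ffun V -> R^o}) = (fun y => b y + c * a y) :> (V -> R).
  by apply/funext => y; rewrite !ffunE addrC.
by rewrite helmholtzD addrC.
Qed.

HB.instance Definition _ tau := GRing.isLinear.Build R {ffun V -> R^o} {ffun V -> R^o}
  _ (helmholtz_ffun tau) (helmholtz_ffun_linear tau).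

Definition green tau x z : R :=
  ((linfun (helmholtz_ffun tau))^-1)%VF [ffun y => (y == z)%:R] x.

Definition resolvent tau u x : R := \sum_z green tau x z * u z.

Lemma helmholtz_green tau x z : 0 <= tau ->
  helmholtz tau (green tau ^~ z) x = (x == z)%:R.
Proof.
move=> tau0; have ker0 : lker (linfun (helmholtz_ffun tau)) == 0%VS.
  apply/lker0P => a b; rewrite !lfunE/= => ab; apply/ffunP.
  apply: (helmholtz_inj tau0) => y; by have /ffunP/(_ y) := ab; rewrite !ffunE.
have := lker0_lfunVK ker0 [ffun y => (y == z)%:R].
by rewrite lfunE/= => /ffunP/(_ x); rewrite !ffunE.
Qed.

Lemma helmholtz_sum (I : finType) tau (c : I -> R) (F : I -> V -> R) x :
  helmholtz tau (fun y => \sum_i c i * F i y) x = \sum_i c i * helmholtz tau (F i) x.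
Proof.
rewrite /helmholtz.
rewrite [RHS](eq_bigr (fun i => c i * F i x + tau * (\sum_(y | e x y) c i * (F i x - F i y)))).
  rewrite [RHS]big_split/=; congr (_ + _).
  rewrite -mulr_sumr exchange_big/=; congr (_ * _).
  by apply: eq_bigr => y _; rewrite -sumrB; apply: eq_bigr => i _; rewrite mulrBr.
by move=> i _; rewrite mulrDr [c i * (tau * _)]mulrCA [c i * \sum_(_ | _) _]mulr_sumr.
Qed.

Lemma resolventK tau u x : 0 <= tau -> helmholtz tau (resolvent tau u) x = u x.
Proof.
move=> tau0.
have -> : resolvent tau u = fun y => \sum_z u z * green tau y z.
  by apply/funext => y; apply: eq_bigr => z _; exact: mulrC.
rewrite helmholtz_sum (bigD1 x)//= helmholtz_green// eqxx mulr1.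
rewrite big1 ?addr0// => z zx; rewrite helmholtz_green// eq_sym (negbTE zx).
by rewrite mulr0.
Qed.

Lemma resolvent_unique tau a u : 0 <= tau -> helmholtz tau a =1 u ->
  a =1 resolvent tau u.
Proof.
by move=> tau0 au; apply: (helmholtz_inj tau0) => x; rewrite resolventK// au.
Qed.

Lemma green_ge0 tau x z : 0 <= tau -> 0 <= green tau x z.
Proof.
move=> tau0; apply: (maximum_principle tau0 (a := green tau ^~ z)) => y.
by rewrite helmholtz_green// ler0n.
Qed.

Lemma green_sum1 tau x : 0 <= tau -> \sum_z green tau x z = 1.
Proof.
move=> tau0; have E : helmholtz tau (fun=> 1) =1 (fun=> 1).
  by move=> y; rewrite /helmholtz big1 ?mulr0 ?addr0// => z _; exact: subrr.
have := resolvent_unique tau0 E x; rewrite /resolvent.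
by under eq_bigr do rewrite mulr1; move=> <-.
Qed.

Lemma resolvent_sym tau u h : 0 <= tau ->
  \sum_x resolvent tau u x * h x = \sum_x u x * resolvent tau h x.
Proof.
move=> tau0.
rewrite (eq_bigr (fun x => resolvent tau u x * helmholtz tau (resolvent tau h) x)).
  rewrite helmholtz_sym; apply: eq_bigr => x _.
  by rewrite resolventK// mulrC.
by move=> x _; rewrite resolventK.
Qed.

Lemma green_sym tau x z : 0 <= tau -> green tau x z = green tau z x.
Proof.
move=> tau0.
have delta y w : resolvent tau (fun v => (v == w)%:R) y = green tau y w.
  rewrite /resolvent (bigD1 w)//= eqxx mulr1 big1 ?addr0// => v /negbTE ->.
  by rewrite mulr0.
have := @resolvent_sym tau (fun v => (v == z)%:R) (fun v => (v == x)%:R) tau0.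
rewrite (bigD1 x)//= eqxx mulr1 big1 ?addr0 => [|v /negbTE ->]; last by rewrite mulr0.
rewrite (bigD1 z)//= eqxx mul1r big1 ?addr0 => [|v /negbTE ->]; last by rewrite mul0r.
by rewrite !delta.
Qed.

Lemma ler_resolvent tau u h x : 0 <= tau -> (forall y, u y <= h y) ->
  resolvent tau u x <= resolvent tau h x.
Proof.
by move=> tau0 uh; apply: ler_sum => z _; apply: ler_wpM2l; rewrite ?green_ge0.
Qed.

Lemma resolvent_ge0 tau u x : 0 <= tau -> (forall y, 0 <= u y) ->
  0 <= resolvent tau u x.
Proof. by move=> t0 u0; apply: sumr_ge0 => z _; rewrite mulr_ge0 ?green_ge0. Qed.

Lemma resolvent_le tau a u x : 0 <= tau -> (forall y, helmholtz tau a y <= u y) ->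
  a x <= resolvent tau u x.
Proof.
move=> tau0 au; rewrite [leLHS](resolvent_unique tau0 (fun=> erefl)).
exact: ler_resolvent.
Qed.

Lemma resolventD tau u h c x : resolvent tau (fun y => u y + c * h y) x =
  resolvent tau u x + c * resolvent tau h x.
Proof.
rewrite /resolvent mulr_sumr -big_split/=; apply: eq_bigr => z _.
by rewrite mulrDr mulrCA.
Qed.

Lemma resolventZ tau c u x : resolvent tau (fun y => c * u y) x = c * resolvent tau u x.
Proof.
by rewrite /resolvent mulr_sumr; apply: eq_bigr => z _; rewrite mulrCA.
Qed.

Lemma sum_resolvent tau u : 0 <= tau -> \sum_x resolvent tau u x = \sum_x u x.
Proof.
move=> tau0; have := @resolvent_sym tau u (fun=> 1) tau0.
under eq_bigr do rewrite mulr1; move=> ->; apply: eq_bigr => x _.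
rewrite /resolvent; under eq_bigr do rewrite mulr1.
by rewrite green_sum1// mulr1.
Qed.

(** The row [green tau x] is a probability measure, by [green_ge0] and [green_sum1]. *)
Lemma resolvent_jensen tau s u x : 0 <= tau -> 1 <= s ->
  `|resolvent tau u x| `^ s <= resolvent tau (fun y => `|u y| `^ s) x.
Proof.
move=> tau0 s1; have s0 : 0 < s by lra.
have g0 z : 0 <= green tau x z by exact: green_ge0.
have := @wnorm_mono R V (green tau x) g0 1 s u (green_sum1 x tau0) ltr01 s1.
rewrite {1}wnormE invr1 powRr1; last by apply: wnorm_sum_ge0.
under eq_bigr do rewrite powRr1//.
move=> h; have -> : resolvent tau (fun y => `|u y| `^ s) x =
    wnorm (green tau x) s u `^ s by rewrite wnorm_powR// gt_eqF.
apply: powR_leq; [exact: ltW|exact: normr_ge0|].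
apply: le_trans h; apply: le_trans (ler_norm_sum _ _ _) _.
by apply: ler_sum => z _; rewrite normrM (ger0_norm (g0 z)).
Qed.

Lemma resolvent_jensen2 tau u x : 0 <= tau ->
  resolvent tau u x ^+ 2 <= resolvent tau (fun y => u y ^+ 2) x.
Proof.
move=> tau0; have := @resolvent_jensen tau 2 u x tau0; rewrite ler1n => /(_ isT).
rewrite powR_mulrn// real_normK ?num_real// => /le_trans; apply.
by apply: ler_resolvent => // y; rewrite powR_mulrn// real_normK ?num_real.
Qed.

Lemma sum_resolvent_powR tau s u : 0 <= tau -> 1 <= s ->
  \sum_x `|resolvent tau u x| `^ s <= \sum_x `|u x| `^ s.
Proof.
move=> tau0 s1; rewrite -[leRHS](sum_resolvent _ tau0).
by apply: ler_sum => x _; exact: resolvent_jensen.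
Qed.

Lemma resolvent_energy tau u : 0 <= tau ->
  \sum_x resolvent tau u x * u x = \sum_x resolvent tau u x ^+ 2
  + tau / 2 * \sum_x \sum_(y | e x y) (resolvent tau u y - resolvent tau u x) ^+ 2.
Proof.
move=> tau0; rewrite (eq_bigr (fun x =>
  resolvent tau u x * helmholtz tau (resolvent tau u) x)) => [|x _].
  by rewrite sum_helmholtz.
by rewrite resolventK.
Qed.

Lemma resolvent_energy_ge0 tau u : 0 <= tau -> 0 <= \sum_x resolvent tau u x * u x.
Proof.
move=> tau0; rewrite resolvent_energy// addr_ge0// ?mulr_ge0 ?divr_ge0//.
  by apply: sumr_ge0 => x _; exact: sqr_ge0.
by apply: sumr_ge0 => x _; apply: sumr_ge0 => y _; exact: sqr_ge0.
Qed.

Lemma quadratic_discriminant (p q r : R) :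
  (forall t, 0 <= p + 2 * t * q + t ^+ 2 * r) -> q ^+ 2 <= p * r.
Proof.
move=> h; have [r0|r0] := eqVneq r 0.
  have [->|q0] := eqVneq q 0; first by rewrite r0 mulr0 expr0n.
  have := h (- (p + 1) / (2 * q)); rewrite r0 mulr0 addr0.
  have -> : p + 2 * (- (p + 1) / (2 * q)) * q = -1 by field.
  by lra.
have := h (- q / r).
have -> : p + 2 * (- q / r) * q + (- q / r) ^+ 2 * r = p - q ^+ 2 / r by field.
(* A negative leading coefficient is refuted by an explicit large [t], for which t r = r - p - 2
   |q|. *)
have r0' : 0 < r.
  rewrite lt_def r0/= leNgt; apply/negP => rn.
  have h1 := h 0; have h2 := h 1; have h3 := h (-1).
  have p0 : 0 <= p by lra.
  pose t := 1 + (p + 2 * `|q|) / - r.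
  have rp : 0 < - r by lra.
  have t1 : 1 <= t by rewrite lerDl divr_ge0 ?addr_ge0 ?mulr_ge0// ltW.
  have := h t; rewrite leNgt => /negP; apply.
  have tr : t * r = r - p - 2 * `|q| by rewrite /t; field; lra.
  have -> : t ^+ 2 * r = t * (r - p - 2 * `|q|) by rewrite -tr; ring.
  have qn : q <= `|q| by exact: ler_norm.
  have : t * q <= t * `|q| by apply: ler_wpM2l => //; lra.
  have : p * 1 <= p * t by apply: ler_wpM2l.
  have : t * r < 0 by rewrite nmulr_llt0//; lra.
  by lra.
by rewrite subr_ge0 ler_pdivrMr.
Qed.

(** The pairing of [res u] with [h] is a symmetric form, positive semidefinite by
    [resolvent_energy_ge0]. *)
Lemma resolvent_cauchy_schwarz tau u h : 0 <= tau ->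
  (\sum_x resolvent tau u x * h x) ^+ 2 <=
  (\sum_x resolvent tau u x * u x) * (\sum_x resolvent tau h x * h x).
Proof.
move=> tau0; apply: quadratic_discriminant => t.
have := resolvent_energy_ge0 (fun y => u y + t * h y) tau0.
under eq_bigr do rewrite resolventD.
rewrite (eq_bigr (fun x => resolvent tau u x * u x + t * (resolvent tau u x * h x)
  + t * (u x * resolvent tau h x) + t ^+ 2 * (resolvent tau h x * h x))); last first.
  by move=> x _; ring.
by rewrite !big_split/= -!mulr_sumr -resolvent_sym// => H; lra.
Qed.

End Resolvent.

(** * Two inequalities for finite sums *)

Section SumLemmas.
Variable R : realType.

Lemma cauchy_schwarz_sum (I : finType) (P : pred I) (f g : I -> R) :
  \sum_(i | P i) f i * g i <=
  Num.sqrt (\sum_(i | P i) f i ^+ 2) * Num.sqrt (\sum_(i | P i) g i ^+ 2).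
Proof.
have f0 : 0 <= \sum_(i | P i) f i ^+ 2 by apply: sumr_ge0 => i _; exact: sqr_ge0.
apply: le_trans (ler_norm _) _; rewrite -sqrtrM// -sqrtr_sqr; apply: ler_wsqrtr.
apply: quadratic_discriminant => t.
have : 0 <= \sum_(i | P i) (f i + t * g i) ^+ 2 by apply: sumr_ge0 => i _; exact: sqr_ge0.
rewrite (eq_bigr (fun i => f i ^+ 2 + 2 * t * (f i * g i) + t ^+ 2 * g i ^+ 2)).
  by rewrite !big_split/= -!mulr_sumr.
by move=> i _; ring.
Qed.

(** Serves to compare the edges transported to a vertex with all edges at that vertex. *)
Lemma sum_partial_injection (I J : finType) (P : pred I) (Q : pred J)
    (k : I -> option J) (h : J -> R) : (forall j, 0 <= h j) ->
  (forall i j, P i -> k i = Some j -> Q j) ->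
  (forall i i' j, P i -> P i' -> k i = Some j -> k i' = Some j -> i = i') ->
  \sum_(i | P i) oapp h 0 (k i) <= \sum_(j | Q j) h j.
Proof.
move=> h0 kQ kinj.
have -> : \sum_(i | P i) oapp h 0 (k i) =
    \sum_(i | P i) \sum_(j | Q j) (k i == Some j)%:R * h j.
  apply: eq_bigr => i Pi; case E : (k i) => [j|]/=; last by rewrite big1// => j _; rewrite mul0r.
  rewrite (bigD1 j) ?(kQ i)//= eqxx mul1r big1 ?addr0// => j' /andP[_ jj'].
  by rewrite (inj_eq Some_inj) eq_sym (negbTE jj') mul0r.
rewrite exchange_big/=; apply: ler_sum => j Qj; rewrite -mulr_suml.
rewrite -[leRHS]mul1r; apply: ler_wpM2r => //.
have [/existsP[i /andP[Pi /eqP ki]]|] := boolP [exists i, P i && (k i == Some j)].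
  rewrite (bigD1 i)//= ki eqxx big1 ?addr0// => i' /andP[Pi' ii'].
  by case: eqP => // ki'; rewrite (kinj i' i j)// eqxx in ii'.
move=> /existsPn no; rewrite big1 ?ler01// => i Pi.
by have := no i; rewrite Pi/= => /negbTE ->.
Qed.

End SumLemmas.

(* Discrete counterpart of nonnegative curvature: the neighbours [x'] of [x] are
   matched with those of [y] so that the edge [(x, y)] is transported to an edge
   [(x', z)], with [tr x x' y = Some z]; unmatched neighbours only help. *)
Definition coupling (R : realType) (V : finType) (e : rel V)
    (tr : V -> V -> V -> option V) : Prop :=
  [/\ forall x x' y z, e x x' -> e x y -> tr x x' y = Some z -> e x' z,
      forall x x' y1 y2 z, e x x' -> e x y1 -> e x y2 ->
        tr x x' y1 = Some z -> tr x x' y2 = Some z -> y1 = y2 &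
      forall x y, e x y -> exists2 zeta : R, 0 <= zeta & forall a : V -> R,
        \sum_(y' | e y y') (a y - a y') - \sum_(x' | e x x') (a x - a x') =
        \sum_(x' | e x x') ((a y - a x) - oapp (fun z => a z - a x') 0 (tr x x' y))
        + zeta * (a y - a x)].

Definition gradient_norm (R : realType) (V : finType) (e : rel V) (u : V -> R) x : R :=
  Num.sqrt (\sum_(y | e x y) (u y - u x) ^+ 2).

(** * Gradient bounds for the resolvent under a coupling *)

Section Coupling.
Variables (R : realType) (V : finType) (e : rel V).
Hypothesis e_sym : symmetric e.
Variable tr : V -> V -> V -> option V.
Hypothesis tr_coupling : coupling R e tr.
Implicit Types (a u : V -> R) (x y z : V).

Let transported a x x' y : R := oapp (fun z => a z - a x') 0 (tr x x' y).

(** A discrete Bochner formula: the difference of the resolvent equations at the two ends of an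
    edge, rearranged by the coupling. *)
Lemma resolvent_edge_equation (tau : R) u x y : 0 <= tau -> e x y ->
  let a := resolvent e tau u in
  exists2 zeta : R, 0 <= zeta & u y - u x = a y - a x +
    tau * (\sum_(x' | e x x') ((a y - a x) - transported a x x' y) + zeta * (a y - a x)).
Proof.
move=> tau0 exy a; have [_ _ /(_ x y exy)[zeta z0 /(_ a) eqn]] := tr_coupling.
exists zeta => //; rewrite -eqn.
by rewrite -(resolventK e u x tau0) -(resolventK e u y tau0) /helmholtz -/a; ring.
Qed.

(** A discrete Bakry-Emery estimate. The edge equation is multiplied by [a y - a x] and summed over
    y. For fixed x' the transported edges are distinct edges at x', so Cauchy-Schwarz bounds their
    contribution by [w x * w x']. Division by [w x] gives [helmholtz] of [w] <= [gradient_norm e u],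
    and the maximum principle concludes. *)
Lemma gradient_resolvent (tau : R) u x : 0 <= tau ->
  gradient_norm e (resolvent e tau u) x <= resolvent e tau (gradient_norm e u) x.
Proof.
move=> tau0; apply: resolvent_le => //.
move=> {}x; set a := resolvent e tau u; set w := gradient_norm e a.
have [edge inj _] := tr_coupling.
have sq z : w z ^+ 2 = \sum_(y | e z y) (a y - a z) ^+ 2.
  by rewrite sqr_sqrtr//; apply: sumr_ge0 => y _; exact: sqr_ge0.
have w0 z : 0 <= w z by exact: sqrtr_ge0.
have key : (1 + tau * degree R e x) * w x ^+ 2 <=
    w x * (gradient_norm e u x + tau * \sum_(x' | e x x') w x').
  rewrite sq mulr_sumr.
  apply: (@le_trans _ _ (\sum_(y | e x y) ((a y - a x) * (u y - u x)
      + tau * \sum_(x' | e x x') (a y - a x) * transported a x x' y))).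
    apply: ler_sum => y exy.
    have [zeta z0 ->] := resolvent_edge_equation u tau0 exy; rewrite -/a.
    rewrite -mulr_sumr sumrB.
    have -> : \sum_(i | e x i) (a y - a x) = degree R e x * (a y - a x).
      by rewrite /degree mulr_suml; apply: eq_bigr => i _; rewrite mul1r.
    have : 0 <= tau * zeta * (a y - a x) ^+ 2 by rewrite mulr_ge0 ?sqr_ge0 ?mulr_ge0.
    by nra.
  rewrite big_split/= mulrDr; apply: lerD; first exact: cauchy_schwarz_sum.
  rewrite -mulr_sumr mulrCA; apply: ler_wpM2l => //.
  rewrite exchange_big/= mulr_sumr; apply: ler_sum => x' exx'.
  apply: le_trans (cauchy_schwarz_sum _ _ _) _; apply: ler_wpM2l => //.
  apply: ler_wsqrtr.
  have := @sum_partial_injection R V V (e x) (e x') (tr x x')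
     (fun z => (a z - a x') ^+ 2) (fun=> sqr_ge0 _).
  move=> h; apply: le_trans (h _ _).
  - apply: ler_sum => y _; rewrite /transported.
    by case: (tr x x' y) => //=; rewrite expr0n.
  - by move=> y z exy; apply: edge.
  - by move=> y1 y2 z; apply: inj.
rewrite helmholtzE; have [wx0|wx0] := eqVneq (w x) 0.
  rewrite wx0 mulr0 sub0r (le_trans _ (sqrtr_ge0 _))// oppr_le0 mulr_ge0//.
  by apply: sumr_ge0.
have wp : 0 < w x by rewrite lt_def wx0 w0.
by rewrite lerBlDr -(ler_pM2l wp); rewrite expr2 mulrCA in key.
Qed.

(** By the edge equation the first factor is tau times a sum of edge differences minus transported
    ones. Young's inequality replaces the products by powers |a y - a x|^s, and after summation over
    the graph injectivity of the transport shows that the transported powers do not exceed the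
    original ones. *)
Lemma resolvent_duality_map (tau s : R) a u : 0 <= tau -> 1 < s ->
  a = resolvent e tau u ->
  0 <= \sum_x \sum_(y | e x y)
    ((u y - u x) - (a y - a x)) * sgpow (s - 1) (a y - a x).
Proof.
move=> tau0 s1 Ea; have s0 : 0 < s by lra.
have [edge inj _] := tr_coupling.
pose W x y := `|a y - a x| `^ s.
pose W' x x' y := `|transported a x x' y| `^ s.
have young (p q : R) : q * sgpow (s - 1) p <= s^-1 * `|q| `^ s + (1 - s^-1) * `|p| `^ s.
  have [b1 sb] := conjugate_exponent s1; have b0 : 0 < s / (s - 1) by lra.
  have := conjugate_powR (normr_ge0 q) (powR_ge0 `|p| (s - 1)) s0 b0 sb.
  rewrite -powRrM [(s - 1) * _]mulrC divfK; last by rewrite gt_eqF//; lra.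
  have -> : (s / (s - 1))^-1 = 1 - s^-1 by move: sb; set z := (s / (s - 1))^-1; lra.
  rewrite [_ `^ s / s]mulrC [_ `^ s * (1 - _)]mulrC; apply: le_trans.
  by apply: le_trans (ler_norm _) _; rewrite normrM ler_wpM2l// norm_sgpow_le.
apply: (@le_trans _ _ (\sum_x \sum_(y | e x y)
    tau * (s^-1 * \sum_(x' | e x x') (W x y - W' x x' y)))); last first.
  apply: ler_sum => x _; apply: ler_sum => y exy.
  have [zeta z0 ->] := resolvent_edge_equation u tau0 exy; rewrite -Ea.
  rewrite addrC addKr -mulrA; apply: ler_wpM2l => //.
  rewrite mulrDl -mulrA mul_sgpow// mulr_suml mulr_sumr.
  apply: ler_wpDr; first by rewrite mulr_ge0 ?powR_ge0.
  apply: ler_sum => x' _; rewrite mulrBl mul_sgpow//.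
  by have := young (a y - a x) (transported a x x' y); rewrite /W /W'; lra.
have -> : \sum_x \sum_(y | e x y) tau * (s^-1 * \sum_(x' | e x x') (W x y - W' x x' y)) =
    tau * (s^-1 * (\sum_x \sum_(x' | e x x') \sum_(y | e x y) W x y
    - \sum_x \sum_(x' | e x x') \sum_(y | e x y) W' x x' y)).
  rewrite -sumrB !mulr_sumr; apply: eq_bigr => x _.
  rewrite -!mulr_sumr; congr (_ * (_ * _)).
  by rewrite exchange_big -sumrB; apply: eq_bigr => x' _; rewrite sumrB.
rewrite !mulr_ge0 ?invr_ge0 ?(ltW s0)// subr_ge0.
rewrite [leRHS](sum_edges_sym e_sym).
apply: ler_sum => x _; apply: ler_sum => x' exx'.
have := @sum_partial_injection R V V (e x) (e x') (tr x x')
  (fun z => W x' z) (fun=> powR_ge0 _ _).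
move=> h; apply: le_trans (h _ _).
- apply: ler_sum => y _; rewrite /W' /transported.
  by case: (tr x x' y) => //=; rewrite normr0 powR0// gt_eqF.
- by move=> y z exy; apply: edge.
- by move=> y1 y2 z; apply: inj.
Qed.

End Coupling.

(** * A chain rule inequality for signed powers *)

Section SignedPowers.
Variable R : realType.
Implicit Types (a b g h : R).

Lemma powR_sub_midpoint g a b : 1 <= g <= 2 -> 0 <= b -> b <= a ->
  a `^ g - b `^ g <= g * (a - b) * ((a + b) / 2) `^ (g - 1).
Proof.
move=> g12 b0 ba; have g0 : 0 < g by lra.
have [m0|m0] := eqVneq (a + b) 0.
  have -> : a = 0 by lra.
  have -> : b = 0 by lra.
  by rewrite powR0 ?gt_eqF// !subr0 mulr0 mul0r.
set m := (a + b) / 2; set h := (a - b) / (a + b).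
have mp : 0 < m by rewrite /m; lra.
have hh : 0 <= h <= 1.
  by apply/andP; split; [apply: divr_ge0; lra|rewrite ler_pdivrMr; lra].
have ea : a = m * (1 + h) by rewrite /m /h; field.
have eb : b = m * (1 - h) by rewrite /m /h; field.
have /andP[h0 h1] := hh.
have -> : a `^ g = m `^ g * (1 + h) `^ g by rewrite -powRM ?(ltW mp) -?ea//; lra.
have -> : b `^ g = m `^ g * (1 - h) `^ g by rewrite -powRM ?(ltW mp) -?eb//; lra.
have -> : g * (a - b) * m `^ (g - 1) = m `^ g * (2 * g * h).
  by rewrite -(mulr_powRB1 (ltW mp) g0) ea eb; ring.
by rewrite -mulrBr; apply: ler_wpM2l; [exact: powR_ge0|exact: powR_midpoint].
Qed.

Lemma powR_add_midpoint g a b : 1 <= g <= 2 -> 0 <= a -> 0 <= b ->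
  a `^ g + b `^ g <= g * (a + b) * ((a + b) / 2) `^ (g - 1).
Proof.
move=> g12 a0 b0; have g0 : 0 < g by lra.
have g1 : 1 <= g by lra.
apply: le_trans (powR_superadd g1 a0 b0) _.
have ab0 : 0 <= a + b by exact: addr_ge0.
have -> : (a + b) `^ g = (a + b) * (2 `^ (g - 1) * ((a + b) / 2) `^ (g - 1)).
  rewrite -powRM ?divr_ge0// [2 * _]mulrC divfK ?pnatr_eq0//.
  by rewrite mulr_powRB1.
have h2 : 2 `^ (g - 1) <= g.
  have := @bernoulli_le R (g - 1) 1 ltac:(lra) ltac:(lra).
  by rewrite (_ : 1 + 1 = 2 :> R)//; lra.
rewrite [g * _]mulrC -[leRHS]mulrA; apply: ler_wpM2l => //.
by apply: ler_wpM2r => //; exact: powR_ge0.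
Qed.

(** A chain rule with the sharp factor [g]. By symmetry |b| <= |a| and a >= 0; then b >= 0 is
    [powR_sub_midpoint] and b < 0 is [powR_add_midpoint]. *)
Lemma sgpow_sub_midpoint g a b : 1 <= g <= 2 ->
  `|sgpow g a - sgpow g b| <= g * `|a - b| * ((`|a| + `|b|) / 2) `^ (g - 1).
Proof.
move=> g12; have g0 : g != 0 by lra.
wlog ba : a b / `|b| <= `|a|.
  move=> H; have [/H//|/ltW/H] := leP `|b| `|a|.
  by rewrite (distrC (sgpow g b)) (distrC b) (addrC ( `|b| )).
wlog a0 : a b ba / 0 <= a.
  move=> H; have [/(H a b ba)//|a0] := leP 0 a.
  have := H (- a) (- b); rewrite !normrN !sgpowN -!opprD !normrN; apply => //.
  by lra.
have [b0|b0] := leP 0 b.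
  move: ba; rewrite (ger0_norm a0) (ger0_norm b0) => ba.
  have d1 : 0 <= a - b by rewrite subr_ge0.
  have d2 : 0 <= a `^ g - b `^ g by rewrite subr_ge0; apply: powR_leq => //; lra.
  rewrite (sgpow_ge0 a0 g0) (sgpow_ge0 b0 g0) (ger0_norm d1) (ger0_norm d2).
  exact: powR_sub_midpoint.
have -> : sgpow g b = - (- b) `^ g.
  by rewrite -[b]opprK sgpowN opprK sgpow_ge0//; lra.
have d1 : 0 <= a - b by lra.
have d2 : 0 <= a `^ g + (- b) `^ g by rewrite addr_ge0 ?powR_ge0.
rewrite (sgpow_ge0 a0 g0) opprK (ger0_norm d1) (ger0_norm d2) (ger0_norm a0).
by rewrite (ltr0_norm b0); apply: powR_add_midpoint => //; lra.
Qed.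

Lemma powR_sum_le (I : finType) (P : pred I) (F : I -> R) k : 1 <= k ->
  (forall i, 0 <= F i) -> \sum_(i | P i) F i `^ k <= (\sum_(i | P i) F i) `^ k.
Proof.
move=> k1 F0.
have : 0 <= \sum_(i | P i) F i /\
  \sum_(i | P i) F i `^ k <= (\sum_(i | P i) F i) `^ k; last by case.
elim/big_ind2 : _ => [|x1 x2 y1 y2 [h1 h2] [h3 h4]|i _].
- by rewrite powR0//; lra.
- split; first exact: addr_ge0.
  exact: le_trans (lerD h2 h4) (powR_superadd k1 h1 h3).
- by [].
Qed.

End SignedPowers.

(** * Averaged norms on vertices and edges, and the Gagliardo-Nirenberg inequality *)

Definition vmeasure (R : realType) (V : finType) : V -> R := fun=> (#|V|%:R)^-1.

(** Uniform measure on oriented edges, extended by zero to all pairs so that edge norms are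
    instances of [wnorm]. Its comparison with [vmeasure] produces the powers of [mean_degree]
    below. *)
Definition emeasure (R : realType) (V : finType) (e : rel V) (p : V * V) : R :=
  (e p.1 p.2)%:R / \sum_x degree R e x.

Definition ediff (R : realType) (V : finType) (u : V -> R) (p : V * V) : R :=
  u p.2 - u p.1.

Definition mean_degree (R : realType) (V : finType) (e : rel V) : R :=
  (\sum_x degree R e x) / #|V|%:R.

Section GraphNorms.
Variables (R : realType) (V : finType) (e : rel V).
Hypothesis e_sym : symmetric e.
Hypothesis V_gt0 : (0 < #|V|)%N.
Hypothesis E_gt0 : 0 < \sum_x degree R e x.
Implicit Types (u f g h : V -> R).

Notation vm := (@vmeasure R V).
Notation em := (@emeasure R V e).
Notation md := (mean_degree R e).

Lemma vmeasure_ge0 x : 0 <= vm x.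
Proof. by rewrite /vmeasure invr_ge0. Qed.

Lemma emeasure_ge0 p : 0 <= em p.
Proof. by rewrite /emeasure divr_ge0// ltW. Qed.

Lemma cardV_gt0 : 0 < #|V|%:R :> R.
Proof. by rewrite ltr0n. Qed.

Lemma vmeasure_sum1 : \sum_x vm x = 1.
Proof.
by rewrite /vmeasure sumr_const -[_ *+ _]mulr_natl mulfV// gt_eqF// cardV_gt0.
Qed.

Lemma md_gt0 : 0 < md.
Proof. by rewrite divr_gt0 ?cardV_gt0. Qed.

Lemma wsum_vmeasure f : wsum vm f = (#|V|%:R)^-1 * \sum_x f x.
Proof. by rewrite /wsum mulr_sumr. Qed.

Lemma wsum_emeasure (F : V -> V -> R) : wsum em (fun p => F p.1 p.2) =
  (\sum_x degree R e x)^-1 * \sum_x \sum_(y | e x y) F x y.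
Proof.
rewrite /wsum mulr_sumr.
rewrite (eq_bigr (fun p => (fun x y => (\sum_x degree R e x)^-1 * ((e x y)%:R * F x y)) p.1 p.2)).
  rewrite -(pair_bigA _ (fun x y => (\sum_x degree R e x)^-1 * ((e x y)%:R * F x y)))/=.
  apply: eq_bigr => x _; rewrite -mulr_sumr; congr (_ * _).
  rewrite [RHS]big_mkcond/=; apply: eq_bigr => y _.
  by case: (e x y); rewrite ?mul1r ?mul0r.
by move=> p _; rewrite /emeasure mulrAC mulrC.
Qed.

Lemma emeasure_neq0 p : em p != 0 -> e p.1 p.2.
Proof. by rewrite /emeasure mulf_eq0 negb_or => /andP[+ _]; case: (e _ _); rewrite ?eqxx. Qed.

Lemma vnorm_powR s f : s != 0 ->
  wnorm vm s f `^ s = (#|V|%:R)^-1 * \sum_x `|f x| `^ s.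
Proof. by move=> s0; rewrite (wnorm_powR vmeasure_ge0 _ s0) mulr_sumr. Qed.

Lemma enorm_powR s f : s != 0 -> wnorm em s (ediff f) `^ s =
  (\sum_x degree R e x)^-1 * \sum_x \sum_(y | e x y) `|f y - f x| `^ s.
Proof.
move=> s0; rewrite (wnorm_powR emeasure_ge0 _ s0).
exact: (wsum_emeasure (fun x y => `|f y - f x| `^ s)).
Qed.

Lemma ler_powR_root (a b s : R) : 0 < s -> 0 <= a -> 0 <= b -> a `^ s <= b `^ s -> a <= b.
Proof.
move=> s0 a0 b0 ab; have sn : s != 0 by rewrite gt_eqF.
by rewrite -(powRK sn a0) -(powRK sn b0) powR_leq ?powR_ge0// invr_ge0 ltW.
Qed.

Lemma gradient_norm_ge0 u x : 0 <= gradient_norm e u x.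
Proof. exact: sqrtr_ge0. Qed.

Lemma gradient_norm_powR u x s :
  gradient_norm e u x `^ s = (\sum_(y | e x y) (u y - u x) ^+ 2) `^ (s / 2).
Proof.
have h : 0 <= \sum_(y | e x y) (u y - u x) ^+ 2.
  by apply: sumr_ge0 => y _; exact: sqr_ge0.
by rewrite /gradient_norm -powR12_sqrt// -powRrM mulrC.
Qed.

Lemma norm_sqr_powR (a s : R) : (a ^+ 2) `^ (s / 2) = `|a| `^ s.
Proof.
rewrite -real_normK ?num_real// -powR_mulrn// -powRrM.
by rewrite mulrC divfK.
Qed.

(** At each vertex the l^2 norm is at most the l^s norm when s <= 2; the power of [md] converts an
    average over edges into one over vertices. [enorm_le_gradient_norm] is the opposite comparison
    for exponents at least 2. *)
Lemma gradient_norm_le_enorm s u : 0 < s <= 2 ->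
  wnorm vm s (gradient_norm e u) <= md `^ s^-1 * wnorm em s (ediff u).
Proof.
move=> /andP[s0 s2]; have sn : s != 0 by rewrite gt_eqF.
have mdp := md_gt0; have m0 := ltW mdp.
apply: (ler_powR_root s0); [exact: wnorm_ge0|by rewrite mulr_ge0 ?powR_ge0 ?wnorm_ge0|].
rewrite powRM ?powR_ge0//; last exact: wnorm_ge0.
rewrite powRVK// vnorm_powR// enorm_powR// mulrA.
have -> : md * (\sum_x degree R e x)^-1 = (#|V|%:R)^-1.
  by rewrite /mean_degree mulrAC divff ?mul1r// gt_eqF.
apply: ler_wpM2l; first by rewrite invr_ge0.
apply: ler_sum => x _; rewrite ger0_norm ?gradient_norm_ge0// gradient_norm_powR.
have k1 : 1 <= 2 / s by rewrite ler_pdivlMr// mul1r.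
have := @powR_sum_le R V (e x) (fun y => `|u y - u x| `^ s) (2 / s) k1 (fun=> powR_ge0 _ _).
have -> : \sum_(y | e x y) (`|u y - u x| `^ s) `^ (2 / s) = \sum_(y | e x y) (u y - u x) ^+ 2.
  apply: eq_bigr => y _; rewrite -powRrM mulrCA divff// mulr1 powR_mulrn//.
  by rewrite real_normK ?num_real.
move=> h; rewrite -[leRHS](powRK (s := 2 / s)) ?gt_eqF ?divr_gt0//; last first.
  by apply: sumr_ge0 => y _; exact: powR_ge0.
rewrite invf_div; apply: powR_leq => //; first by rewrite divr_ge0// ltW.
by apply: sumr_ge0 => y _; exact: sqr_ge0.
Qed.

Lemma enorm_le_gradient_norm s u : 2 <= s ->
  wnorm em s (ediff u) <= md `^ (- s^-1) * wnorm vm s (gradient_norm e u).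
Proof.
move=> s2; have s0 : 0 < s by lra.
have sn : s != 0 by rewrite gt_eqF.
have mdp := md_gt0; have m0 := ltW mdp.
apply: (ler_powR_root s0); [exact: wnorm_ge0|by rewrite mulr_ge0 ?powR_ge0 ?wnorm_ge0|].
rewrite powRM ?powR_ge0//; last exact: wnorm_ge0.
rewrite -powRrM mulNr mulVf// powR_inv1// vnorm_powR// enorm_powR// mulrA.
have -> : md^-1 * (#|V|%:R)^-1 = (\sum_x degree R e x)^-1.
  by rewrite /mean_degree; field; rewrite !gt_eqF ?cardV_gt0.
apply: ler_wpM2l; first by rewrite invr_ge0 ltW.
apply: ler_sum => x _; rewrite ger0_norm ?gradient_norm_ge0// gradient_norm_powR.
have k1 : 1 <= s / 2 by lra.
have := @powR_sum_le R V (e x) (fun y => (u y - u x) ^+ 2) (s / 2) k1 (fun=> sqr_ge0 _).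
by under eq_bigr do rewrite norm_sqr_powR.
Qed.

Section GagliardoNirenberg.
(* [C] bounds the Sobolev-Poincare constant, [Delta] the degrees. *)
Variables (P al C Delta kap : R).
Hypotheses (P0 : 1 < P) (al0 : 0 < al) (C0 : 0 <= C) (kap1 : 0 < kap).
Hypothesis sobolev : forall u L, (forall a, L <= wnorm vm P (fun x => u x - a)) ->
  L <= C * wnorm em al (ediff u).
Hypothesis degree_le : forall x, degree R e x <= Delta.
Hypothesis mean_le : forall f a,
  wnorm vm P (fun x => f x - wsum vm f) <= kap * wnorm vm P (fun x => f x - a).

(** Convexity separates the two end points, and each vertex is then counted as often as its
    degree. *)
Lemma enorm_midpoint s f : 1 <= s ->
  wnorm em s (fun p => (`|f p.1| + `|f p.2|) / 2) <= (Delta / md) `^ s^-1 * wnorm vm s f.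
Proof.
move=> s1; have s0 : 0 < s by lra.
have sn : s != 0 by rewrite gt_eqF.
have mdp := md_gt0; have m0 := ltW mdp.
have D0 : 0 <= Delta.
  have /card_gt0P[x _] := V_gt0.
  by apply: le_trans (degree_le x); apply: sumr_ge0.
apply: (ler_powR_root s0); [exact: wnorm_ge0|by rewrite mulr_ge0 ?powR_ge0 ?wnorm_ge0|].
rewrite powRM ?powR_ge0//; last exact: wnorm_ge0.
rewrite (powRVK sn (divr_ge0 D0 m0)) (vnorm_powR _ sn) (wnorm_powR emeasure_ge0 _ sn).
have := wsum_emeasure (fun x y => `|(`|f x| + `|f y|) / 2| `^ s).
rewrite /wsum => ->.
have -> : Delta / md * ((#|V|%:R)^-1 * \sum_x `|f x| `^ s) =
    (\sum_x degree R e x)^-1 * (Delta * \sum_x `|f x| `^ s).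
  by rewrite /mean_degree; field; rewrite !gt_eqF ?cardV_gt0.
apply: ler_wpM2l; first by rewrite invr_ge0 ltW.
apply: (@le_trans _ _ (\sum_x \sum_(y | e x y) (`|f x| `^ s / 2 + `|f y| `^ s / 2))).
  apply: ler_sum => x _; apply: ler_sum => y _.
  rewrite ger0_norm ?divr_ge0 ?addr_ge0// -mulrDl.
  exact: powR_half_convex.
rewrite (eq_bigr (fun x => \sum_(y | e x y) `|f x| `^ s / 2
   + \sum_(y | e x y) `|f y| `^ s / 2)); last by move=> x _; rewrite big_split.
rewrite big_split/= [X in _ + X](sum_edges_sym e_sym (fun x y => `|f y| `^ s / 2)).
rewrite -big_split/= mulr_sumr; apply: ler_sum => x _.
rewrite -big_split/=; apply: (@le_trans _ _ (degree R e x * `|f x| `^ s)).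
  rewrite /degree mulr_suml; apply: ler_sum => y _; lra.
by apply: ler_wpM2r; rewrite ?powR_ge0.
Qed.

(** The chain rule [sgpow_sub_midpoint], then Hölder with 1/al = 1/s + (g - 1)/s, which is the
    condition g al = s. *)
Lemma enorm_sgpow (s g : R) f : 1 <= s -> 1 <= g <= 2 -> g * al = s ->
  wnorm em al (ediff (fun x => sgpow g (f x))) <=
  g * (Delta / md) `^ ((g - 1) / s) * wnorm vm s f `^ (g - 1) * wnorm em s (ediff f).
Proof.
move=> s1 g12 gal; have s0 : 0 < s by lra.
have g0 : 0 < g by lra.
apply: (@le_trans _ _ (wnorm em al (fun p => g * (ediff f p *
    ((`|f p.1| + `|f p.2|) / 2) `^ (g - 1))))).
  apply: ler_wnorm => [p||p _]; [exact: emeasure_ge0|exact: ltW|].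
  rewrite [leRHS]normrM [X in _ <= _ * X]normrM (ger0_norm (powR_ge0 _ _)).
  rewrite (ger0_norm (ltW g0)) mulrA (addrC ( `|f p.1| )).
  exact: sgpow_sub_midpoint.
rewrite (wnormZ emeasure_ge0) ?gt_eqF// (ger0_norm (ltW g0)) -!mulrA.
apply: ler_wpM2l; first exact: ltW.
have [g1|gn1] := eqVneq g 1.
  rewrite g1 subrr mul0r !powRr0 !mul1r -gal g1 mul1r.
  rewrite le_eqVlt; apply/orP; left; apply/eqP; apply: wnorm_eq => p _.
  by rewrite powRr0 mulr1.
have g10 : 0 < g - 1 by rewrite lt_def subr_eq0 gn1/=; lra.
have k0 : 0 < s / (g - 1) by exact: divr_gt0.
apply: (@le_trans _ _ (wnorm em s (ediff f) *
   wnorm em (s / (g - 1)) (fun p => ((`|f p.1| + `|f p.2|) / 2) `^ (g - 1)))).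
  apply: hoelder_wnorm => //; first exact: emeasure_ge0.
  by rewrite -gal; field; rewrite !gt_eqF//=; lra.
rewrite mulrA [leRHS]mulrC; apply: ler_wpM2l; first exact: wnorm_ge0.
have -> : wnorm em (s / (g - 1)) (fun p => ((`|f p.1| + `|f p.2|) / 2) `^ (g - 1)) =
   wnorm em s (fun p => (`|f p.1| + `|f p.2|) / 2) `^ (g - 1).
  have := wnorm_norm_powR em (fun p => (`|f p.1| + `|f p.2|) / 2) g10 (lt0r_neq0 k0).
  rewrite mulrCA divff ?(gt_eqF g10)// mulr1 => <-; apply: wnorm_eq => p _.
  by rewrite [in RHS](@ger0_norm _ ((`|f p.1| + `|f p.2|) / 2)).
rewrite mulrC [(g - 1) / s]mulrC powRrM -powRM ?powR_ge0//; last exact: wnorm_ge0.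
apply: powR_leq; [exact: ltW|exact: wnorm_ge0|].
by rewrite mulrC; exact: enorm_midpoint.
Qed.

(* Sobolev applied to the signed power [f^g]; [zeta] is 0 if that power has mean 0. *)
Lemma gagliardo_nirenberg (s g x zeta : R) f : 1 < s -> 1 <= g <= 2 -> g * al = s ->
  0 <= x <= 1 -> (1 - g * x) / s = (1 - x) / P -> 0 <= zeta ->
  `|wsum vm (fun x => sgpow g (f x))| <= zeta * wnorm vm s f `^ g ->
  wnorm vm P f <= wnorm vm s f `^ (1 - x) *
    (kap * C * (g * (Delta / md) `^ ((g - 1) / s)) * wnorm em s (ediff f)
     + zeta * wnorm vm s f) `^ x.
Proof.
move=> s1 g12 gal /andP[x0 x1] gx zeta0 hmean.
have s0 : 0 < s by lra.
have g0 : 0 < g by lra.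
have P00 : 0 < P by exact: lt_trans P0.
have An : 0 <= wnorm vm s f by exact: wnorm_ge0.
have Bn : 0 <= wnorm em s (ediff f) by exact: wnorm_ge0.
have [A0|A0] := eqVneq (wnorm vm s f) 0.
  have -> : wnorm vm P f = wnorm vm P (fun=> 0).
    apply: wnorm_eq => t mt; rewrite (wnorm_eq0 vmeasure_ge0 s0 A0 mt) normr0.
    by [].
  rewrite (wnorm1 _ (lt0r_neq0 P00) vmeasure_sum1) normr0 mulr_ge0 ?powR_ge0//.
have Ap : 0 < wnorm vm s f by rewrite lt_def A0.
set A := wnorm vm s f in An A0 Ap hmean *; set B := wnorm em s (ediff f) in Bn *.
pose h x := sgpow g (f x).
have hP : wnorm vm (g * P) f `^ g = wnorm vm P h.
  rewrite -(wnorm_norm_powR vm f g0 (lt0r_neq0 P00)).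
  by apply: wnorm_eq => t _; rewrite norm_sgpow ?(gt_eqF g0)// ger0_norm ?powR_ge0.
set K := g * (Delta / md) `^ ((g - 1) / s).
have h1 : wnorm vm P (fun x => h x - wsum vm h) <= kap * C * K * A `^ (g - 1) * B.
  rewrite -!mulrA -ler_pdivrMl//.
  have := sobolev (u := h) (L := kap^-1 * wnorm vm P (fun x => h x - wsum vm h)).
  move=> H; apply: le_trans (H _) _ => [a|].
    by rewrite ler_pdivrMl.
  apply: ler_wpM2l => //; apply: le_trans (enorm_sgpow f (ltW s1) g12 gal) _.
  by rewrite -!mulrA.
have h2 : wnorm vm P h <= A `^ (g - 1) * (kap * C * K * B + zeta * A).
  apply: le_trans (_ : wnorm vm P (fun x => h x - wsum vm h) + `|wsum vm h| <= _).
    rewrite -(wnorm1 (wsum vm h) (lt0r_neq0 P00) vmeasure_sum1).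
    apply: le_trans (minkowski_wnorm vmeasure_ge0 _ _ P0).
    by rewrite le_eqVlt (wnorm_eq _ (g := h)) ?eqxx// => t _; rewrite subrK.
  apply: le_trans (lerD h1 hmean) _.
  by rewrite -(mulr_powRB1 An g0); lra.
have gP0 : 0 < g * P by exact: mulr_gt0.
have l1 : 0 <= g * x <= 1.
  have : 0 <= (1 - g * x) / s by rewrite gx divr_ge0 ?subr_ge0// ltW.
  rewrite pmulr_lge0 ?invr_gt0// subr_ge0 => ->; rewrite andbT.
  by rewrite mulr_ge0// ltW.
(* L^P lies between L^s and L^(g P). The L^(g P) norm of [f], to the power g, is the L^P norm of the
   signed power, so the weight g x becomes the exponent x. *)
have := @wnorm_interp _ _ vm vmeasure_ge0 P s (g * P) (g * x) f P00 s0 gP0 l1.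
have -> : (1 - g * x) / s + g * x / (g * P) = P^-1.
  by rewrite gx; field; rewrite !gt_eqF.
move=> /(_ erefl) h3; apply: le_trans h3 _.
rewrite powRrM hP -/A.
apply: le_trans (_ : A `^ (1 - g * x) * (A `^ (g - 1) * (kap * C * K * B + zeta * A)) `^ x <= _).
  apply: ler_wpM2l; first exact: powR_ge0.
  by apply: powR_leq => //; rewrite wnormE powR_ge0.
have Q0 : 0 <= kap * C * K * B + zeta * A.
  by rewrite addr_ge0 ?mulr_ge0 ?powR_ge0// ltW.
rewrite powRM ?powR_ge0// mulrA -powRrM -powRD; last by rewrite A0 implybT.
by have -> : 1 - g * x + (g - 1) * x = 1 - x by ring.
Qed.

End GagliardoNirenberg.

End GraphNorms.

(** * Energy estimates and identities for the resolvent *)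

Section ResolventEstimates.
Variables (R : realType) (V : finType) (e : rel V).
Hypothesis e_sym : symmetric e.
Hypothesis V_gt0 : (0 < #|V|)%N.
Hypothesis E_gt0 : 0 < \sum_x degree R e x.
Implicit Types (u f g h : V -> R) (x y : V) (tau rho : R).

Notation vm := (@vmeasure R V).
Notation em := (@emeasure R V e).
Notation md := (mean_degree R e).
Notation res := (resolvent e).

Lemma wnorm2_sqr f : wnorm vm 2 f ^+ 2 = (#|V|%:R)^-1 * \sum_x f x ^+ 2.
Proof.
have n2 : (2 : R) != 0 by rewrite pnatr_eq0.
rewrite -powR_mulrn ?wnorm_ge0// (vnorm_powR _ n2); congr (_ * _).
by apply: eq_bigr => x _; rewrite powR_mulrn// real_normK ?num_real.
Qed.

Lemma enorm2_sqr f : wnorm em 2 (ediff f) ^+ 2 =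
  (\sum_x degree R e x)^-1 * \sum_x \sum_(y | e x y) (f y - f x) ^+ 2.
Proof.
have n2 : (2 : R) != 0 by rewrite pnatr_eq0.
rewrite -powR_mulrn ?wnorm_ge0// (enorm_powR E_gt0 _ n2); congr (_ * _).
apply: eq_bigr => x _; apply: eq_bigr => y _.
by rewrite powR_mulrn// real_normK ?num_real.
Qed.

Definition energy tau f : R := wsum vm (fun x => res tau f x * f x).

Lemma energyE tau f : 0 <= tau -> energy tau f =
  wnorm vm 2 (res tau f) ^+ 2 + tau * md / 2 * wnorm em 2 (ediff (res tau f)) ^+ 2.
Proof.
move=> tau0; rewrite /energy wsum_vmeasure resolvent_energy// wnorm2_sqr enorm2_sqr.
rewrite /mean_degree mulrDr; congr (_ + _).
have n0 := cardV_gt0 R V_gt0.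
by field; rewrite !gt_eqF.
Qed.

Lemma energy_ge0 tau f : 0 <= tau -> 0 <= energy tau f.
Proof.
move=> tau0; rewrite energyE// addr_ge0 ?sqr_ge0// mulr_ge0 ?sqr_ge0//.
by rewrite !mulr_ge0// ltW// md_gt0.
Qed.

(** Nash's argument. With v = res f the energy is the pairing of v and f, at most |v|_Q |f|_s;
    Gagliardo-Nirenberg bounds |v|_Q by the square root of the energy, and one square root
    cancels. *)
Lemma energy_le (Q al C Delta kap g x s tau : R) f :
  1 < Q -> 0 < al -> 0 <= C -> 0 < kap ->
  (forall u L, (forall a, L <= wnorm vm Q (fun x => u x - a)) ->
    L <= C * wnorm em al (ediff u)) ->
  (forall x, degree R e x <= Delta) ->
  (forall f a, wnorm vm Q (fun x => f x - wsum vm f)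
    <= kap * wnorm vm Q (fun x => f x - a)) ->
  1 <= g <= 2 -> g * al = 2 -> 0 <= x <= 1 -> (1 - g * x) / 2 = (1 - x) / Q ->
  0 < s -> Q^-1 + s^-1 = 1 -> 0 < tau ->
  Num.sqrt (energy tau f) <=
  (1 + (kap * C * (g * (Delta / md) `^ ((g - 1) / 2))) ^+ 2 / (tau * md / 2)) `^ (x / 2)
  * wnorm vm s f.
Proof.
move=> Q1 al0 C0 kap0 sob deg mean g12 gal x01 gx s0 Qs tau0.
set B := kap * C * _; have mdp := md_gt0 V_gt0 E_gt0.
have D0 : 0 <= Delta.
  by have /card_gt0P[z _] := V_gt0; apply: le_trans (deg z); apply: sumr_ge0.
have B0 : 0 <= B by rewrite !mulr_ge0 ?powR_ge0 ?(ltW kap0)//; lra.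
set t2 := tau * md / 2; have t20 : 0 < t2 by rewrite divr_gt0// mulr_gt0.
set v := res tau f; set A := wnorm vm 2 v; set G := wnorm em 2 (ediff v).
have A0 : 0 <= A by exact: wnorm_ge0.
have G0 : 0 <= G by exact: wnorm_ge0.
have EE : energy tau f = A ^+ 2 + t2 * G ^+ 2 by rewrite energyE// ltW.
have E0 : 0 <= energy tau f by apply: energy_ge0; exact: ltW.
set sE := Num.sqrt (energy tau f); have sE0 : 0 <= sE by exact: sqrtr_ge0.
have sE2 : sE ^+ 2 = A ^+ 2 + t2 * G ^+ 2 by rewrite sqr_sqrtr.
have K0 : 0 <= 1 + B ^+ 2 / t2.
  by apply: addr_ge0 => //; apply: divr_ge0; [exact: sqr_ge0|exact: ltW].
have hA : A <= sE.
  rewrite -(ler_pXn2r (n := 2)) ?nnegrE// sE2 lerDl; apply: mulr_ge0; [exact: ltW|exact: sqr_ge0].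
(* Cauchy-Schwarz in the plane for (B / sqrt t2, 1) and (sqrt t2 G, A). *)
have hBG : B * G + 1 * A <= sE * Num.sqrt (1 + B ^+ 2 / t2).
  have l0 : 0 <= B * G + 1 * A by apply: addr_ge0; apply: mulr_ge0.
  have r0 : 0 <= sE * Num.sqrt (1 + B ^+ 2 / t2) by rewrite mulr_ge0// sqrtr_ge0.
  rewrite -(ler_pXn2r (n := 2)) ?nnegrE//.
  rewrite exprMn sE2 sqr_sqrtr// mul1r.
  have -> : (A ^+ 2 + t2 * G ^+ 2) * (1 + B ^+ 2 / t2) =
    (B * G + A) ^+ 2 + (B * A - t2 * G) ^+ 2 / t2 by field; exact: lt0r_neq0.
  by rewrite lerDl; apply: divr_ge0; [exact: sqr_ge0|exact: ltW].
have /andP[x0 x1] := x01.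
have hv : wnorm vm Q v <= sE * (1 + B ^+ 2 / t2) `^ (x / 2).
  (* The signed power of [v] need not have mean zero; its mean is at most |v|_g^g, so [zeta] = 1
     will do. *)
  have hmean : `|wsum vm (fun x => sgpow g (v x))| <= 1 * wnorm vm 2 v `^ g.
    have g0 : 0 < g by lra.
    have gm : wnorm vm g v <= wnorm vm 2 v.
      apply: (@wnorm_mono R V vm _ g 2 v) => //; last by lra.
        by move=> y; exact: vmeasure_ge0.
      exact: vmeasure_sum1.
    rewrite mul1r; apply: le_trans (powR_leq (ltW g0) (wnorm_ge0 _ _ _) gm).
    rewrite (wnorm_powR (@vmeasure_ge0 R V)) ?gt_eqF//.
    apply: le_trans (ler_norm_sum _ _ _) _; apply: ler_sum => y _.
    rewrite normrM ger0_norm ?vmeasure_ge0//.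
    by apply: ler_wpM2l; [exact: vmeasure_ge0|exact: norm_sgpow_le].
  have := gagliardo_nirenberg e_sym V_gt0 E_gt0 Q1 al0 C0 kap0 sob deg mean
    _ g12 gal x01 gx ler01 hmean.
  rewrite ltr1n => /(_ isT); rewrite -/A -/G -/B => h; apply: le_trans h _.
  apply: le_trans (_ : sE `^ (1 - x) * (sE * Num.sqrt (1 + B ^+ 2 / t2)) `^ x <= _).
    apply: ler_pM; rewrite ?powR_ge0//; first by apply: powR_leq => //; lra.
    apply: powR_leq; [exact: x0| |exact: hBG].
    by apply: addr_ge0; apply: mulr_ge0.
  rewrite powRM ?sqrtr_ge0// mulrA -powRD ?subrK ?oner_eq0// powRr1//.
  by rewrite -powR12_sqrt// -powRrM mulrC [2^-1 * x]mulrC mulrC.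
have [sE0'|sEn0] := eqVneq sE 0.
  by rewrite sE0' mulr_ge0 ?powR_ge0 ?wnorm_ge0.
have sEp : 0 < sE by rewrite lt_def sEn0.
have Q0 : 0 < Q by lra.
have h1 : energy tau f <= wnorm vm Q v * wnorm vm s f.
  apply: le_trans (ler_norm _) _.
  exact: (hoelder_wsum (@vmeasure_ge0 R V)).
rewrite -(ler_pM2l sEp) -expr2 sqr_sqrtr// mulrA; apply: le_trans h1 _.
by apply: ler_wpM2r; rewrite ?wnorm_ge0.
Qed.

(** The resolvent is symmetric and positive, so its pairing with g is at most the product of two
    root energies; by duality two energy bounds combine to a bound from L^s to L^P. *)
Lemma resolvent_wnorm_le (P P' s K1 K2 tau : R) f : 1 < P -> 0 < P' ->
  P^-1 + P'^-1 = 1 -> 0 <= K1 -> 0 <= K2 -> 0 <= tau ->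
  (forall g, Num.sqrt (energy tau g) <= K1 * wnorm vm s g) ->
  (forall g, Num.sqrt (energy tau g) <= K2 * wnorm vm P' g) ->
  wnorm vm P (res tau f) <= K1 * K2 * wnorm vm s f.
Proof.
move=> P1 P'0 PP K10 K20 tau0 h1 h2.
apply: (wnorm_dual (@vmeasure_ge0 R V) P1 P'0 PP).
  by rewrite !mulr_ge0 ?wnorm_ge0.
move=> g.
have cs : wsum vm (fun x => res tau f x * g x) <=
    Num.sqrt (energy tau f) * Num.sqrt (energy tau g).
  rewrite -sqrtrM ?energy_ge0//; apply: le_trans (ler_norm _) _.
  rewrite -sqrtr_sqr; apply: ler_wsqrtr; rewrite /energy !wsum_vmeasure.
  rewrite exprMn [leRHS]mulrACA -expr2; apply: ler_wpM2l; first exact: sqr_ge0.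
  exact: (resolvent_cauchy_schwarz e_sym).
apply: le_trans cs _.
apply: le_trans (ler_pM (sqrtr_ge0 _) (sqrtr_ge0 _) (h1 f) (h2 g)) _.
by rewrite le_eqVlt; apply/orP; left; apply/eqP; ring.
Qed.

(** The resolvent identity, from 1 + rho tau L = rho (1 + tau L) + (1 - rho). *)
Lemma resolvent_step tau rho u x : 0 <= tau -> 0 <= rho ->
  res tau u x = rho * res (rho * tau) u x
    + (1 - rho) * res (rho * tau) (res tau u) x.
Proof.
move=> tau0 rho0; have rt0 : 0 <= rho * tau by exact: mulr_ge0.
rewrite -resolventZ -resolventD.
apply: (resolvent_unique rt0) => y.
have := resolventK e u y tau0; rewrite /helmholtz => <-.
ring.
Qed.

Lemma resolvent_comm tau rho u x : 0 <= tau -> 0 < rho -> rho != 1 ->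
  res (rho * tau) (res tau u) x = res tau (res (rho * tau) u) x.
Proof.
move=> tau0 rho0 rho1; have rt0 : 0 <= rho * tau by rewrite mulr_ge0// ltW.
have r0 : 0 <= rho^-1 by rewrite invr_ge0 ltW.
have h1 := resolvent_step u x tau0 (ltW rho0).
have := resolvent_step u x rt0 r0.
rewrite mulKf ?gt_eqF// => h2.
have rn : 1 - rho != 0 by rewrite subr_eq0 eq_sym.
apply: (mulfI rn).
have -> : (1 - rho) * res (rho * tau) (res tau u) x = res tau u x - rho * res (rho * tau) u x.
  by rewrite h1; ring.
rewrite [X in _ - rho * X]h2; field.
by rewrite gt_eqF.
Qed.

(* From [helmholtz (v^2) = g^2 - (g - v)^2 - tau |grad v|^2] for [v = res g]. *)
Lemma resolvent_reverse_poincare tau g x : 0 <= tau ->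
  tau * res tau (fun y => gradient_norm e (res tau g) y ^+ 2) x
    <= res tau (fun y => g y ^+ 2) x.
Proof.
move=> tau0; set v := res tau g.
have h : forall y, helmholtz e tau (fun y => v y ^+ 2) y <=
    g y ^+ 2 + (- tau) * gradient_norm e v y ^+ 2.
  move=> y; have := resolventK e g y tau0; rewrite -/v.
  rewrite /gradient_norm sqr_sqrtr; last by apply: sumr_ge0 => z _; exact: sqr_ge0.
  rewrite /helmholtz; set S := \sum_(z | e y z) (v y - v z) => hS.
  have -> : \sum_(z | e y z) (v y ^+ 2 - v z ^+ 2) =
      2 * v y * S - \sum_(z | e y z) (v z - v y) ^+ 2.
    by rewrite /S mulr_sumr -sumrB; apply: eq_bigr => z _; ring.
  rewrite -hS; have := sqr_ge0 (tau * S); nra.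
have := resolvent_le x tau0 h; rewrite resolventD.
by have := sqr_ge0 (v x); lra.
Qed.

End ResolventEstimates.

(** * The resolvent as a smoothing operator on a graph with a coupling *)

Section Smoothing.
Variables (R : realType) (V : finType) (e : rel V).
Hypothesis e_sym : symmetric e.
Hypothesis V_gt0 : (0 < #|V|)%N.
Hypothesis E_gt0 : 0 < \sum_x degree R e x.
Variable tr : V -> V -> V -> option V.
Hypothesis tr_coupling : coupling R e tr.
Implicit Types (u f g h : V -> R) (x y : V) (tau : R).

Notation vm := (@vmeasure R V).
Notation em := (@emeasure R V e).
Notation md := (mean_degree R e).
Notation res := (resolvent e).
Let vm0 := @vmeasure_ge0 R V.

(** By [gradient_resolvent] a bound of the resolvent from L^s to L^P passes to gradients; the power
    of [md] comes from the two comparisons of [gradient_norm] with edge norms. *)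
Lemma enorm_resolvent_le (P s K tau : R) u : 0 < s <= 2 -> 2 <= P -> 0 <= tau ->
  (forall f, wnorm vm P (res tau f) <= K * wnorm vm s f) -> 0 <= K ->
  wnorm em P (ediff (res tau u)) <=
    md `^ (s^-1 - P^-1) * K * wnorm em s (ediff u).
Proof.
move=> s02 P2 tau0 hK K0; have mdp := md_gt0 V_gt0 E_gt0.
apply: le_trans (enorm_le_gradient_norm V_gt0 E_gt0 _ P2) _.
rewrite addrC powRD ?(gt_eqF mdp) ?implybT// -!mulrA.
apply: ler_wpM2l; first exact: powR_ge0.
apply: le_trans (_ : wnorm vm P (res tau (gradient_norm e u)) <= _).
  apply: ler_wnorm => [//||x _]; first by lra.
  rewrite ger0_norm ?gradient_norm_ge0// ger0_norm; last first.
    by apply: resolvent_ge0 => // y; exact: gradient_norm_ge0.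
  exact: (gradient_resolvent tr_coupling).
apply: le_trans (hK _) _; rewrite mulrCA; apply: ler_wpM2l => //.
exact: gradient_norm_le_enorm.
Qed.

(** [centering_wnorm] on the edges, with W the gradient of [res tau u]; the sign of the pairing is
    [resolvent_duality_map]. *)
Lemma enorm_sub_resolvent_le (k nu s tau : R) u : 0 <= tau -> 1 < s ->
  0 < k <= 1 -> 0 <= nu -> centering k nu s ->
  wnorm em s (ediff (fun x => u x - res tau u x))
    <= k^-1 `^ s^-1 * wnorm em s (ediff u).
Proof.
move=> tau0 s1 k01 nu0 cent.
apply: (centering_wnorm (@emeasure_ge0 _ _ _ E_gt0) (W := ediff (res tau u)) s1 k01 nu0 cent).
  by move=> p _; rewrite /ediff; ring.
have := wsum_emeasure e (fun x y => (u y - res tau u y - (u x - res tau u x)) *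
  sgpow (s - 1) (res tau u y - res tau u x)).
rewrite /ediff => ->; rewrite mulr_ge0 ?invr_ge0 ?(ltW E_gt0)//.
have := resolvent_duality_map e_sym tr_coupling tau0 s1 (erefl (res tau u)).
congr (0 <= _); apply: eq_bigr => x _; apply: eq_bigr => y _.
by congr (_ * _); ring.
Qed.

(** Let G be the squared gradient of [res tau h]. Gradient contraction and Jensen bound the left
    side by [res (rho * tau) G]; by [resolvent_step], rho times this is at most [res tau G], to
    which the reverse Poincare inequality applies. *)
Lemma gradient_norm_resolvent2 tau rho h x : 0 < tau -> 0 < rho < 1 ->
  gradient_norm e (res (rho * tau) (res tau h)) x ^+ 2
    <= (rho * tau)^-1 * res tau (fun y => h y ^+ 2) x.
Proof.
move=> tau0 /andP[rho0 rho1]; have rt0 : 0 < rho * tau by exact: mulr_gt0.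
have h1 := gradient_resolvent tr_coupling (res tau h) x (ltW rt0).
have h2 := resolvent_jensen2 e (gradient_norm e (res tau h)) x (ltW rt0).
have h3 := resolvent_reverse_poincare e h x (ltW tau0).
set G := fun y => gradient_norm e (res tau h) y ^+ 2 in h2 h3.
have G0 y : 0 <= G y by exact: sqr_ge0.
have h4 := resolvent_step e G x (ltW tau0) (ltW rho0).
have h5 : 0 <= (1 - rho) * res (rho * tau) (res tau G) x.
  apply: mulr_ge0; first by lra.
  by apply: resolvent_ge0 (ltW rt0) _ => y; exact: resolvent_ge0 (ltW tau0) _.
rewrite ler_pdivlMl//.
apply: le_trans (_ : rho * tau * res (rho * tau) G x <= _).
  rewrite ler_pM2l//; apply: le_trans h2.
  by apply: lerXn2r => //; rewrite nnegrE ?gradient_norm_ge0// (le_trans _ h1) ?gradient_norm_ge0.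
apply: le_trans h3; rewrite mulrAC [leLHS]mulrC; apply: ler_wpM2l; first exact: ltW.
by lra.
Qed.

(** By duality. Since u - res tau u = tau L (res tau u), the pairing with [h] is an edge sum of the
    gradient of [u] against that of the twice smoothed [h], bounded pointwise by
    [gradient_norm_resolvent2]. The conjugate exponent [b] is at least 2, so the resolvent contracts
    L^(b/2), applied to h^2. *)
Lemma pseudo_poincare_step (s tau rho : R) u : 1 < s <= 2 -> 0 < tau -> 0 < rho < 1 ->
  wnorm vm s (res (rho * tau) (fun x => u x - res tau u x)) <=
  tau / (2 * Num.sqrt (rho * tau)) * wnorm vm s (gradient_norm e u).
Proof.
move=> /andP[s1 s2] tau0 rho01; have /andP[rho0 rho1] := rho01.
have rt0 : 0 < rho * tau by exact: mulr_gt0.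
have [b1 sb] := conjugate_exponent s1.
set b := s / (s - 1) in b1 sb *; have b0 : 0 < b by lra.
have b2 : 2 <= b by rewrite /b ler_pdivlMr; lra.
have sq0 : 0 < Num.sqrt (rho * tau) by rewrite sqrtr_gt0.
have C0 : 0 <= tau / (2 * Num.sqrt (rho * tau)).
  by rewrite divr_ge0 ?mulr_ge0 ?(ltW tau0) ?(ltW sq0).
apply: (wnorm_dual vm0 s1 b0 sb); first by rewrite mulr_ge0// wnorm_ge0.
move=> h.
have E1 : \sum_x res (rho * tau) (fun x => u x - res tau u x) x * h x =
    tau / 2 * \sum_x \sum_(y | e x y) (u y - u x) *
      (res (rho * tau) (res tau h) y - res (rho * tau) (res tau h) x).
  rewrite (resolvent_sym e_sym)//; last exact: ltW.
  set k := res (rho * tau) h.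
  rewrite (eq_bigr (fun x => u x * k x - res tau u x * k x)); last first.
    by move=> x _; rewrite mulrBl.
  rewrite sumrB (resolvent_sym e_sym)//; last exact: ltW.
  have := sum_helmholtz e_sym tau u (res tau k).
  rewrite (eq_bigr (fun x => u x * k x)); last by move=> x _; rewrite resolventK// ltW.
  move=> ->; rewrite addrC addKr; congr (_ * _).
  apply: eq_bigr => x _; apply: eq_bigr => y _.
  have tau0' : 0 <= tau by exact: ltW.
  have rhon : rho != 1 by rewrite lt_eqF.
  by rewrite /k !(resolvent_comm e).
rewrite wsum_vmeasure E1.
apply: (@le_trans _ _ ((#|V|%:R)^-1 * (tau / 2 * \sum_x gradient_norm e u x *
    ((Num.sqrt (rho * tau))^-1 * Num.sqrt (res tau (fun y => h y ^+ 2) x))))).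
  apply: ler_wpM2l; first by rewrite invr_ge0.
  apply: ler_wpM2l; first by rewrite divr_ge0// ltW.
  apply: ler_sum => x _; apply: le_trans (cauchy_schwarz_sum _ _ _) _.
  apply: ler_wpM2l; first exact: sqrtr_ge0.
  rewrite -sqrtrV ?(ltW rt0)// -sqrtrM ?invr_ge0 ?(ltW rt0)//; apply: ler_wsqrtr.
  have := gradient_norm_resolvent2 h x tau0 rho01.
  rewrite /gradient_norm sqr_sqrtr//; by apply: sumr_ge0 => y _; exact: sqr_ge0.
have -> : (#|V|%:R)^-1 * (tau / 2 * \sum_x gradient_norm e u x *
    ((Num.sqrt (rho * tau))^-1 * Num.sqrt (res tau (fun y => h y ^+ 2) x))) =
  tau / (2 * Num.sqrt (rho * tau)) *
    wsum vm (fun x => gradient_norm e u x * Num.sqrt (res tau (fun y => h y ^+ 2) x)).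
  rewrite wsum_vmeasure; under eq_bigr do rewrite mulrCA.
  by rewrite -mulr_sumr; field; rewrite !gt_eqF ?cardV_gt0.
rewrite -[leRHS]mulrA; apply: ler_wpM2l => //.
apply: le_trans (ler_norm _) _.
have s0 : 0 < s by lra.
apply: le_trans (hoelder_wsum vm0 _ _ s0 b0 sb) _.
apply: ler_wpM2l; first exact: wnorm_ge0.
apply: (ler_powR_root b0); rewrite ?wnorm_ge0//.
have bn : b != 0 by rewrite gt_eqF.
rewrite !vnorm_powR//; apply: ler_wpM2l; first by rewrite invr_ge0.
have r0 y : 0 <= res tau (fun z => h z ^+ 2) y.
  by apply: resolvent_ge0 => [|z]; [exact: ltW|exact: sqr_ge0].
have b21 : 1 <= b / 2 by lra.
have := sum_resolvent_powR e_sym (fun y => h y ^+ 2) (ltW tau0) b21.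
rewrite [X in _ <= X -> _](eq_bigr (fun x => `|h x| `^ b)); last first.
  by move=> x _; rewrite ger0_norm ?sqr_ge0// norm_sqr_powR.
apply: le_trans; apply: ler_sum => x _.
rewrite !ger0_norm ?sqrtr_ge0// -powR12_sqrt// -powRrM.
by rewrite mulrC.
Qed.

Lemma le_of_geometric (a b C rho : R) : 0 <= rho < 1 ->
  (forall k : nat, a <= b + C * rho ^+ k) -> a <= b.
Proof.
move=> /andP[rho0 rho1] H; rewrite leNgt; apply/negP => ba.
have [C0|C0] := leP C 0.
  by have := H 0%N; rewrite expr0; lra.
have d0 : 0 < a - b by rewrite subr_gt0.
have [r0|rn0] := eqVneq rho 0.
  by have := H 1%N; rewrite r0 expr1; lra.
have rp : 0 < rho by rewrite lt_def rn0.
pose q := rho^-1 - 1; have q0 : 0 < q.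
  by rewrite subr_gt0 invf_gt1.
pose k := Num.bound (C / (q * (a - b))).
have kb : C / (q * (a - b)) < k%:R.
  apply: archi_boundP; apply: divr_ge0; first exact: ltW.
  by apply: mulr_ge0; exact: ltW.
have pk : 1 + k%:R * q <= rho^-1 ^+ k.
  have -> : rho^-1 = 1 + q by rewrite /q addrC subrK.
  elim: k {kb} => [|j IH]; first by rewrite mul0r addr0 expr0.
  have q1 : 0 <= 1 + q by lra.
  have j0 : 0 <= j%:R * q ^+ 2 by rewrite mulr_ge0// sqr_ge0.
  by have := ler_wpM2l q1 IH; rewrite -exprS -natr1; lra.
have rk0 : 0 < rho ^+ k by exact: exprn_gt0.
have := H k; rewrite leNgt => /negP; apply.
suff : C * rho ^+ k < a - b by lra.
rewrite -ltr_pdivlMr// -exprVn.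
have : C < k%:R * q * (a - b).
  by move: kb; rewrite ltr_pdivrMr ?mulr_gt0// mulrA.
by have := ler_wpM2r (ltW d0) pk; nra.
Qed.

(** Telescopes along the steps tau, rho tau, rho^2 tau, and so on: each increment is
    [pseudo_poincare_step], and the last error vanishes in the limit because u - res t u is of order
    t. *)
Lemma pseudo_poincare (s tau : R) u : 1 < s <= 2 -> 0 < tau ->
  wnorm vm s (fun x => u x - res tau u x) <=
  19 / 18 * Num.sqrt tau * wnorm vm s (gradient_norm e u).
Proof.
move=> s12 tau0; have /andP[s1 s2] := s12.
set Dn := wnorm vm s (gradient_norm e u); have D0 : 0 <= Dn by exact: wnorm_ge0.
(* Chosen with rational root 9/10: an increment costs (1 - rho) / (2 sqrt rho) = 19/180, and the
   geometric series of ratio 9/10 multiplies this by 10. *)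
pose rho : R := 81 / 100; have rho01 : 0 < rho < 1 by rewrite /rho; lra.
have sqrho (t : R) : 0 <= t -> Num.sqrt (rho * t) = 9 / 10 * Num.sqrt t.
  move=> t0; rewrite sqrtrM; last by rewrite /rho; lra.
  have -> : rho = (9 / 10) ^+ 2 by rewrite /rho; field.
  by rewrite sqrtr_sqr ger0_norm//; lra.
pose bn (t : R) := wnorm vm s (fun x => u x - res t u x).
have step t : 0 < t -> bn t <= bn (rho * t) + 19 / 180 * Num.sqrt t * Dn.
  move=> t0.
  have -> : bn t = wnorm vm s (fun x => (u x - res (rho * t) u x)
     + (1 - rho) * res (rho * t) (fun y => u y - res t u y) x).
    apply: wnorm_eq => x _; congr (`|_|).
    rewrite (resolvent_step e u x (ltW t0) (_ : 0 <= rho)); last by rewrite /rho; lra.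
    have := resolventD e (rho * t) u (res t u) (-1) x.
    rewrite (_ : (fun y => u y + -1 * res t u y) = (fun y => u y - res t u y)).
      by move=> ->; ring.
    by apply/funext => y; rewrite mulN1r.
  apply: le_trans (minkowski_wnorm vm0 _ _ s1) _; rewrite lerD2l.
  rewrite (wnormZ vm0) ?gt_eqF//; last by lra.
  rewrite ger0_norm; last by rewrite /rho; lra.
  have := pseudo_poincare_step u s12 t0 rho01; rewrite sqrho ?(ltW t0)//.
  have -> : t / (2 * (9 / 10 * Num.sqrt t)) = 5 / 9 * Num.sqrt t.
    have st0 : 0 < Num.sqrt t by rewrite sqrtr_gt0.
    by rewrite -{1}(sqr_sqrtr (ltW t0)); field; rewrite gt_eqF.
  have r1 : 0 <= 1 - rho by rewrite /rho; lra.
  by move=> h; have := ler_wpM2l r1 h; rewrite /rho /Dn; lra.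
have iter k t : 0 < t -> bn t <= bn (rho ^+ k * t) + 19 / 18 * Num.sqrt t * Dn.
  elim: k t => [|k IH] t t0.
    rewrite expr0 mul1r lerDl !mulr_ge0 ?sqrtr_ge0//.
  have rt0 : 0 < rho * t by rewrite mulr_gt0//; rewrite /rho; lra.
  have := IH _ rt0; rewrite mulrA -exprSr sqrho ?(ltW t0)// => h.
  by have := step t t0; lra.
pose ell x := \sum_(y | e x y) (u x - u y).
have small t : 0 <= t -> bn t <= t * wnorm vm s ell.
  move=> t0.
  have -> : bn t = wnorm vm s (fun x => t * res t ell x).
    apply: wnorm_eq => x _; congr (`|_|).
    have /(_ x) := @resolvent_unique R V e t u (fun y => u y + t * ell y) t0 (fun=> erefl).
    by rewrite resolventD => {1}->; ring.
  rewrite (wnormZ vm0) ?gt_eqF//; last by lra.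
  rewrite ger0_norm//; apply: ler_wpM2l => //.
  have s0 : 0 < s by lra.
  apply: (ler_powR_root s0); rewrite ?wnorm_ge0//.
  rewrite !vnorm_powR ?gt_eqF//; apply: ler_wpM2l; first by rewrite invr_ge0.
  by apply: sum_resolvent_powR => //; lra.
apply: (@le_of_geometric _ _ (tau * wnorm vm s ell) rho) => [|k].
  by have /andP[r0 ->] := rho01; rewrite ltW.
apply: le_trans (iter k tau tau0) _; rewrite addrC lerD2l.
apply: le_trans (small _ _) _.
  by rewrite mulr_ge0 ?exprn_ge0 ?(ltW tau0)//; rewrite /rho; lra.
by rewrite le_eqVlt; apply/orP; left; apply/eqP; ring.
Qed.

End Smoothing.

(** * Centring a signed power *)

Section Centering.
Variables (R : realType) (V : finType).
Hypothesis V_gt0 : (0 < #|V|)%N.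
Notation vm := (@vmeasure R V).
Let vm0 := @vmeasure_ge0 R V.

(** The right side has mean 0 as soon as z has mean 0 and |z|^s has mean 1; this is how
    [exists_sgpow_center] finds a sign. *)
Lemma sgpow_sub1_le (g s z : R) : 1 <= g <= s ->
  sgpow g (z - 1) <= `|z| `^ s - 1 + g * z.
Proof.
move=> /andP[g1 gs]; have g0 : g != 0 by lra.
have [z1|z1] := leP 1 z.
  have z0 : 0 <= z by lra.
  have z10 : 0 <= z - 1 by lra.
  rewrite (sgpow_ge0 z10 g0) (ger0_norm z0).
  have := powR_superadd g1 z10 ler01; rewrite subrK powR1.
  have : z `^ g <= z `^ s by apply: ler_powR.
  have : 0 <= g * z by apply: mulr_ge0; lra.
  by lra.
have -> : sgpow g (z - 1) = - (1 - z) `^ g.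
  by rewrite -[z - 1]opprB sgpowN sgpow_ge0//; lra.
have [z0|z0] := leP 0 z.
  have := @bernoulli_ge R g (- z) g1 ltac:(lra); have := powR_ge0 `|z| s; lra.
have := @bernoulli_ge R g (- z) g1 ltac:(lra); have := powR_ge0 `|z| s; lra.
Qed.

Lemma wsum_sgpow_continuous (g : R) (b : V -> R) : 1 <= g <= 2 ->
  continuous (fun a : R => wsum vm (fun x => sgpow g (b x - a))).
Proof.
move=> g12 a0; have g1 : 0 <= g - 1 by lra.
pose M := (\sum_x `|b x|) + `|a0| + 1.
have bM x : `|b x| <= \sum_x `|b x|.
  by rewrite (bigD1 x)//= lerDl sumr_ge0.
have M1 : 1 <= M by rewrite /M lerDr addr_ge0// sumr_ge0.
pose L := g * M `^ (g - 1).
have L0 : 0 < L by rewrite mulr_gt0 ?powR_gt0//; lra.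
apply/cvgrPdist_le => eps eps0.
near=> a.
have a1 : `|a0 - a| <= 1 by near: a; apply: cvgr_dist_le.
have a2 : `|a0 - a| <= eps / L by near: a; apply: cvgr_dist_le => //; exact: divr_gt0.
have aM : `|a| <= `|a0| + 1.
  by rewrite -[a](subKr a0) (le_trans (ler_normB _ _))// lerD2l.
apply: (@le_trans _ _ (wsum vm (fun=> eps))); last first.
  by rewrite /wsum -mulr_suml vmeasure_sum1// mul1r.
rewrite /wsum -sumrB; apply: le_trans (ler_norm_sum _ _ _) _.
apply: ler_sum => x _; rewrite -mulrBr normrM ger0_norm//; apply: ler_wpM2l => //.
apply: le_trans (sgpow_sub_midpoint _ _ g12) _.
have -> : b x - a0 - (b x - a) = a - a0 by ring.
have h1 : ((`|b x - a0| + `|b x - a|) / 2) `^ (g - 1) <= M `^ (g - 1).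
  apply: powR_leq; [exact: g1|by apply: divr_ge0; rewrite ?addr_ge0|].
  have := ler_normB (b x) a0; have := ler_normB (b x) a; have := bM x; rewrite /M; lra.
rewrite distrC -mulrA mulrCA.
apply: le_trans (_ : `|a0 - a| * L <= _); last by rewrite -ler_pdivlMr.
by rewrite /L; apply: ler_wpM2l => //; apply: ler_wpM2l => //; lra.
Unshelve. all: by end_near.
Qed.

(** Intermediate value theorem on the interval from -A to A, where A is the L^s norm of [b];
    [sgpow_sub1_le] gives the signs at the ends. This centre makes [zeta] = 0 possible in
    [gagliardo_nirenberg], while the L^s norm at most doubles. *)
Lemma exists_sgpow_center (g s : R) (b : V -> R) : 1 < s <= 2 -> 1 <= g <= s ->
  wsum vm b = 0 ->
  exists2 a, `|a| <= wnorm vm s b & wsum vm (fun x => sgpow g (b x - a)) = 0.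
Proof.
move=> /andP[s1 s2] g1s b0; have s0 : 0 < s by lra.
have /andP[g1 gs] := g1s.
have g12 : 1 <= g <= 2 by rewrite g1/=; lra.
have g0 : 0 < g by lra.
set A := wnorm vm s b.
have A0 : 0 <= A by exact: wnorm_ge0.
have [Az|An] := eqVneq A 0.
  exists 0; first by rewrite normr0.
  rewrite /wsum big1// => x _; have [->|vx] := eqVneq (vm x) 0; first by rewrite mul0r.
  by rewrite (wnorm_eq0 vm0 s0 Az vx) subrr /sgpow sgr0 mul0r mulr0.
have Ap : 0 < A by rewrite lt_def An.
have key (c : V -> R) : wsum vm c = 0 -> wnorm vm s c = A ->
    wsum vm (fun x => sgpow g (c x - A)) <= 0.
  move=> c0 cA.
  have pt x : sgpow g (c x - A) <= A `^ g * ((A `^ s)^-1 * `|c x| `^ s - 1 + g * (c x / A)).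
    have -> : c x - A = A * (c x / A - 1) by field.
    have -> : sgpow g (A * (c x / A - 1)) = A `^ g * sgpow g (c x / A - 1).
      by rewrite /sgpow sgrM (gtr0_sg Ap) mul1r normrM powRM// (gtr0_norm Ap) mulrCA.
    apply: ler_wpM2l; first exact: powR_ge0.
    apply: le_trans (sgpow_sub1_le _ g1s) _.
    have Ai : 0 <= A^-1 by rewrite invr_ge0.
    have -> // : `|c x / A| `^ s = (A `^ s)^-1 * `|c x| `^ s.
    by rewrite normrM normfV (gtr0_norm Ap) (powRM _ (normr_ge0 _) Ai) powRV// mulrC.
  apply: le_trans (_ : wsum vm (fun x => A `^ g * ((A `^ s)^-1 * `|c x| `^ s - 1 + g * (c x / A))) <= _).
    by apply: ler_sum => x _; apply: ler_wpM2l.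
  have -> : wsum vm (fun x => A `^ g * ((A `^ s)^-1 * `|c x| `^ s - 1 + g * (c x / A))) =
      A `^ g * ((A `^ s)^-1 * wsum vm (fun x => `|c x| `^ s) - \sum_x vm x
        + g / A * wsum vm c).
    rewrite /wsum !mulr_sumr -sumrB -big_split/= mulr_sumr.
    by apply: eq_bigr => x _; ring.
  rewrite c0 vmeasure_sum1// /wsum -(wnorm_powR vm0 c (lt0r_neq0 s0)) cA mulVf.
    by rewrite subrr mulr0 addr0 mulr0.
  by rewrite gt_eqF// powR_gt0.
have AA : - A <= A by lra.
have cont : {within `[- A, A], continuous (fun a : R => wsum vm (fun x => sgpow g (b x - a)))}%classic.
  by apply: continuous_subspaceT; exact: wsum_sgpow_continuous.
have hA : wsum vm (fun x => sgpow g (b x - A)) <= 0 by exact: key.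
have hN : 0 <= wsum vm (fun x => sgpow g (b x - - A)).
  have : wsum vm (fun x => sgpow g (- b x - A)) <= 0.
    apply: key; last exact: wnormN.
    by rewrite /wsum; under eq_bigr do rewrite mulrN; rewrite sumrN -/(wsum vm b) b0 oppr0.
  rewrite -oppr_ge0 /wsum -sumrN; congr (0 <= _).
  by apply: eq_bigr => x _; rewrite -mulrN -sgpowN opprB !opprK [A + _]addrC.
have [|a] := IVT AA cont (v := 0).
  by rewrite ge_min hA orbT le_max hN.
by rewrite in_itv/= => /andP[a1 a2] ha; exists a => //; rewrite ler_norml a1.
Qed.

End Centering.

(** * The abstract interpolation inequality *)

Section Interpolation.
Variables (R : realType) (V : finType) (e : rel V).
Hypothesis e_sym : symmetric e.
Hypothesis V_gt0 : (0 < #|V|)%N.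
Hypothesis E_gt0 : 0 < \sum_x degree R e x.
Variable tr : V -> V -> V -> option V.
Hypothesis tr_coupling : coupling R e tr.
Notation vm := (@vmeasure R V).
Notation em := (@emeasure R V e).
Notation md := (mean_degree R e).
Notation res := (resolvent e).

(** [Phi] is bounded through the L^P gradient on [a = res tau u] and through the L^P norm on
    [b = u - a]. The latter comes from Gagliardo-Nirenberg, fed with [pseudo_poincare] and
    [enorm_sub_resolvent_le]. The factor 19/9 is twice 19/18 because [b] is recentred. *)
Lemma interpolation_resolvent (P P' al C Delta kap s g x k nu tau K1 K2 c1 c2 : R)
    (Phi : (V -> R) -> R) (u : V -> R) :
  2 <= P -> 0 < P' -> P^-1 + P'^-1 = 1 -> 0 < al -> 0 <= C -> 0 < kap ->
  (forall u L, (forall a, L <= wnorm vm P (fun x => u x - a)) ->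
    L <= C * wnorm em al (ediff u)) ->
  (forall x, degree R e x <= Delta) ->
  (forall f a, wnorm vm P (fun x => f x - wsum vm f)
    <= kap * wnorm vm P (fun x => f x - a)) ->
  1 < s <= 2 -> 1 <= g <= s -> g * al = s -> 0 <= x <= 1 ->
  (1 - g * x) / s = (1 - x) / P ->
  0 < k <= 1 -> 0 <= nu -> centering k nu s ->
  0 < tau -> 0 <= K1 -> 0 <= K2 ->
  (forall f, Num.sqrt (energy e tau f) <= K1 * wnorm vm s f) ->
  (forall f, Num.sqrt (energy e tau f) <= K2 * wnorm vm P' f) ->
  0 <= c1 -> 0 <= c2 ->
  (forall f h, Phi (fun x => f x + h x) <= Phi f + Phi h) ->
  (forall f a, Phi (fun x => f x - a) = Phi f) ->
  (forall f, Phi f <= c1 * wnorm em P (ediff f)) ->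
  (forall f, Phi f <= c2 * wnorm vm P f) ->
  Phi u <= (c1 * (md `^ (s^-1 - P^-1) * (K1 * K2)) +
    c2 * ((19 / 9 * Num.sqrt tau * md `^ s^-1) `^ (1 - x) *
      (kap * C * (g * (Delta / md) `^ ((g - 1) / s)) * k^-1 `^ s^-1) `^ x))
    * wnorm em s (ediff u).
Proof.
move=> P2 P'0 PP al0 C0 kap0 sob deg mean s12 g1s gal x01 gx k01 nu0 cent tau0
  K10 K20 hK1 hK2 c10 c20 PhiD Phisub Phi1 Phi2.
have /andP[s1 s2] := s12; have s0 : 0 < s by lra.
have /andP[x0 x1] := x01; have /andP[g1 gs] := g1s.
have P1 : 1 < P by lra.
have mdp := md_gt0 V_gt0 E_gt0.
have D0 : 0 <= Delta.
  by have /card_gt0P[z _] := V_gt0; apply: le_trans (deg z); apply: sumr_ge0.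
set F := wnorm em s (ediff u); have F0 : 0 <= F by exact: wnorm_ge0.
pose a := res tau u; pose b := fun x => u x - a x.
have bmean : wsum vm b = 0.
  by rewrite wsum_vmeasure sumrB sum_resolvent ?(ltW tau0)// subrr mulr0.
have [m mb hm] := exists_sgpow_center V_gt0 s12 g1s bmean.
have -> : u = fun x => a x + b x by apply/funext => y; rewrite /b addrC subrK.
apply: le_trans (PhiD _ _) _; rewrite mulrDl; apply: lerD.
  apply: le_trans (Phi1 _) _; rewrite -mulrA; apply: ler_wpM2l => //.
  apply: (enorm_resolvent_le V_gt0 E_gt0 tr_coupling) => //.
  - by rewrite s0.
  - exact: ltW.
  - move=> f; apply: (resolvent_wnorm_le e_sym V_gt0) hK1 hK2 => //; exact: ltW.
  - exact: mulr_ge0.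
rewrite -(Phisub _ m); apply: le_trans (Phi2 _) _; rewrite -mulrA; apply: ler_wpM2l => //.
pose f y := b y - m.
have g12 : 1 <= g <= 2 by rewrite g1/=; lra.
have hmean : `|wsum vm (fun y => sgpow g (f y))| <= 0 * wnorm vm s f `^ g.
  by rewrite hm normr0 mul0r.
apply: le_trans (gagliardo_nirenberg e_sym V_gt0 E_gt0 P1 al0 C0 kap0 sob deg mean
  s1 g12 gal x01 gx (lexx 0) hmean) _.
have bs : wnorm vm s b <= 19 / 18 * Num.sqrt tau * (md `^ s^-1 * F).
  apply: le_trans (pseudo_poincare e_sym V_gt0 tr_coupling u s12 tau0) _.
  apply: ler_wpM2l; first by rewrite mulr_ge0 ?sqrtr_ge0//; lra.
  by apply: gradient_norm_le_enorm => //; rewrite s0.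
have fs : wnorm vm s f <= 19 / 9 * Num.sqrt tau * md `^ s^-1 * F.
  have : wnorm vm s f <= wnorm vm s b + `|m|.
    have := minkowski_wnorm (@vmeasure_ge0 R V) b (fun=> - m) s1.
    by rewrite wnormN (wnorm1 m (lt0r_neq0 s0) (vmeasure_sum1 R V_gt0)).
  by lra.
have df : wnorm em s (ediff f) <= k^-1 `^ s^-1 * F.
  have -> : wnorm em s (ediff f) = wnorm em s (ediff b).
    by apply: wnorm_eq => p _; congr (`|_|); rewrite /ediff /f; ring.
  by apply: (enorm_sub_resolvent_le e_sym E_gt0 tr_coupling _ (ltW tau0) s1 k01 nu0 cent).
rewrite mul0r addr0.
set B := kap * C * _.
have B0 : 0 <= B by rewrite !mulr_ge0 ?powR_ge0 ?(ltW kap0)//; lra.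
have ki : 0 <= k^-1 `^ s^-1 by exact: powR_ge0.
have T0 : 0 <= 19 / 9 * Num.sqrt tau * md `^ s^-1.
  by rewrite !mulr_ge0 ?sqrtr_ge0 ?powR_ge0//; lra.
have -> : (19 / 9 * Num.sqrt tau * md `^ s^-1) `^ (1 - x) * (B * k^-1 `^ s^-1) `^ x * F =
  (19 / 9 * Num.sqrt tau * md `^ s^-1 * F) `^ (1 - x) * (B * (k^-1 `^ s^-1 * F)) `^ x.
  rewrite (mulrA B) (powRM _ T0 F0) (powRM _ (mulr_ge0 B0 ki) F0) mulrACA.
  by rewrite -[F `^ _ * F `^ _]powRD ?subrK ?oner_eq0// powRr1.
apply: ler_pM; rewrite ?powR_ge0//.
  by apply: powR_leq => //; [lra|exact: wnorm_ge0].
apply: powR_leq => //; first by rewrite mulr_ge0// wnorm_ge0.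
exact: ler_wpM2l.
Qed.

End Interpolation.

(* The facts needed by [lia] must be in the goal: entries are abstracted there. *)
Ltac entries_lia :=
  clear;
  repeat match goal with
  | |- context [@fun_of_matrix ?T ?m ?k ?x ?i ?j] =>
      move: (@fun_of_matrix T m k x i j) => ?
  end; lia.

(** * Paths on the boundary of a box *)

Section BoundaryGraph.
Variables (d n : nat).
Implicit Types (x y z : Zd d).

Lemma adjacentI x y i : (`|x 0%R i - y 0%R i|)%N = 1%N ->
  (forall j, j != i -> x 0%R j = y 0%R j) -> adjacent x y.
Proof.
move=> hi hj; rewrite /adjacent (bigD1 i)//= big1 => [|j ji].
  by rewrite !mxE hi.
by rewrite !mxE hj// subrr.
Qed.

Lemma adjacent_sym x y : adjacent x y = adjacent y x.
Proof.
by apply/idP/idP => /adjacentP[i hi hj]; apply: (@adjacentI _ _ i) => [|j /hj//]; lia.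
Qed.

Lemma adjacent_sub x y x' y' : x - y = x' - y' -> adjacent x y = adjacent x' y'.
Proof. by rewrite /adjacent => ->. Qed.

Hypothesis d_gt0 : (0 < d)%N.

Lemma bdryP x : reflect ((forall i, (`|x 0%R i| <= n)%N) /\ exists i, (`|x 0%R i|)%N = n)
  (x \in bdry d n).
Proof.
rewrite mem_bdry; apply: (iffP eqP) => [xn|[h [i xi]]].
  split=> [i|]; first by rewrite -xn; exact: (@bigop.leq_bigmax _ (fun j : 'I_d => `|x 0%R j|%N)).
  have [|i xi] := @bigop.eq_bigmax _ (fun i : 'I_d => `|x 0%R i|%N); first by rewrite card_ord.
  by exists i; rewrite -xi.
apply/eqP; rewrite eqn_leq supnorm_le -{2}xi; apply/andP; split; first exact/forallP.
exact: (@bigop.leq_bigmax _ (fun j : 'I_d => `|x 0%R j|%N)).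
Qed.

(* [z] continues the path from [x] to [y]: straight ahead, or, if [x] and [y] are
   separated by a ridge of the box, around that ridge. *)
Definition continues x y z : bool := [&& adjacent x y, adjacent y z, x != z &
  (x + z - y == y) || (x + z - y \notin bdry d n)].

Lemma continues_sym x y z : continues x y z = continues z y x.
Proof.
rewrite /continues (adjacent_sym x y) (adjacent_sym z y) eq_sym [z + x]addrC.
by rewrite andbCA.
Qed.

(** Two unit steps along the same axis either go straight or go back, and [x != z] excludes the
    latter. *)
Lemma straight x y z i l : 
  (`|x 0%R i - y 0%R i|)%N = 1%N -> (forall j, j != i -> x 0%R j = y 0%R j) ->
  (`|y 0%R l - z 0%R l|)%N = 1%N -> (forall j, j != l -> y 0%R j = z 0%R j) ->
  x != z -> (x + z - y == y) = (l == i).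
Proof.
move=> hi hj hl hk xz; apply/eqP/eqP => [h|li].
  apply/eqP; apply: contraT => li; have := congr1 (fun v : Zd d => v 0 l) h.
  by rewrite !mxE (hj _ li); move: hl; entries_lia.
subst l; apply/rowP => j; rewrite !mxE; have [->|ji] := eqVneq j i; last first.
  by move: (hk j ji) (hj j ji); entries_lia.
have : x 0 i != z 0 i.
  apply: contra xz => /eqP e; apply/eqP/rowP => k; have [->//|ki] := eqVneq k i.
  by rewrite hj// hk.
by move: hi hl; entries_lia.
Qed.

(** A turn requires the fourth corner of the parallelogram to be interior. This forces the only
    extreme coordinate of [x] to be the axis of the turn, which is then directed inwards: hence
    there is at most one turn. If there were also a straight continuation, the axis of the path
    would be extreme at [y], and [x] or [z] would lie outside the box. *)
Lemma continues_uniq x y z z' : x \in bdry d n -> y \in bdry d n ->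
  z \in bdry d n -> z' \in bdry d n ->
  continues x y z -> continues x y z' -> z = z'.
Proof.
move=> xX yX.
(* If one of the two continuations is straight, it may be taken to be [z]. *)
wlog : z z' / (x + z - y == y) || (x + z' - y != y).
  move=> H zX z'X; have [h|h] := boolP ((x + z - y == y) || (x + z' - y != y)).
    exact: H.
  move=> c1 c2; apply/esym; apply: H => //.
  by move: h; rewrite negb_or negbK => /andP[h1 h2]; rewrite h2.
move=> ord /bdryP[zle [kz zk]] /bdryP[z'le [kz' z'k]].
move=> /and4P[/adjacentP[i hi hj] /adjacentP[l hl hk] xz c1].
move=> /and4P[_ /adjacentP[l' hl' hk'] xz' c2].
have [xle [kx xk]] := bdryP _ xX; have [yle _] := bdryP _ yX.
have s1 := straight hi hj hl hk xz; have s2 := straight hi hj hl' hk' xz'.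
(* At a turn the fourth corner stays in the box but avoids the boundary, so each of its coordinates
   is below [n] in absolute value. *)
have box_w (w : Zd d) m : (forall j, `|w 0%R j| <= n)%N -> m != i ->
    (`|y 0%R m - w 0%R m|)%N = 1%N -> (forall j, j != m -> y 0%R j = w 0%R j) ->
    x + w - y \notin bdry d n -> forall j, (`|(x + w - y)%R 0%R j| < n)%N.
  move=> wle mi hm hmj /bdryP h j; rewrite ltn_neqAle; apply/andP; split.
    apply/eqP => e; apply: h; split; last by exists j.
    move=> k; rewrite !mxE; have [->|km] := eqVneq k m.
      by rewrite (hj _ mi); move: (wle m); entries_lia.
    by rewrite -(hmj _ km); move: (xle k); entries_lia.
  rewrite !mxE; have [->|km] := eqVneq j m.
    by rewrite (hj _ mi); move: (wle m); entries_lia.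
  by rewrite -(hmj _ km); move: (xle j); entries_lia.
have [li|li] := eqVneq l i.
  have [l'i|l'i] := eqVneq l' i.
    have /eqP e1 : x + z - y == y by rewrite s1 li.
    have /eqP e2 : x + z' - y == y by rewrite s2 l'i.
    by apply: (addrI x); apply: (addIr (- y)); rewrite e1.
  move: c2; rewrite s2 (negbTE l'i)/= => c2.
  have lt := box_w _ _ z'le l'i hl' hk' c2.
  have ki : kz' = i.
    apply/eqP; apply: contraT => ki; move: (lt kz'); rewrite !mxE (hj _ ki).
    by move: z'k; entries_lia.
  subst kz' l.
  move: (hk' i); rewrite eq_sym => /(_ l'i) => yz'.
  have xz0 : x 0 i != z 0 i.
    apply: contra xz => /eqP e; apply/eqP/rowP => k; have [->//|ki] := eqVneq k i.
    by rewrite hj// hk.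
  by move: (zle i) (xle i) yz' xz0 hi hl z'k; entries_lia.
have {}ord : l' != i by move: ord; rewrite s1 s2 (negbTE li).
move: c1 c2; rewrite s1 s2 (negbTE li) (negbTE ord)/= => c1 c2.
have lt1 := box_w _ _ zle li hl hk c1; have lt2 := box_w _ _ z'le ord hl' hk' c2.
have kl : kx = l.
  apply/eqP; apply: contraT => kl; move: (lt1 kx) xk; rewrite !mxE -(hk _ kl); entries_lia.
have kl' : kx = l'.
  apply/eqP; apply: contraT => kl'; move: (lt2 kx) xk; rewrite !mxE -(hk' _ kl'); entries_lia.
subst l l'; apply/rowP => j; have [->|jk] := eqVneq j kx; last first.
  by rewrite -hk// hk'.
by move: (lt1 kx) (lt2 kx) hl hl' xk (hj _ li); rewrite !mxE; entries_lia.
Qed.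

End BoundaryGraph.

Ltac row_ring := apply/rowP => ?; rewrite !mxE; ring.

(** * The coupling on the boundary of a box *)

Section BoundaryCoupling.
Variables (d n : nat).
Hypothesis d_gt0 : (0 < d)%N.
Notation X := (bdry d n).
Implicit Types (x y z : X).

Definition bdry_rel : rel X := fun x y => adjacent (val x) (val y).

Lemma bdry_rel_sym : symmetric bdry_rel.
Proof. by move=> x y; exact: adjacent_sym. Qed.

(** Matches neighbours x' of x with neighbours of y: y itself goes to the point ahead, the point
    behind x goes to x, and sideways points are translated along with the edge. By [transportP] the
    only failure is that nothing lies ahead. *)
Definition transport x x' y : option X :=
  if x' == y then [pick z : X | continues n (val x) (val y) (val z)]
  else if continues n (val y) (val x) (val x') then Some x
  else insub (val x' + val y - val x).

Variant transport_spec x x' y : option X -> Prop :=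
| TransportNone of x' = y & (forall z, ~~ continues n (val x) (val y) (val z)) :
    transport_spec x x' y None
| TransportAhead z of x' = y & continues n (val x) (val y) (val z) :
    transport_spec x x' y (Some z)
| TransportBack of x' != y & continues n (val y) (val x) (val x') :
    transport_spec x x' y (Some x)
| TransportSide z of x' != y & z != x & val z = val x' + val y - val x :
    transport_spec x x' y (Some z).

Lemma transportP x x' y : bdry_rel x x' -> bdry_rel x y ->
  transport_spec x x' y (transport x x' y).
Proof.
move=> exx' exy; rewrite /transport; case: eqP => [x'y|/eqP x'y].
  by case: pickP => [z zc|h]; [exact: TransportAhead|apply: TransportNone => // z; rewrite h].
have [c|nc] := boolP (continues _ _ _ _); first exact: TransportBack.
move: nc; rewrite /continues [adjacent (val y) _]adjacent_sym -/(bdry_rel x y) exy.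
rewrite -/(bdry_rel x x') exx' (inj_eq val_inj) eq_sym x'y/= negb_or negbK.
rewrite [val y + _]addrC => /andP[px pX].
by rewrite (insubT (fun p => p \in X) pX); apply: TransportSide.
Qed.

Lemma continues_bdry_uniq x y z z' : continues n (val x) (val y) (val z) ->
  continues n (val x) (val y) (val z') -> z = z'.
Proof.
by move=> c1 c2; apply: val_inj; apply: continues_uniq c1 c2; rewrite ?fsvalP.
Qed.

Lemma transport_edge x x' y z : bdry_rel x x' -> bdry_rel x y ->
  transport x x' y = Some z -> bdry_rel x' z.
Proof.
move=> exx' exy; case: transportP => // [z' -> /and4P[_ h _ _]|_ _|z' _ _ hz'] [<-].
- exact: h.
- by rewrite bdry_rel_sym.
rewrite /bdry_rel (@adjacent_sub _ _ _ (val x) (val y)) ?exy//.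
by rewrite hz'; row_ring.
Qed.

Lemma continues_return x y z : continues n (val x) (val y) (val z) -> z <> x.
Proof. by move=> /and4P[_ _ /eqP xz _] zx; apply: xz; rewrite zx. Qed.

(* The fourth corner of a parallelogram cannot belong to the boundary when the
   path continues along two of its sides, unless the path is straight. *)
Lemma continues_corner x y z t : continues n (val x) (val y) (val z) ->
  val t = val x + val z - val y -> t = y.
Proof.
move=> /and4P[_ _ _ /orP[/eqP h|h]] ht; first by apply: val_inj; rewrite ht.
by move: h; rewrite -ht fsvalP.
Qed.

Lemma transport_inj x x' y1 y2 z : bdry_rel x x' -> bdry_rel x y1 -> bdry_rel x y2 ->
  transport x x' y1 = Some z -> transport x x' y2 = Some z -> y1 = y2.
Proof.
move=> exx' e1 e2 t1 t2.
case: (transportP exx' e1) t1 => [? ? //|z1 h1 c1 [E1]|h1 c1 [E1]|z1 h1 n1 c1 [E1]];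
case: (transportP exx' e2) t2 => [? ? //|z2 h2 c2 [E2]|h2 c2 [E2]|z2 h2 n2 c2 [E2]].
- by rewrite -h1 -h2.
- by have := continues_return c1; rewrite E1 E2.
- have := continues_corner c1 (t := y2); rewrite E1 -E2 c2 h1.
  have -> : val x + (val y1 + val y2 - val x) - val y1 = val y2 by row_ring.
  by move=> /(_ erefl) e; rewrite h1 e eqxx in h2.
- by have := continues_return c2; rewrite E1 E2.
- by apply: (@continues_bdry_uniq x' x); rewrite continues_sym.
- by rewrite E2 -E1 eqxx in n2.
- have := continues_corner c2 (t := y1); rewrite E2 -E1 c1 h2.
  have -> : val x + (val y2 + val y1 - val x) - val y2 = val y1 by row_ring.
  by move=> /(_ erefl) e; rewrite h2 e eqxx in h1.
- by rewrite E1 -E2 eqxx in n1.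
- apply: val_inj; apply: (addrI (val x')); apply: (addIr (- val x)).
  by rewrite -c1 -c2 E1 E2.
Qed.

Lemma transport_inj_neighbour x y x1 x2 z : bdry_rel x y -> bdry_rel x x1 ->
  bdry_rel x x2 ->
  transport x x1 y = Some z -> transport x x2 y = Some z -> x1 = x2.
Proof.
move=> exy e1 e2 t1 t2.
case: (transportP e1 exy) t1 => [? ? //|z1 h1 c1 [E1]|h1 c1 [E1]|z1 h1 n1 c1 [E1]];
case: (transportP e2 exy) t2 => [? ? //|z2 h2 c2 [E2]|h2 c2 [E2]|z2 h2 n2 c2 [E2]].
- by rewrite h1 h2.
- by have := continues_return c1; rewrite E1 E2.
- have := continues_corner c1 (t := x2); rewrite E1 -E2 c2.
  have -> : val x + (val x2 + val y - val x) - val y = val x2 by row_ring.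
  by move=> /(_ erefl) e; rewrite e eqxx in h2.
- by have := continues_return c2; rewrite E1 E2.
- exact: continues_bdry_uniq c1 c2.
- by rewrite E2 -E1 eqxx in n2.
- have := continues_corner c2 (t := x1); rewrite E2 -E1 c1.
  have -> : val x + (val x1 + val y - val x) - val y = val x1 by row_ring.
  by move=> /(_ erefl) e; rewrite e eqxx in h1.
- by rewrite E1 -E2 eqxx in n1.
- apply: val_inj; apply: (addIr (val y)); apply: (addIr (- val x)).
  by rewrite -c1 -c2 E1 E2.
Qed.

(** Hence [x] is the only neighbour of [y] that can remain unmatched, and the remainder in the
    coupling identity is a multiple of [a y - a x]. *)
Lemma transport_onto x y z : bdry_rel x y -> bdry_rel y z -> z != x ->
  exists2 x', bdry_rel x x' & transport x x' y = Some z.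
Proof.
move=> exy eyz zx.
have [c|nc] := boolP (continues n (val x) (val y) (val z)).
  exists y => //; case: transportP => // [_ /(_ z)|z' _ c'|/eqP//|z' /eqP//].
    by rewrite c.
  by rewrite (continues_bdry_uniq c c').
move: (nc); rewrite /continues -/(bdry_rel x y) -/(bdry_rel y z) exy eyz.
rewrite (inj_eq val_inj) eq_sym zx/= negb_or negbK => /andP[py pX].
pose p : X := [` pX].
have pv : val p = val x + val z - val y by [].
have exp : bdry_rel x p.
  rewrite /bdry_rel (@adjacent_sub _ _ _ (val y) (val z)) ?eyz//.
  by rewrite pv; row_ring.
exists p => //.
have py' : p != y by rewrite -(inj_eq val_inj).
case: transportP => // [/eqP|z' /eqP|_ c|z' _ _ h]; rewrite ?(negbTE py')//.
  have := continues_corner c (t := z); rewrite pv.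
  have -> : val y + (val x + val z - val y) - val x = val z by row_ring.
  by move=> /(_ erefl) e; rewrite e eqxx in zx.
congr Some; apply: val_inj; rewrite h pv; row_ring.
Qed.

Variable R : realType.

Lemma transport_count x y z : bdry_rel x y ->
  \sum_(x' | bdry_rel x x') (transport x x' y == Some z)%:R <= 1 :> R.
Proof.
move=> exy; have [/existsP[i /andP[Pi /eqP ki]]|] :=
  boolP [exists x', bdry_rel x x' && (transport x x' y == Some z)].
  rewrite (bigD1 i)//= ki eqxx big1 ?addr0// => i' /andP[Pi' ii'].
  by case: eqP => // ki'; rewrite (transport_inj_neighbour exy Pi' Pi ki' ki) eqxx in ii'.
move=> /existsPn no; rewrite big1 ?ler01// => i Pi.
by have := no i; rewrite Pi/= => /negbTE ->.
Qed.

Lemma transport_count1 x y z : bdry_rel x y -> bdry_rel y z -> z != x ->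
  \sum_(x' | bdry_rel x x') (transport x x' y == Some z)%:R = 1 :> R.
Proof.
move=> exy eyz zx; apply/eqP; rewrite eq_le transport_count//=.
have [x' exx' tx'] := transport_onto exy eyz zx.
by rewrite (bigD1 x')//= tx' eqxx lerDl sumr_ge0.
Qed.

Lemma sum_transport x y (F : X -> R) : bdry_rel x y ->
  \sum_(z | bdry_rel y z) F z = \sum_(x' | bdry_rel x x') oapp F 0 (transport x x' y)
   + (1 - \sum_(x' | bdry_rel x x') (transport x x' y == Some x)%:R) * F x.
Proof.
move=> exy.
have -> : \sum_(x' | bdry_rel x x') oapp F 0 (transport x x' y) =
    \sum_(z | bdry_rel y z) (\sum_(x' | bdry_rel x x') (transport x x' y == Some z)%:R) * F z.
  under [RHS]eq_bigr do rewrite mulr_suml.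
  rewrite exchange_big/=; apply: eq_bigr => x' exx'.
  case E : (transport x x' y) => [z|]/=; last by rewrite big1// => z _; rewrite mul0r.
  have eyz : bdry_rel y z.
    case: (transportP exx' exy) E => [? ? //|z' _ /and4P[_ h _ _] [<-]//|_ _ [<-]|z' _ _ hz' [<-]].
      by rewrite bdry_rel_sym.
    rewrite /bdry_rel (@adjacent_sub _ _ _ (val x) (val x')) ?exx'//.
    by rewrite hz'; row_ring.
  rewrite (bigD1 z)//= eqxx mul1r big1 ?addr0// => z' /andP[_ zz'].
  by rewrite (inj_eq Some_inj) eq_sym (negbTE zz') mul0r.
have eyx : bdry_rel y x by rewrite bdry_rel_sym.
rewrite (bigD1 x)//= [in RHS](bigD1 x)//=.
rewrite [X in _ = _ + X + _](eq_bigr F) => [|z /andP[eyz zx]]; first by ring.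
by rewrite transport_count1// mul1r.
Qed.

(** [zeta] is 0 if some neighbour of [x] is matched with [x] seen as a neighbour of [y], and 1
    otherwise. The identity follows from [sum_transport] for [a] and for the constant 1, since [y]
    is the only neighbour of [x] that may have no image. *)
Lemma transport_coupling : coupling R bdry_rel transport.
Proof.
split=> [x x' y z|x x' y1 y2 z|x y exy].
- exact: transport_edge.
- exact: transport_inj.
exists (1 - \sum_(x' | bdry_rel x x') (transport x x' y == Some x)%:R).
  by rewrite subr_ge0 transport_count.
move=> a; set v := 1 - _.
pose s x' : R := (transport x x' y != None)%:R.
have hs x' : bdry_rel x x' -> x' != y -> s x' = 1.
  by move=> exx' x'y; rewrite /s; case: transportP => // /eqP; rewrite (negbTE x'y).
have ha := sum_transport a exy; have h1 := sum_transport (fun=> 1) exy.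
rewrite -/v mulr1 in ha h1.
have hs1 : \sum_(x' | bdry_rel x x') oapp (fun=> 1) 0 (transport x x' y) =
    \sum_(x' | bdry_rel x x') s x'.
  by apply: eq_bigr => x' _; rewrite /s; case: (transport x x' y).
rewrite hs1 in h1.
have sy (F : X -> R) : \sum_(x' | bdry_rel x x') s x' * F x' =
    \sum_(x' | bdry_rel x x') F x' - (1 - s y) * F y.
  rewrite (bigD1 y)//= [in RHS](bigD1 y)//=.
  rewrite [X in _ + X = _](eq_bigr F) => [|x' /andP[exx' x'y]]; first by ring.
  by rewrite hs// mul1r.
have sya := sy a; have sy1 := sy (fun=> 1).
have hs1' : \sum_(x' | bdry_rel x x') s x' * 1 = \sum_(x' | bdry_rel x x') s x'.
  by apply: eq_bigr => x' _; rewrite mulr1.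
rewrite hs1' mulr1 in sy1.
have -> : \sum_(x' | bdry_rel x x')
     (a y - a x - oapp (fun z => a z - a x') 0 (transport x x' y)) =
   (a y - a x) * (\sum_(x' | bdry_rel x x') 1) -
   \sum_(x' | bdry_rel x x') oapp a 0 (transport x x' y) +
   (\sum_(x' | bdry_rel x x') a x' - (1 - s y) * a y).
  rewrite -sya mulr_sumr -sumrB -big_split/=; apply: eq_bigr => x' _.
  by rewrite /s; case: (transport x x' y) => [z|]/=; ring.
rewrite !sumrB.
have cst u c : \sum_(z | bdry_rel u z) c = c * \sum_(z | bdry_rel u z) 1 :> R.
  by rewrite mulr_sumr; apply: eq_bigr => z _; rewrite mulr1.
rewrite (cst y (a y)) (cst x (a x)) ha.
move: h1 sy1; set A := \sum_(z | bdry_rel y z) 1; set B := \sum_(z | bdry_rel x z) 1.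
by move=> -> ->; ring.
Qed.

End BoundaryCoupling.

(** * Degrees and cardinality of the boundary *)

Section BoundaryDegrees.
Variables (d n : nat).
Hypothesis d_gt0 : (0 < d)%N.
Hypothesis n_gt0 : (0 < n)%N.
Notation X := (bdry d n).

Definition step (i : 'I_d) (b : bool) : Zd d :=
  \row_j (if j == i then (if b then 1 else -1) else 0).

Lemma adjacent_step (x : Zd d) i b : adjacent x (x + step i b).
Proof.
apply: (@adjacentI _ _ _ i) => [|j ji].
  by rewrite !mxE eqxx; case: b; entries_lia.
by rewrite !mxE (negbTE ji) addr0.
Qed.

Lemma adjacent_stepP (x y : Zd d) : adjacent x y -> exists i b, y = x + step i b.
Proof.
move=> /adjacentP[i hi hj]; exists i, (x 0 i < y 0 i); apply/rowP => j.
rewrite !mxE; have [->|ji] := eqVneq j i; last by rewrite addr0 hj.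
by case: ifP; move: hi; entries_lia.
Qed.

Lemma step_inj i b i' b' : step i b = step i' b' -> i = i' /\ b = b'.
Proof.
move=> h; have := congr1 (fun v : Zd d => v 0 i) h; rewrite !mxE eqxx.
have [<-|ii'] := eqVneq i i'; last by case: b {h}.
by case: b b' {h} => [] [].
Qed.

Definition dirs (x : Zd d) (i : 'I_d) : nat :=
  (\sum_(b : bool) ((x + step i b)%R \in X))%N.

Lemma card_neighbours (x : X) :
  (\sum_(y | @bdry_rel d n x y) 1 = \sum_i dirs (val x) i)%N.
Proof.
rewrite /dirs pair_bigA/= big_mkcond/=.
rewrite (eq_bigr (fun y : X => \sum_(p : 'I_d * bool) (val y == (val x + step p.1 p.2)%R)))%N.
  rewrite exchange_big/=; apply: eq_bigr => [[i b]] _ /=.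
  have [pX|pX] := boolP ((val x + step i b)%R \in X).
    rewrite (bigD1 [` pX])//= eqxx big1 ?addn0// => y.
    by rewrite -(inj_eq val_inj)/= => /negbTE ->.
  rewrite big1// => y _; apply/eqP; rewrite eqb0; apply: contra pX => /eqP <-.
  exact: fsvalP.
move=> y _; case: ifP => [/adjacent_stepP[i [b e]]|na].
  rewrite (bigD1 (i, b))//=; move/eqP: (e) => ->; rewrite big1// => [[i' b']] ib.
  apply/eqP; rewrite eqb0; apply: contra ib => /eqP e'.
  have /addrI/step_inj[ii bb] := etrans (esym e') e.
  by apply/eqP; congr pair.
rewrite big1// => [[i b]] _ /=; case: eqP => // e.
have : bdry_rel x y by rewrite /bdry_rel (_ : val y = val x + step i b) ?adjacent_step.
by rewrite na.
Qed.

Lemma dirs_le2 x i : (dirs x i <= 2)%N.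
Proof. by rewrite /dirs big_bool/=; case: (_ \in _); case: (_ \in _). Qed.

Lemma dirs_extreme (x : Zd d) i : (`|x 0%R i|)%N = n -> (dirs x i <= 1)%N.
Proof.
move=> xi; rewrite /dirs big_bool/=.
have [h1|_] := boolP ((x + step i true)%R \in X); last by case: (_ \in X).
have [h2|//] := boolP ((x + step i false)%R \in X).
have [/(_ i) + _] := bdryP n d_gt0 _ h1; have [/(_ i) + _] := bdryP n d_gt0 _ h2.
by rewrite !mxE eqxx; move: xi n_gt0; entries_lia.
Qed.

Lemma dirs_sole_extreme (x : Zd d) i : (forall j, (`|x 0%R j| <= n)%N) ->
  (forall j, j != i -> (`|x 0%R j|)%N != n) -> (`|x 0%R i|)%N = n -> dirs x i = 0%N.
Proof.
move=> xle sole xi; rewrite /dirs big1// => b _.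
apply/eqP; rewrite eqb0; apply/negP => /(bdryP n d_gt0)[hle [k hk]].
have ki : k = i.
  apply/eqP; apply: contraT => ki; have := sole _ ki; move: hk.
  by rewrite !mxE (negbTE ki) addr0 => ->; rewrite eqxx.
subst k; move: hk (hle i); rewrite !mxE eqxx; case: b {hle}; move: xi n_gt0; entries_lia.
Qed.

Lemma dirs_other (x : Zd d) i l : (forall j, (`|x 0%R j| <= n)%N) -> l != i ->
  (`|x 0%R l|)%N = n -> (1 <= dirs x i)%N.
Proof.
move=> xle li xl; rewrite /dirs.
rewrite (bigD1 (x 0 i < 0))//= (_ : (_ \in X) = true) ?leq_addr//.
apply/(bdryP n d_gt0); split; last by exists l; rewrite !mxE (negbTE li) addr0.
move=> j; rewrite !mxE; have [->|ji] := eqVneq j i; last by rewrite addr0.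
by case: ifP; move: (xle i) n_gt0; entries_lia.
Qed.

Lemma dirs_interior (x : Zd d) i l : (forall j, (`|x 0%R j| <= n)%N) -> l != i ->
  (`|x 0%R l|)%N = n -> (`|x 0%R i|)%N != n -> dirs x i = 2%N.
Proof.
move=> xle li xl xi; rewrite /dirs big_bool/=.
have h b : x + step i b \in X.
  apply/(bdryP n d_gt0); split; last by exists l; rewrite !mxE (negbTE li) addr0.
  move=> j; rewrite !mxE; have [->|ji] := eqVneq j i; last by rewrite addr0.
  by case: b; move: (xle i) xi; entries_lia.
by rewrite !h.
Qed.

(** An axis contributes at most 2 neighbours. If only one coordinate is extreme, its axis
    contributes none; if there are two, each of their axes contributes at most 1. *)
Lemma neighbours_le (x : X) : (\sum_i dirs (val x) i <= 2 * d.-1)%N.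
Proof.
have [xle [k xk]] := bdryP n d_gt0 _ (fsvalP x).
have [/existsP[l /andP[lk /eqP xl]]|no] := boolP [exists l, (l != k) && (`|(val x) 0%R l|%N == n)].
  rewrite (bigD1 k)//= (bigD1 l)//=.
  have h : (\sum_(i | (i != k) && (i != l)) dirs (val x) i <= 2 * d.-2)%N.
    apply: leq_trans (_ : \sum_(i | (i != k) && (i != l)) 2 <= _)%N.
      by apply: leq_sum => i _; exact: dirs_le2.
    rewrite sum_nat_const mulnC leq_mul2l/=.
    have c := cardD1 l (predC1 k); rewrite cardC1 card_ord inE lk in c.
    rewrite (@eq_card _ _ [predD1 predC1 k & l]); last by move=> i; rewrite !inE andbC.
    by move: c; rewrite add1n => c; rewrite c.
  have d2 : (1 < d)%N.
    by move: lk; rewrite -(inj_eq val_inj)/=; have := ltn_ord l; have := ltn_ord k; lia.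
  apply: leq_trans (leq_add (dirs_extreme xk) (leq_add (dirs_extreme xl) h)) _; lia.
rewrite (bigD1 k)//= dirs_sole_extreme//; last first.
  by move=> j jk; move/existsPn/(_ j): no; rewrite jk.
apply: leq_trans (_ : \sum_(i | i != k) 2 <= _)%N.
  by apply: leq_sum => i _; exact: dirs_le2.
by rewrite sum_nat_const cardC1 card_ord mulnC.
Qed.

Lemma neighbours_sole (x : X) k : (forall j, j != k -> (`|(val x) 0%R j|)%N != n) ->
  (2 * d.-1 <= \sum_i dirs (val x) i)%N.
Proof.
move=> sole; have [xle [k' xk]] := bdryP n d_gt0 _ (fsvalP x).
have kk : k' = k.
  by apply/eqP; apply: contraT => /sole; rewrite xk eqxx.
subst k'; rewrite (bigD1 k)//= -[leqLHS]add0n leq_add//.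
rewrite (eq_bigr (fun=> 2)%N) => [|i ik].
  by rewrite sum_nat_const cardC1 card_ord mulnC.
by apply: dirs_interior xk _ => //; [rewrite eq_sym|exact: sole].
Qed.

Lemma neighbours_ge (x : X) : (1 < d)%N -> (d <= \sum_i dirs (val x) i)%N.
Proof.
move=> d1; have [xle [k xk]] := bdryP n d_gt0 _ (fsvalP x).
have [/existsP[l /andP[lk /eqP xl]]|no] := boolP [exists l, (l != k) && (`|(val x) 0%R l|%N == n)].
  apply: leq_trans (_ : \sum_(i < d) 1 <= _)%N; first by rewrite sum_nat_const card_ord muln1.
  apply: leq_sum => i _; have [->|ik] := eqVneq i k.
    exact: dirs_other lk xl.
  by apply: (@dirs_other _ _ k) => //; rewrite eq_sym.
apply: leq_trans (neighbours_sole (k := k) _); first by lia.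
by move=> j jk; move/existsPn/(_ j): no; rewrite jk.
Qed.

Lemma neighbours_corner (x : X) : (forall j, (`|(val x) 0%R j|)%N = n) ->
  (\sum_i dirs (val x) i <= d)%N.
Proof.
move=> ext; apply: leq_trans (_ : \sum_(i < d) 1 <= _)%N.
  by apply: leq_sum => i _; exact: dirs_extreme.
by rewrite sum_nat_const card_ord muln1.
Qed.

(** A neighbour in the open box shares all coordinates but one. *)
Lemma tbdry_sole (y : Zd d) : y \in tbdry d n ->
  exists k, forall j, j != k -> (`|y 0%R j|)%N != n.
Proof.
rewrite in_fset/= => /andP[yb /existsP[x /adjacentP[i hi hj]]].
exists i => j ji; have := fsvalP x; rewrite mem_obox => xn.
rewrite -(hj _ ji).
have : (supnorm (val x) <= n.-1)%N by rewrite -ltnS prednK.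
rewrite supnorm_le => /forallP/(_ j).
by move: n_gt0; rewrite /=; entries_lia.
Qed.

Lemma card_box k : #|` box d k| = (k.*2.+1 ^ d)%N.
Proof.
rewrite card_imfset/=; last first.
  move=> f g /rowP h; apply/ffunP => i; apply: val_inj.
  by have := h i; rewrite !mxE => /addIr [].
by rewrite -cardE card_ffun !card_ord.
Qed.

Lemma card_bdry : #|` X| = (n.*2.+1 ^ d - n.*2.-1 ^ d)%N.
Proof.
have -> : X = box d n `\` obox d n.
  apply/fsetP => x; rewrite in_fsetD mem_bdry mem_obox mem_box; lia.
have -> : obox d n = box d n.-1.
  by apply/fsetP => x; rewrite mem_obox mem_box; lia.
rewrite cardfsD (fsetIidPr _).
  by rewrite !card_box; congr (_ - _ ^ _)%N; lia.
by apply/fsubsetP => x; rewrite !mem_box; lia.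
Qed.

End BoundaryDegrees.

(** For j = 2n - 1 and m = d - 1 the second part is (2n+1)^d - (2n-1)^d >= 2 d (2n)^(d-1); its
    induction needs the first part, midpoint convexity. *)
Lemma sub_pow_ge (j m : nat) :
  ((2 * j.+1 ^ m <= j.+2 ^ m + j ^ m) /\
   (2 * m.+1 * j.+1 ^ m + j ^ m.+1 <= j.+2 ^ m.+1))%N.
Proof.
elim: m => [|m [IH1 IH2]]; first by rewrite !expn0 !expn1 muln1; lia.
have IH3 : (j ^ m <= j.+2 ^ m)%N by case: m {IH1 IH2} => // m; rewrite leq_exp2r//; lia.
rewrite !(expnS _ m.+1) !(expnS _ m) in IH2 *.
move: (j ^ m)%N (j.+1 ^ m)%N (j.+2 ^ m)%N IH1 IH2 IH3 => a b c IH1 IH2 IH3.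
split; nia.
Qed.

Lemma card_bdry_ge d n : (0 < d)%N -> (0 < n)%N ->
  (2 * d * n.*2 ^ d.-1 <= #|` bdry d n|)%N.
Proof.
case: d n => [//|m] [//|n] _ n0; rewrite card_bdry//.
have [_ h] := sub_pow_ge n.*2.+1 m.
have -> : (n.+1.*2 = n.*2.+2)%N by lia.
rewrite /= in h *; lia.
Qed.

(** * The norms of the theorem as weighted norms *)

Section AveragedNorms.
Variable R : realType.

Lemma sum_fset_bij (T : finType) (K : choiceType) (P : pred T) (h : T -> K)
    (A : {fset K}) (G : K -> R) : injective h ->
  (forall p, P p -> h p \in A) -> (forall k, k \in A -> exists2 p, P p & h p = k) ->
  \sum_(k <- A) G k = \sum_(p | P p) G (h p).
Proof.
move=> hinj hA Ah.
rewrite (perm_big (map h (enum P)))/=; first by rewrite big_map big_enum.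
apply: uniq_perm; rewrite ?fset_uniq ?map_inj_uniq ?enum_uniq//.
move=> k; apply/idP/mapP => [/Ah[p Pp <-]|[p Pp ->]].
  by exists p => //; rewrite mem_enum.
by apply: hA; rewrite mem_enum in Pp.
Qed.

Lemma anormE (T : choiceType) (s : R) (A : {fset T}) (f : T -> R) :
  anorm s A f = wnorm (@vmeasure R A) s (fun x : A => f (val x)).
Proof.
by rewrite wnormE /anorm big_seq_fsetE/= mulr_sumr /vmeasure -cardfE.
Qed.

Lemma sum_tedges d n (G : oedge d -> R) : \sum_(k <- tedges d n) G k =
  \sum_x \sum_(y | @bdry_rel d n x y) G (val x, val y).
Proof.
rewrite pair_big_dep/=.
apply: (@sum_fset_bij _ _ (fun p : bdry d n * bdry d n => bdry_rel p.1 p.2)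
   (fun p => (val p.1, val p.2))).
- by move=> [a b] [a' b'] [/val_inj -> /val_inj ->].
- move=> [x y] /= exy; rewrite mem_tedges /= !fsvalP; exact: exy.
move=> [x y]; rewrite mem_tedges /= => /and3P[xX yX a].
by exists ([` xX], [` yX]).
Qed.

Lemma degree_bdry d n (x : bdry d n) :
  degree R (@bdry_rel d n) x = (\sum_(y | bdry_rel x y) 1)%N%:R.
Proof. by rewrite /degree natr_sum. Qed.

Lemma card_tedges d n : #|` tedges d n|%:R = \sum_x degree R (@bdry_rel d n) x.
Proof. by rewrite card_fset_sum1 natr_sum sum_tedges. Qed.

Lemma anorm_tedges d n (s : R) (f : Zd d -> R) : s != 0 ->
  anorm s (tedges d n) (grad f) =
  wnorm (@emeasure R _ (@bdry_rel d n)) s (ediff (fun x : bdry d n => f (val x))).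
Proof.
move=> s0; rewrite wnormE /anorm sum_tedges card_tedges; congr (_ `^ _).
have := wsum_emeasure (@bdry_rel d n) (fun x y => `|f (val y) - f (val x)| `^ s).
by rewrite /wsum /ediff => ->.
Qed.

Lemma normal_snd d n (y : Zd d) : y \in tbdry d n -> (normal n y).2 = y.
Proof. by move=> /Defs.normalP/andP[_ /eqP]. Qed.

Lemma normal_nedges d n (y : Zd d) : y \in tbdry d n -> normal n y \in nedges d n.
Proof. by move=> /Defs.normalP/andP[]. Qed.

Lemma nedges_normal d n (k : oedge d) : k \in nedges d n ->
  k.2 \in tbdry d n /\ normal n k.2 = k.
Proof.
case: k => x y kE; have := kE; rewrite mem_nedges /= => /and3P[xo yb a].
have yt : y \in tbdry d n.
  rewrite in_fset; apply/andP; split; first exact: yb.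
  by apply/existsP; exists [` xo].
split=> //; have := normal_nedges yt; have := normal_snd yt.
case: (normal n y) => x' y' /= -> h.
by rewrite (normal_uniq kE h).
Qed.

Lemma sum_nedges d n (G : oedge d -> R) :
  \sum_(k <- nedges d n) G k = \sum_(y : tbdry d n) G (normal n (val y)).
Proof.
apply: (@sum_fset_bij _ _ predT (fun y : tbdry d n => normal n (val y))) => //.
- move=> y y' h; apply: val_inj.
  exact: etrans (esym (normal_snd (fsvalP y))) (etrans (congr1 snd h) (normal_snd (fsvalP y'))).
- by move=> y _; exact: normal_nedges (fsvalP y).
move=> k /nedges_normal[kt kn]; by exists [` kt].
Qed.

Lemma anorm_nedges d n (s : R) (F : oedge d -> R) :
  anorm s (nedges d n) F =
  wnorm (@vmeasure R (tbdry d n)) s (fun y : tbdry d n => F (normal n (val y))).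
Proof.
rewrite wnormE /anorm sum_nedges mulr_sumr /vmeasure; congr (_ `^ _).
suff -> : #|` nedges d n| = #|{: tbdry d n}| by [].
apply/eqP; rewrite -(eqr_nat R) card_fset_sum1 natr_sum -sum1_card natr_sum.
by rewrite sum_nedges.
Qed.

Lemma ext_val (d : nat) (A : {fset Zd d}) (f : {ffun A -> R^o}) (x : A) :
  ext f (val x) = f x.
Proof. by rewrite /ext valK. Qed.

Lemma ext_in (d : nat) (A : {fset Zd d}) (f : {ffun A -> R^o}) x (xA : x \in A) :
  ext f x = f [` xA].
Proof. by rewrite -ext_val. Qed.

Lemma ext_restr (d : nat) (A : {fset Zd d}) (f : Zd d -> R) x : x \in A ->
  ext (restr A f) x = f x.
Proof. by move=> xA; rewrite ext_in ffunE. Qed.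

End AveragedNorms.

(** * Lower bounds for [c] from a test function at two corners *)

Section CornerTest.
Variables (R : realType) (d n : nat).
Hypothesis d_gt1 : (1 < d)%N.
Hypothesis n_gt0 : (0 < n)%N.
Notation X := (bdry d n).
Notation em := (@emeasure R X (@bdry_rel d n)).
Notation vm := (@vmeasure R X).
Let d_gt0 : (0 < d)%N := ltnW d_gt1.

Lemma natr_pred : d%:R - 1 = d.-1%:R :> R.
Proof. by rewrite -subn1 natrB. Qed.

Lemma degree_ge (x : X) : d%:R <= degree R (@bdry_rel d n) x.
Proof. by rewrite degree_bdry card_neighbours// ler_nat neighbours_ge. Qed.

Lemma degree_le (x : X) : degree R (@bdry_rel d n) x <= 2 * (d%:R - 1).
Proof.
rewrite degree_bdry card_neighbours// natr_pred -natrM ler_nat.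
exact: neighbours_le.
Qed.

Lemma degree_tbdry (x : X) : val x \in tbdry d n ->
  2 * (d%:R - 1) <= degree R (@bdry_rel d n) x.
Proof.
move=> /(tbdry_sole n_gt0)[k sole].
rewrite degree_bdry card_neighbours// natr_pred -natrM ler_nat.
exact: neighbours_sole sole.
Qed.

(** Points of [tbdry] have degree at least 2(d - 1), the others at least d, and the former make up a
    proportion of at least 1/c0. *)
Lemma sum_degree_ge (c0 : R) : 0 < c0 -> #|` X|%:R <= c0 * #|` tbdry d n|%:R ->
  (d%:R + (d%:R - 2) / c0) * #|{: X}|%:R <= \sum_(x : X) degree R (@bdry_rel d n) x.
Proof.
move=> c00 hc.
have tb : #|` tbdry d n|%:R = \sum_(x : X | val x \in tbdry d n) 1 :> R.
  rewrite card_fset_sum1 natr_sum.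
  apply: (@sum_fset_bij R X _ (fun x => val x \in tbdry d n) (fun x => val x)) => //.
    exact: val_inj.
  move=> k kt; have kX : k \in X by move: kt; rewrite in_fset => /andP[].
  by exists [` kX].
have d2 : 0 <= d%:R - 2 :> R by rewrite subr_ge0 ler_nat.
apply: (@le_trans _ _ (d%:R * #|{: X}|%:R + (d%:R - 2) * #|` tbdry d n|%:R)).
  rewrite mulrDl lerD2l -mulrA; apply: ler_wpM2l => //.
  by rewrite ler_pdivrMl// -cardfE.
rewrite tb mulr_sumr big_mkcond/= -[#|{: X}|]sum1_card natr_sum mulr_sumr -big_split/=.
apply: ler_sum => x _; case: ifP => [xt|_].
  by have := degree_tbdry xt; lra.
by have := degree_ge x; lra.
Qed.

Definition corner (b : bool) : Zd d := const_mx (if b then n%:Z else - n%:Z).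

Lemma corner_bdry b : corner b \in X.
Proof.
apply/(bdryP n d_gt0); split=> [i|]; first by rewrite mxE; case: b; lia.
by exists (Ordinal d_gt0); rewrite mxE; case: b; lia.
Qed.

Definition cornerX b : X := [` corner_bdry b].

Lemma corner_neq : cornerX true != cornerX false.
Proof.
rewrite -(inj_eq val_inj)/=; apply/eqP => /(congr1 (fun v : Zd d => v 0 (Ordinal d_gt0))).
by rewrite !mxE; lia.
Qed.

Lemma corner_far : ~~ bdry_rel (cornerX true) (cornerX false).
Proof.
apply/negP => /adjacentP[i hi hj]; move: hi; rewrite /= !mxE; lia.
Qed.

(** Corners have the fewest neighbours, which keeps the gradient small; the two opposite signs keep
    the function away from every constant. *)
Definition corner_test (x : X) : R :=
  (x == cornerX true)%:R - (x == cornerX false)%:R.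

Lemma norm_corner_test x :
  `|corner_test x| = (x == cornerX true)%:R + (x == cornerX false)%:R.
Proof.
rewrite /corner_test; have [->|_] := eqVneq x (cornerX true).
  by rewrite (negbTE corner_neq) subr0 addr0 normr1.
by rewrite sub0r add0r normrN ger0_norm.
Qed.

Lemma corner_test_grad (s : R) x y : 0 < s -> bdry_rel x y ->
  `|corner_test y - corner_test x| `^ s <= `|corner_test x| + `|corner_test y|.
Proof.
move=> s0 exy; rewrite !norm_corner_test /corner_test.
have sn : s != 0 by rewrite gt_eqF.
have irr (z : X) : ~~ bdry_rel z z.
  by apply/negP => /adjacentP[i hi _]; move: hi; rewrite subrr.
have far b b' : bdry_rel (cornerX b) (cornerX b') = false.
  case: b b' => [] []; try exact: negbTE (irr _); first exact: negbTE corner_far.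
  by rewrite bdry_rel_sym; exact: negbTE corner_far.
have two b b' : (x == cornerX b) && (y == cornerX b') = false.
  by apply/negP => /andP[/eqP ex /eqP ey]; move: exy; rewrite ex ey far.
have := two true true; have := two true false; have := two false true.
have := two false false.
have one (z : X) : (z == cornerX true) && (z == cornerX false) = false.
  by apply/negP => /andP[/eqP -> ]; rewrite (negbTE corner_neq).
have := one x; have := one y.
case: (x == cornerX true); case: (x == cornerX false);
case: (y == cornerX true); case: (y == cornerX false) => //= _ _ _ _ _ _;
  rewrite ?mulr1n ?mulr0n ?subrr ?subr0 ?sub0r ?oppr0 ?normrN ?opprK ?normr0 ?normr1 ?powR1 ?powR0// ?addr0 ?add0r//.
Qed.

Lemma sum_norm_corner_test (g : X -> R) : \sum_x `|corner_test x| * g x =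
  g (cornerX true) + g (cornerX false).
Proof.
have sel a : \sum_x (x == a)%:R * g x = g a.
  rewrite (bigD1 a)//= eqxx mul1r big1 ?addr0// => x xa.
  by rewrite (negbTE xa) mul0r.
under eq_bigr do rewrite norm_corner_test mulrDl.
by rewrite big_split/= !sel.
Qed.

Lemma corner_test_energy (s : R) : 0 < s ->
  \sum_x \sum_(y | @bdry_rel d n x y) `|corner_test y - corner_test x| `^ s
    <= 4 * d%:R.
Proof.
move=> s0.
apply: (@le_trans _ _ (\sum_x \sum_(y | @bdry_rel d n x y) (`|corner_test x| + `|corner_test y|))).
  by apply: ler_sum => x _; apply: ler_sum => y; exact: corner_test_grad.
have one : \sum_x \sum_(y | @bdry_rel d n x y) `|corner_test x| <= 2 * d%:R.
  rewrite (eq_bigr (fun x => `|corner_test x| * degree R (@bdry_rel d n) x)).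
    rewrite sum_norm_corner_test.
    have deg b : degree R (@bdry_rel d n) (cornerX b) <= d%:R.
      rewrite degree_bdry card_neighbours// ler_nat.
      by apply: (neighbours_corner d_gt0 n_gt0) => j; rewrite /= mxE; case: b; lia.
    by have := deg true; have := deg false; lra.
  by move=> x _; rewrite /degree mulr_sumr; apply: eq_bigr => y _; rewrite mulr1.
have two : \sum_x \sum_(y | @bdry_rel d n x y) `|corner_test y| =
           \sum_x \sum_(y | @bdry_rel d n x y) `|corner_test x|.
  rewrite (exchange_big_dep predT)//=; apply: eq_bigr => y _.
  by apply: eq_bigl => x; rewrite bdry_rel_sym.
under eq_bigr do rewrite big_split/=.
by rewrite big_split/= two; lra.
Qed.

Lemma corner_test_dist (P a : R) : 1 <= P ->
  2 <= \sum_(x : X) `|corner_test x - a| `^ P.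
Proof.
move=> P1; have Pn : 0 < P by lra.
rewrite (bigD1 (cornerX true))//= (bigD1 (cornerX false))/=; last first.
  by rewrite eq_sym corner_neq.
rewrite /corner_test !eqxx (negbTE corner_neq) eq_sym (negbTE corner_neq).
set T := \sum_(_ | _) _; have T0 : 0 <= T by apply: sumr_ge0 => *; exact: powR_ge0.
rewrite subr0 sub0r.
have := powR_half_convex P1 (normr_ge0 (1 - a)) (normr_ge0 (- 1 - a)).
suff : 1 <= ((`|1 - a| + `|- 1 - a|) / 2) `^ P by lra.
apply: powR_ge1; last by lra.
rewrite ler_pdivlMr// mul1r; have := ler_normB (1 - a) (- 1 - a).
by rewrite opprB addrA addrNK ger0_norm//; lra.
Qed.
End CornerTest.

Section SobolevConstant.
Variables (R : realType) (d n : nat) (c P al : R).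
Hypothesis d_gt1 : (1 < d)%N.
Hypothesis n_gt0 : (0 < n)%N.
Notation X := (bdry d n).
Notation em := (@emeasure R X (@bdry_rel d n)).
Notation vm := (@vmeasure R X).
Notation md := (mean_degree R (@bdry_rel d n)).
Notation D := (d.-1).
Hypothesis c_gt0 : 0 < c.
Hypothesis P_ge2 : 2 <= P.
Hypothesis al_eq : al^-1 = P^-1 + D%:R^-1.
Hypothesis sobolev : forall (u : X -> R) (L : R),
  (forall a, L <= wnorm vm P (fun x => u x - a)) ->
  L <= c * n%:R * wnorm em al (ediff u).
Let d_gt0 : (0 < d)%N := ltnW d_gt1.

Lemma card_bdry_gt0 : (0 < #|{: X}|)%N.
Proof. by apply/card_gt0P; exists (cornerX d_gt1 n_gt0 true). Qed.

Lemma sum_degree_gt0 : 0 < \sum_(x : X) degree R (@bdry_rel d n) x.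
Proof.
apply: (@lt_le_trans _ _ (\sum_(x : X) d%:R)).
  by rewrite sumr_const -[_ *+ _]mulr_natl -natrM ltr0n muln_gt0 card_bdry_gt0.
by apply: ler_sum => x _; exact: degree_ge.
Qed.

Lemma mean_degree_le : md <= 2 * (d%:R - 1).
Proof.
rewrite /mean_degree ler_pdivrMr ?ltr0n ?card_bdry_gt0//.
apply: (@le_trans _ _ (\sum_(x : X) 2 * (d%:R - 1))).
  by apply: ler_sum => x _; exact: degree_le.
by rewrite sumr_const -[_ *+ _]mulr_natl mulrC.
Qed.

Lemma mean_degree_ge (c0 : R) : 0 < c0 -> #|` X|%:R <= c0 * #|` tbdry d n|%:R ->
  d%:R + (d%:R - 2) / c0 <= md.
Proof.
move=> c00 h; rewrite /mean_degree ler_pdivlMr ?ltr0n ?card_bdry_gt0//.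
exact: sum_degree_ge.
Qed.

(** The Sobolev inequality for [corner_test], with the cardinality bound [card_bdry_ge]; [r] is a
    lower bound for the mean degree relative to 2d. *)
Lemma sobolev_constant (r : R) : 0 < r -> 2 * d%:R * r <= md ->
  (d%:R * r) ^+ 2 * (4 * r) ^+ D <= c ^+ (D * 2).
Proof.
move=> r0 rmd.
set Nn : R := #|{: X}|%:R; set E := \sum_(x : X) degree R (@bdry_rel d n) x.
have N0 : 0 < Nn by rewrite ltr0n card_bdry_gt0.
have E0 : 0 < E := sum_degree_gt0.
have dR : 2 <= d%:R :> R by rewrite ler_nat.
have D0 : (0 < D)%N by lia.
have DR : 0 < D%:R :> R by rewrite ltr0n.
have P1 : 1 <= P by apply: le_trans P_ge2; rewrite ler1n.
have P0 : 0 < P by apply: lt_le_trans P_ge2.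
have iD : 0 < D%:R^-1 :> R by rewrite invr_gt0.
have iP : 0 < P^-1 by rewrite invr_gt0.
have al0 : 0 < al by rewrite -invr_gt0 al_eq addr_gt0.
(* Below, Z = 4 d / E bounds the mean of the power of the gradient of the test function, and Z y = 2
   / N bounds from below that of its distance to constants. *)
pose y := md / (2 * d%:R).
have ry : r <= y by rewrite /y ler_pdivlMr; lra.
have y0 : 0 < y by lra.
have y1 : y <= 1.
  by rewrite /y ler_pdivrMr; last lra; have := mean_degree_le; lra.
pose Z := 2 / (y * Nn).
have Z0 : 0 < Z by rewrite divr_gt0// mulr_gt0.
have step1 : (Z * y) `^ P^-1 <= c * n%:R * (Z `^ P^-1 * Z `^ D%:R^-1).
  rewrite -powRD; last by apply/implyP => _; rewrite gt_eqF.
  rewrite -al_eq.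
  apply: (@le_trans _ _ (c * n%:R * wnorm em al (ediff (corner_test R d_gt1 n_gt0)))).
    apply: sobolev => a; apply: (@ler_powR_root _ _ _ P) => //.
    - exact: powR_ge0.
    - exact: wnorm_ge0.
    rewrite powRVK ?gt_eqF//; last by rewrite mulr_ge0// ltW.
    rewrite vnorm_powR ?gt_eqF//.
    have -> : Z * y = Nn^-1 * 2 by rewrite /Z; field; rewrite !gt_eqF.
    by apply: ler_wpM2l; [rewrite invr_ge0 ltW|apply: corner_test_dist].
  apply: ler_wpM2l; first by rewrite mulr_ge0 ?ler0n ?ltW.
  apply: (@ler_powR_root _ _ _ al) => //.
  - exact: wnorm_ge0.
  - exact: powR_ge0.
  rewrite powRVK ?gt_eqF//; last exact: ltW.
  rewrite (enorm_powR E0) ?gt_eqF//.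
  rewrite mulrC ler_pdivrMr//.
  apply: (le_trans (corner_test_energy d_gt1 n_gt0 al0)).
  rewrite le_eqVlt; apply/orP; left; apply/eqP.
  rewrite /Z /y /mean_degree -/E -/Nn; field.
  by rewrite !gt_eqF//; lra.
have step2 : y `^ P^-1 <= c * n%:R * Z `^ D%:R^-1.
  move: step1; rewrite powRM ?(ltW Z0) ?(ltW y0)// mulrCA ler_pM2l//.
  exact: powR_gt0.
(* As y <= 1 and P >= 2, the exponent 1/P may be raised to 1/2, which eliminates P. *)
have step3 : y `^ 2^-1 <= c * n%:R * Z `^ D%:R^-1.
  apply: le_trans step2; apply: ger_powR; first by rewrite y0.
  by rewrite lef_pV2// posrE.
have step4 : y ^+ D <= (c * n%:R) ^+ (D * 2) * Z ^+ 2.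
  have -> : Z ^+ 2 = (Z `^ D%:R^-1) ^+ (D * 2).
    by rewrite exprM -[(_ `^ _) ^+ D]powR_mulrn ?powR_ge0// powRVK ?gt_eqF// ltW.
  have -> : y ^+ D = (y `^ 2^-1) ^+ (D * 2).
    rewrite mulnC exprM -[(_ `^ _) ^+ 2]powR_mulrn ?powR_ge0// powRVK ?gt_eqF// ltW//.
  rewrite -exprMn lerXn2r ?nnegrE ?powR_ge0// mulr_ge0 ?powR_ge0// mulr_ge0 ?ler0n//.
  exact: ltW.
pose q : R := n%:R ^+ D.
have q0 : 0 < q by rewrite exprn_gt0 ?ltr0n.
have Nq : 2 * d%:R * (2 ^+ D * q) <= Nn.
  have := card_bdry_ge d_gt0 n_gt0; rewrite -(ler_nat R) cardfE.
  by rewrite !natrM natrX -mul2n natrM exprMn.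
have step5 : y ^+ D * y ^+ 2 * (Nn ^+ 2) <= c ^+ (D * 2) * q ^+ 2 * 4.
  rewrite -ler_pdivlMr ?exprn_gt0// -ler_pdivlMr ?exprn_gt0//.
  apply: (le_trans step4); rewrite le_eqVlt; apply/orP; left; apply/eqP.
  rewrite /Z /q exprMn [n%:R ^+ (D * 2)]exprM; field.
  by rewrite !gt_eqF.
have step6 : y ^+ D * y ^+ 2 * (d%:R ^+ 2 * 4 ^+ D) <= c ^+ (D * 2).
  rewrite -(ler_pM2r (_ : 0 < q ^+ 2 * 4)); last by rewrite mulr_gt0// exprn_gt0.
  rewrite [leRHS]mulrA; apply: le_trans step5; rewrite -[leLHS]mulrA.
  apply: ler_wpM2l; first by rewrite mulr_ge0 ?exprn_ge0// ltW.
  apply: (@le_trans _ _ ((2 * d%:R * (2 ^+ D * q)) ^+ 2)); last first.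
    by rewrite lerXn2r ?nnegrE// ?(ltW N0)// !mulr_ge0 ?exprn_ge0// ltW.
  have -> : 4 ^+ D = 2 ^+ D ^+ 2 :> R by rewrite -exprM mulnC exprM; congr (_ ^+ D); ring.
  by rewrite le_eqVlt; apply/orP; left; apply/eqP; ring.
apply: le_trans step6.
have -> : (d%:R * r) ^+ 2 * (4 * r) ^+ D = r ^+ D * r ^+ 2 * (d%:R ^+ 2 * 4 ^+ D).
  by rewrite !exprMn; ring.
apply: ler_wpM2r; first by rewrite mulr_ge0 ?exprn_ge0.
by apply: ler_pM; rewrite ?exprn_ge0 ?lerXn2r ?nnegrE// ltW.
Qed.

Lemma sobolev_constant_lt (c0 r : R) : 0 < c0 -> c < c0 ->
  #|` X|%:R <= c * #|` tbdry d n|%:R -> 0 < r ->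
  2 * d%:R * r <= d%:R + (d%:R - 2) / c0 ->
  (d%:R * r) ^+ 2 * (4 * r) ^+ D < c0 ^+ (D * 2).
Proof.
move=> c00 cc0 hc r0 hr.
apply: (@le_lt_trans _ _ (c ^+ (D * 2))).
  apply: sobolev_constant => //; apply: (le_trans hr); apply: mean_degree_ge => //.
  by apply: (le_trans hc); rewrite ler_wpM2r// ltW.
rewrite ltrXn2r ?(ltW c_gt0)// ?(ltW c00)// muln_eq0; lia.
Qed.

Lemma sobolev_constant_ge2 : (2 < d < 9)%N ->
  #|` X|%:R <= c * #|` tbdry d n|%:R -> 2 <= c.
Proof.
move=> /andP[d2 d9] hc; rewrite leNgt; apply/negP => c2.
have lt (r : R) : 0 < r -> 2 * d%:R * r <= d%:R + (d%:R - 2) / 2 ->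
    (d%:R * r) ^+ 2 * (4 * r) ^+ D < 2 ^+ (D * 2).
  by apply: sobolev_constant_lt.
have cases : d \in [:: 3; 4; 5; 6; 7; 8]%N by rewrite !inE; lia.
move: cases lt; rewrite !inE => /orP[|/orP[|/orP[|/orP[|/orP[]]]]] /eqP -> /=.
(* In each case [r] is (d + (d - 2)/2) / (2 d), the largest value that [lt] admits. *)
- by move=> /(_ (7 / 12)) h; have := h; rewrite !exprS !expr0; lra.
- by move=> /(_ (5 / 8)) h; have := h; rewrite !exprS !expr0; lra.
- by move=> /(_ (13 / 20)) h; have := h; rewrite !exprS !expr0; lra.
- by move=> /(_ (2 / 3)) h; have := h; rewrite !exprS !expr0; lra.
- by move=> /(_ (19 / 28)) h; have := h; rewrite !exprS !expr0; lra.
- by move=> /(_ (11 / 16)) h; have := h; rewrite !exprS !expr0; lra.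
Qed.

Lemma sobolev_constant_ge17 : (8 < d)%N ->
  #|` X|%:R <= c * #|` tbdry d n|%:R -> 17 / 10 <= c.
Proof.
move=> d8 hc; rewrite leNgt; apply/negP => c2.
have dR : 9 <= d%:R :> R by rewrite ler_nat.
have : (d%:R * (29 / 40)) ^+ 2 * (4 * (29 / 40)) ^+ D < (17 / 10) ^+ (D * 2) :> R.
  (* The value 29/40 is admissible for all d >= 9, and 4 r = 2.9 exceeds 1.7^2 = 2.89. *)
  apply: (@sobolev_constant_lt (17 / 10) (29 / 40)) => //; lra.
apply/negP; rewrite -leNgt.
rewrite mulnC exprM -[leLHS]mul1r.
apply: ler_pM; rewrite ?exprn_ge0//; last by rewrite lerXn2r ?nnegrE//; lra.
  by rewrite expr2; nra.
Qed.
End SobolevConstant.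

Lemma powR_scaled_le (R : realType) (C eps x b z A B : R) :
  0 < C -> 0 < eps -> 0 <= x <= 1 -> 0 <= b -> 0 <= z ->
  0 <= A -> A <= C * (eps * b) -> 0 <= B -> B <= C * z ->
  A `^ (1 - x) * B `^ x <= C * eps `^ (1 - x) * (b `^ (1 - x) * z `^ x).
Proof.
move=> C0 e0 /andP[x0 x1] b0 z0 A0 Ab B0 Bz.
apply: (@le_trans _ _ ((C * (eps * b)) `^ (1 - x) * (C * z) `^ x)).
  by apply: ler_pM; rewrite ?powR_ge0//; apply: powR_leq => //; lra.
rewrite (powRM _ (ltW C0) (mulr_ge0 (ltW e0) b0)) (powRM _ (ltW e0) b0).
rewrite (powRM _ (ltW C0) z0).
have CC : C = C `^ (1 - x) * C `^ x.
  by rewrite -powRD ?subrK ?powRr1 ?oner_eq0// ltW.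
by rewrite {3}CC le_eqVlt; apply/orP; left; apply/eqP; ring.
Qed.

(** * The smoothing estimate with explicit constants *)

Section Smoothing.
Variables (R : realType) (V : finType) (e : rel V).
Hypothesis e_sym : symmetric e.
Hypothesis V_gt0 : (0 < #|V|)%N.
Hypothesis E_gt0 : 0 < \sum_x degree R e x.
Variable tr : V -> V -> V -> option V.
Hypothesis tr_coupling : coupling R e tr.
Notation vm := (@vmeasure R V).
Notation em := (@emeasure R V e).
Notation md := (mean_degree R e).
Variables (D : nat) (M C eps k i j : R).
Hypothesis D_gt1 : (1 < D)%N.
Hypothesis deg_le : forall x, degree R e x <= 2 * D%:R.
Hypothesis md_le : md `^ D%:R^-1 <= M.
Hypothesis rho_le : (2 * D%:R / md) `^ D%:R^-1 <= 7 / 6.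
Hypothesis C_gt0 : 0 < C.
Hypothesis eps01 : 0 < eps <= 1.
Hypothesis k01 : 0 < k <= 1.
Hypothesis i_ge0 : 0 <= i.
Hypothesis j_ge0 : 0 <= j.
Hypothesis i_lt1 : i < 1.
Hypothesis j_lt1 : j < 1.

(** Here [r] stands for 1/p or 1/q. The infimum over constants is encoded by its lower bounds
    [L]. *)
Definition sobolev_inequality (r : R) := forall (u : V -> R) (L : R),
  (forall a, L <= wnorm vm (2 / (1 - r)) (fun x => u x - a)) ->
  L <= C * wnorm em ((1 - r) / 2 + D%:R^-1)^-1 (ediff u).

Let u0 : R := D%:R^-1.
Let D_gt0 : (0 < D)%N := ltnW D_gt1.
Let DR_gt0 : 0 < D%:R :> R. Proof. by rewrite ltr0n. Qed.
Let u0_gt0 : 0 < u0. Proof. by rewrite invr_gt0. Qed.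
Let u0_le : u0 <= 1 / 2.
Proof. by rewrite ler_pdivlMr// /u0 mulrC ler_pdivrMr// mul1r ler_nat. Qed.
Let Du0 : D%:R * u0 = 1 :> R.
Proof. by rewrite /u0 divff// gt_eqF. Qed.

(** Bounds, up to the factor [C], the Gagliardo-Nirenberg constant in [energy_le]: removal of the
    mean, the power g = 1 - r + 2/D, and the degree ratio to the power (g - 1)/2. *)
Definition energy_factor (r : R) : R :=
  k^-1 `^ ((1 + r) / 2) * (1 - r + 2 * u0) * (1 + (1 - D%:R * r / 2) / 6).

(* The step of the resolvent; the factor 9/8 is a near-optimal choice. *)
Definition smoothing_step : R := (9 / 8 * C * eps) ^+ 2 / md.

Let md_pos : 0 < md. Proof. exact: md_gt0. Qed.
Let k_pos : 0 < k. Proof. by case/andP: k01. Qed.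
Let e_pos : 0 < eps. Proof. by case/andP: eps01. Qed.

Lemma smoothing_step_gt0 : 0 < smoothing_step.
Proof. by rewrite divr_gt0// exprn_gt0// !mulr_gt0//; lra. Qed.

Let M_ge0 : 0 <= M. Proof. by apply: le_trans md_le; exact: powR_ge0. Qed.

Lemma rho_pow_le t : 0 <= t <= 1 -> (2 * D%:R / md) `^ (u0 * t) <= 1 + t / 6.
Proof.
move=> t01; rewrite powRrM.
apply: le_trans (_ : (7 / 6) `^ t <= _).
  by apply: powR_leq; [case/andP: t01|exact: powR_ge0|].
have -> : 7 / 6 = 1 + 1 / 6 :> R by lra.
by apply: le_trans (bernoulli_le _ _) _ => //; lra.
Qed.

(** [energy_le] at [smoothing_step], for which tau md / 2 is free of the degrees. As eps <= 1, the
    summand 1 is absorbed into a multiple of eps^(-2). *)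
Lemma energy_bound nu r Y (f : V -> R) : 0 <= r < 1 -> r <= 2 * u0 ->
  sobolev_inequality r -> 0 <= nu -> centering k nu (2 / (1 + r)) ->
  0 <= Y -> 1 + 2 * (energy_factor r / (9 / 8)) ^+ 2 <= Y ^+ 2 ->
  Num.sqrt (energy e smoothing_step f)
    <= (Y / eps) `^ (D%:R * r / 2) * wnorm vm (2 / (1 + r)) f.
Proof.
move=> /andP[r0 r1] ru sob nu0 cent Y0 hY.
have [ul up] := (u0_le, u0_gt0).
set x := D%:R * r / 2.
have ux : u0 * x = r / 2 by rewrite /x mulrA mulrA [u0 * _]mulrC Du0 mul1r.
have x0 : 0 <= x by rewrite /x !mulr_ge0.
have x1 : x <= 1 by rewrite -(ler_pM2l up) ux; lra.
pose al := ((1 - r) / 2 + u0)^-1; pose g := 1 - r + 2 * u0.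
have al0 : 0 < al by rewrite invr_gt0; lra.
have Q1 : 1 < 2 / (1 - r) by rewrite ltr_pdivlMr; lra.
have P1 : 1 < 2 / (1 + r) by rewrite ltr_pdivlMr; lra.
have PQ : (2 / (1 - r))^-1 + (2 / (1 + r))^-1 = 1.
  by rewrite !invf_div; lra.
pose kap := k^-1 `^ ((1 + r) / 2).
have kap0 : 0 < kap by apply: powR_gt0; rewrite invr_gt0.
have mean (h : V -> R) a : wnorm vm (2 / (1 - r)) (fun x => h x - wsum vm h)
    <= kap * wnorm vm (2 / (1 - r)) (fun x => h x - a).
  have := wnorm_sub_mean_dual (@vmeasure_ge0 R V) h a Q1 P1 PQ k01 nu0 cent
    (vmeasure_sum1 R V_gt0).
  by rewrite invf_div.
have g12 : 1 <= g <= 2 by rewrite /g; lra.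
have gal : g * al = 2.
  have -> : al = 2 / g by rewrite -[RHS]invf_div; congr (_^-1); rewrite /g; lra.
  by rewrite mulrCA divff ?mulr1// gt_eqF//; lra.
have gx : (1 - g * x) / 2 = (1 - x) / (2 / (1 - r)).
  have -> : g * x = (1 - r) * x + 2 * (u0 * x) by rewrite /g; ring.
  by rewrite ux invf_div; field.
have s0 : 0 < 2 / (1 + r) by lra.
apply: le_trans (energy_le e_sym V_gt0 E_gt0 f Q1 al0 (ltW C_gt0) kap0 sob deg_le
  mean g12 gal _ gx s0 PQ smoothing_step_gt0) _; first by rewrite x0.
apply: ler_wpM2r; first exact: wnorm_ge0.
set B := kap * C * _.
have B0 : 0 <= B by rewrite !mulr_ge0 ?powR_ge0 ?ltW//; case/andP: g12; lra.
have BC : B <= C * energy_factor r.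
  rewrite /B /energy_factor -/kap -/g.
  have -> : C * (kap * g * (1 + (1 - x) / 6)) = kap * C * (g * (1 + (1 - x) / 6)) by ring.
  apply: ler_wpM2l; first by rewrite mulr_ge0// ltW.
  apply: ler_wpM2l; first by case/andP: g12; lra.
  have -> : (g - 1) / 2 = u0 * (1 - x) by rewrite mulrBr ux /g; lra.
  by apply: rho_pow_le; lra.
have t2 : smoothing_step * md / 2 = (9 / 8 * C * eps) ^+ 2 / 2.
  by rewrite /smoothing_step divfK// gt_eqF.
have t20 : 0 < (9 / 8 * C * eps) ^+ 2 / 2.
  by rewrite divr_gt0// exprn_gt0// !mulr_gt0//; lra.
rewrite t2.
have key : 1 + B ^+ 2 / ((9 / 8 * C * eps) ^+ 2 / 2) <= (Y / eps) ^+ 2.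
  apply: (@le_trans _ _ (1 + 2 * (energy_factor r / (9 / 8)) ^+ 2 / eps ^+ 2)).
    rewrite lerD2l ler_pdivrMr//.
    have -> : 2 * (energy_factor r / (9 / 8)) ^+ 2 / eps ^+ 2 * ((9 / 8 * C * eps) ^+ 2 / 2)
      = (C * energy_factor r) ^+ 2.
      by field; rewrite gt_eqF.
    by rewrite lerXn2r ?nnegrE// (le_trans B0).
  rewrite [leRHS]expr_div_n ler_pdivlMr ?exprn_gt0// mulrDl divfK ?gt_eqF ?exprn_gt0// mul1r.
  apply: le_trans hY; rewrite lerD2r expr_le1 ?(ltW e_pos)//.
  by case/andP: eps01.
apply: le_trans (_ : ((Y / eps) ^+ 2) `^ (x / 2) <= _).
  apply: powR_leq => //; first by lra.
  by rewrite addr_ge0// divr_ge0 ?sqr_ge0// ltW.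
rewrite -powR_mulrn; last by rewrite divr_ge0// ltW.
by rewrite -powRrM mulrCA divff ?mulr1//.
Qed.

(** On the regular part the resolvent loses (Y/eps)^x, by [energy_bound] at [i] and at [j] since D
    i/2 + D j/2 = x, against the factor C eps of [Phi]. On the remainder, [pseudo_poincare] gives C
    eps to the power 1 - x, because sqrt tau is of order C eps. Both parts are thus of order C
    eps^(1-x). *)
Lemma smoothing_estimate nu nu' c2 Y (Phi : (V -> R) -> R) (u : V -> R) :
  let x := D%:R * (i + j) / 2 in
  i + j <= 2 * u0 ->
  sobolev_inequality i -> sobolev_inequality j ->
  0 <= nu -> centering k nu (2 / (1 + j)) ->
  0 <= nu' -> centering k nu' (2 / (1 + i)) ->
  0 <= Y -> 1 + 2 * (energy_factor i / (9 / 8)) ^+ 2 <= Y ^+ 2 ->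
  1 + 2 * (energy_factor j / (9 / 8)) ^+ 2 <= Y ^+ 2 ->
  0 <= c2 ->
  (forall f h, Phi (fun x => f x + h x) <= Phi f + Phi h) ->
  (forall f a, Phi (fun x => f x - a) = Phi f) ->
  (forall f, Phi f <= C * eps * wnorm em (2 / (1 - i)) (ediff f)) ->
  (forall f, Phi f <= c2 * wnorm vm (2 / (1 - i)) f) ->
  Phi u <= C * eps `^ (1 - x) *
    ((M * Y) `^ x + c2 * ((19 / 8 * M `^ (D%:R * j / 2)) `^ (1 - x) *
       (k^-1 `^ ((1 + i) / 2) * k^-1 `^ ((1 + j) / 2) *
        (1 + 2 * u0 * (1 - x)) * (1 + (1 - x) / 6)) `^ x))
   * wnorm em (2 / (1 + j)) (ediff u).
Proof.
move=> x ij sobi sobj nu0 cent nu'0 cent' Y0 hYi hYj c20 PhiD Phisub Phi1 Phi2.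
have [ul up] := (u0_le, u0_gt0).
have ux : u0 * x = (i + j) / 2 by rewrite /x mulrA mulrA [u0 * _]mulrC Du0 mul1r.
have x0 : 0 <= x by rewrite /x !mulr_ge0 ?addr_ge0.
have x1 : x <= 1 by rewrite -(ler_pM2l up) ux; lra.
have [i0 i1] := (i_ge0, i_lt1); have [j0 j1] := (j_ge0, j_lt1).
have [mdp kp] := (md_pos, k_pos); have [ep C0] := (e_pos, C_gt0).
pose al := ((1 - i) / 2 + u0)^-1; pose g := (1 - i + 2 * u0) / (1 + j).
have al0 : 0 < al by rewrite invr_gt0; lra.
have P2 : 2 <= 2 / (1 - i) by rewrite ler_pdivlMr; lra.
have Q1 : 1 < 2 / (1 - i) by lra.
have P1 : 1 < 2 / (1 + i) by rewrite ltr_pdivlMr; lra.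
have P'0 : 0 < 2 / (1 + i) by lra.
have PQ : (2 / (1 - i))^-1 + (2 / (1 + i))^-1 = 1 by rewrite !invf_div; lra.
have s12 : 1 < 2 / (1 + j) <= 2.
  by rewrite ltr_pdivlMr ?ler_pdivrMr; lra.
have g1s : 1 <= g <= 2 / (1 + j).
  rewrite /g ler_pdivlMr ?ler_pM2r ?invr_gt0; lra.
have al_eq : al = 2 / (1 - i + 2 * u0).
  by rewrite -[RHS]invf_div; congr (_^-1); lra.
have gal : g * al = 2 / (1 + j).
  by rewrite al_eq /g; field; apply/andP; split; rewrite gt_eqF//; lra.
have gj : g * (1 + j) = 1 - i + 2 * u0 by rewrite /g divfK// gt_eqF//; lra.
have gx : (1 - g * x) / (2 / (1 + j)) = (1 - x) / (2 / (1 - i)).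
  have -> : (1 - g * x) / (2 / (1 + j)) = ((1 + j) - g * (1 + j) * x) / 2.
    by rewrite invf_div; field.
  have -> : 1 + j - g * (1 + j) * x = 1 + j - (1 - i) * x - 2 * (u0 * x).
    by rewrite gj; ring.
  by rewrite ux invf_div; field.
have gE : (g - 1) / (2 / (1 + j)) = u0 * (1 - x).
  have -> : (g - 1) / (2 / (1 + j)) = (g * (1 + j) - (1 + j)) / 2.
    by rewrite invf_div; field.
  by rewrite gj mulrBr ux; lra.
have g0 : 0 <= g by case/andP: g1s; lra.
have gle : g <= 1 + 2 * u0 * (1 - x).
  have w0 : 0 <= 2 * u0 * (1 - x) by rewrite !mulr_ge0//; lra.
  have w1 : 2 * u0 * (1 - x) = 2 * u0 - (i + j).
    by rewrite -mulrA mulrBr ux; lra.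
  rewrite /g ler_pdivrMr; last by lra.
  rewrite mulrDr mulr1; have := mulr_ge0 w0 j0; lra.
pose kap := k^-1 `^ ((1 + i) / 2).
have kap0 : 0 < kap by apply: powR_gt0; rewrite invr_gt0.
have mean (h : V -> R) a : wnorm vm (2 / (1 - i)) (fun x => h x - wsum vm h)
    <= kap * wnorm vm (2 / (1 - i)) (fun x => h x - a).
  have := wnorm_sub_mean_dual (@vmeasure_ge0 R V) h a Q1 P1 PQ k01 nu'0 cent'
    (vmeasure_sum1 R V_gt0).
  by rewrite invf_div.
have iu : i <= 2 * u0 by lra.
have ju : j <= 2 * u0 by lra.
have ib : 0 <= i < 1 by rewrite i0.
have jb : 0 <= j < 1 by rewrite j0.
have K2 (f : V -> R) := energy_bound f ib iu sobi nu'0 cent' Y0 hYi.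
have K1 (f : V -> R) := energy_bound f jb ju sobj nu0 cent Y0 hYj.
have x01 : 0 <= x <= 1 by rewrite x0.
apply: le_trans (interpolation_resolvent e_sym V_gt0 E_gt0 tr_coupling u P2 P'0 PQ
  al0 (ltW C0) kap0 sobi deg_le mean s12 g1s gal x01 gx k01 nu0 cent
  smoothing_step_gt0 (powR_ge0 _ _) (powR_ge0 _ _) K1 K2
  (ltW (mulr_gt0 C0 ep)) c20 PhiD Phisub Phi1 Phi2) _.
apply: ler_wpM2r; first exact: wnorm_ge0.
rewrite mulrDr; apply: lerD.
  have Yp : 0 < Y.
    rewrite lt_neqAle Y0 andbT; apply/eqP => Y00; move: hYi.
    by rewrite -Y00 expr0n/=; have := sqr_ge0 (energy_factor i / (9 / 8)); lra.
  rewrite -powRD; last by apply/implyP => _; rewrite gt_eqF// divr_gt0.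
  have -> : D%:R * j / 2 + D%:R * i / 2 = x by rewrite /x; field.
  have -> : (2 / (1 + j))^-1 - (2 / (1 - i))^-1 = u0 * x by rewrite ux !invf_div; field.
  have ie0 : 0 <= eps^-1 by rewrite invr_ge0 ltW.
  rewrite powRrM (powRM _ Y0 ie0) (powRV _ (ltW ep)).
  have -> : C * eps `^ (1 - x) * (M * Y) `^ x =
      C * eps * (M `^ x * (Y `^ x * (eps `^ x)^-1)).
    rewrite (powRM _ M_ge0 Y0).
    have -> : eps `^ (1 - x) = eps / eps `^ x.
      by rewrite powRB ?powRr1 ?(ltW ep) ?(gt_eqF ep) ?implybT.
    by ring.
  apply: ler_wpM2l; first by rewrite mulr_ge0// ltW.
  apply: ler_wpM2r; first by rewrite mulr_ge0 ?invr_ge0 ?powR_ge0.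
  by apply: powR_leq => //; exact: powR_ge0.
rewrite [leRHS]mulrCA; apply: ler_wpM2l => //.
pose Z := kap * k^-1 `^ ((1 + j) / 2) * (1 + 2 * u0 * (1 - x)) * (1 + (1 - x) / 6).
rewrite -/kap -/Z.
have T2 : kap * C * (g * (2 * D%:R / md) `^ ((g - 1) / (2 / (1 + j)))) *
    k^-1 `^ (2 / (1 + j))^-1 <= C * Z.
  rewrite gE [(2 / (1 + j))^-1]invf_div.
  have E := @rho_pow_le (1 - x).
  have -> : C * Z = kap * C * ((1 + 2 * u0 * (1 - x)) * (1 + (1 - x) / 6)) *
    k^-1 `^ ((1 + j) / 2) by rewrite /Z; ring.
  apply: ler_wpM2r; first exact: powR_ge0.
  apply: ler_wpM2l; first by rewrite mulr_ge0// ltW.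
  by apply: ler_pM => //; [exact: powR_ge0|apply: E; lra].
(* The root of the step is 9/8 C eps / sqrt md. The product of 19/9 and 9/8 is 19/8, and md^(j/2)
   remains. *)
have T1 : 19 / 9 * Num.sqrt smoothing_step * md `^ (2 / (1 + j))^-1
    <= C * (eps * (19 / 8 * M `^ (D%:R * j / 2))).
  have -> : Num.sqrt smoothing_step = 9 / 8 * C * eps / md `^ 2^-1.
    rewrite /smoothing_step -[LHS]powR12_sqrt; last by rewrite divr_ge0 ?sqr_ge0// ltW.
    rewrite powRM ?sqr_ge0 ?invr_ge0 ?(ltW mdp)// powRV ?(ltW mdp)//; congr (_ / _).
    by rewrite -powR_mulrn ?powRK// !mulr_ge0// ltW//; lra.
  have -> : 19 / 9 * (9 / 8 * C * eps / md `^ 2^-1) * md `^ (2 / (1 + j))^-1 =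
      C * (eps * (19 / 8 * (md `^ (2 / (1 + j))^-1 / md `^ 2^-1))).
    by move: (md `^ _) (md `^ _)^-1 => a b; field.
  have c0 : 0 < 19 / 8 :> R by rewrite divr_gt0.
  rewrite (ler_pM2l C0) (ler_pM2l ep) (ler_pM2l c0).
  rewrite -powRB ?(gt_eqF mdp) ?implybT//.
  have -> : (2 / (1 + j))^-1 - 2^-1 = u0 * (D%:R * j / 2).
    by rewrite [(2 / (1 + j))^-1]invf_div !mulrA [u0 * _]mulrC Du0; field.
  rewrite powRrM; apply: powR_leq => //; last exact: powR_ge0.
  by rewrite !mulr_ge0.
have L0 : 0 <= 19 / 9 * Num.sqrt smoothing_step * md `^ (2 / (1 + j))^-1.
  by rewrite !mulr_ge0 ?sqrtr_ge0 ?powR_ge0//; lra.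
have R0 : 0 <= kap * C * (g * (2 * D%:R / md) `^ ((g - 1) / (2 / (1 + j)))) *
    k^-1 `^ (2 / (1 + j))^-1.
  have kC := mulr_ge0 (ltW kap0) (ltW C0).
  exact: mulr_ge0 (mulr_ge0 kC (mulr_ge0 g0 (powR_ge0 _ _))) (powR_ge0 _ _).
have B0 : 0 <= 19 / 8 * M `^ (D%:R * j / 2) by rewrite mulr_ge0 ?powR_ge0//; lra.
have Z0 : 0 <= Z.
  have z1 : 0 <= 1 + 2 * u0 * (1 - x) := le_trans g0 gle.
  have z2 : 0 <= 1 + (1 - x) / 6 by lra.
  exact: mulr_ge0 (mulr_ge0 (mulr_ge0 (powR_ge0 _ _) (powR_ge0 _ _)) z1) z2.
exact: powR_scaled_le C0 ep x01 B0 Z0 L0 T1 R0 T2.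
Qed.
End Smoothing.


(** * Numerical constants *)

Section SmoothingNumerics.
Variable R : realType.
Implicit Types (M Y c x u z i j : R).

(** Young and Bernoulli replace the powers involving [x] and [t] by polynomials, which are within
    reach of arithmetic tactics. *)
Lemma interpolated_le M t x z : 1 <= M -> 0 <= t <= 1 -> 0 <= x <= 1 -> 0 <= z ->
  (19 / 8 * M `^ t) `^ (1 - x) * z `^ x
    <= (1 - x) * (19 / 8 * (1 + t * (M - 1))) + x * z.
Proof.
move=> M1 t01 x01 z0; have /andP[x0 x1] := x01.
have M0 : 0 <= 19 / 8 * M `^ t by rewrite mulr_ge0 ?powR_ge0//; lra.
have := powR_young z0 M0 x01; rewrite mulrC => /le_trans; apply.
rewrite addrC lerD2r; apply: ler_wpM2l; first by lra.
apply: ler_wpM2l; first by lra.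
have := @bernoulli_le _ t (M - 1) t01; rewrite addrCA subrr addr0; apply; lra.
Qed.

Lemma crude_total M Y u c x t z K : 1 <= M -> 1 <= Y -> 0 <= t <= x -> 0 <= x <= 1 ->
  0 <= u -> 0 <= z <= 4 -> 0 <= c ->
  (1 - x) * (19 / 8 * (1 + x * (M - 1))) + x * (4 * (1 + 2 * u * (1 - x)) * (1 + (1 - x) / 6)) <= K ->
  (M * Y) `^ x + (1 + c) * ((19 / 8 * M `^ t) `^ (1 - x) *
    (z * (1 + 2 * u * (1 - x)) * (1 + (1 - x) / 6)) `^ x) <= M * Y + (1 + c) * K.
Proof.
move=> M1 Y1 /andP[t0 tx] /andP[x0 x1] u0 /andP[z0 z4] c0 hK.
have MY : 1 <= M * Y by nra.
apply: lerD.
  by rewrite -[leRHS]powRr1; [apply: ler_powR|lra].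
apply: ler_wpM2l; first by lra.
have w0 : 0 <= 1 + 2 * u * (1 - x).
  have : 0 <= 2 * u * (1 - x) by rewrite !mulr_ge0//; lra.
  by lra.
have v0 : 0 <= 1 + (1 - x) / 6 by lra.
have t01 : 0 <= t <= 1 by lra.
have x01 : 0 <= x <= 1 by lra.
apply: le_trans (interpolated_le M1 t01 x01 _) _; first by rewrite !mulr_ge0.
apply: le_trans hK; apply: lerD.
  apply: ler_wpM2l; first by lra.
  apply: ler_wpM2l; first by lra.
  by rewrite lerD2l; apply: ler_wpM2r => //; lra.
apply: ler_wpM2l => //; apply: ler_wpM2r => //; exact: ler_wpM2r.
Qed.

Lemma kappa_half_le i : 0 <= i < 1 -> (2^-1)^-1 `^ ((1 + i) / 2) <= 2 :> R.
Proof.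
move=> i01; rewrite invrK -[leRHS](@powRr1 _ 2)//.
by apply: ler_powR; lra.
Qed.

Lemma sqrt_ten_sevenths_le : (10 / 7) `^ 2^-1 <= 6 / 5 :> R.
Proof.
have t0 : 0 <= 10 / 7 :> R by lra.
apply: (@ler_powR_root _ _ _ 2); rewrite ?powR_ge0//; try lra.
by rewrite (powRVK _ t0) ?pnatr_eq0// powR_mulrn; lra.
Qed.

Lemma kappa_seven_tenths_le i : 0 <= i <= 1 ->
  (7 / 10)^-1 `^ ((1 + i) / 2) <= 6 / 5 * (1 + 3 / 14 * i) :> R.
Proof.
move=> i01; rewrite invf_div.
have -> : (1 + i) / 2 = 2^-1 + i / 2 by field.
rewrite powRD; last by apply/implyP => _; rewrite gt_eqF//; lra.
apply: ler_pM; rewrite ?powR_ge0//; first exact: sqrt_ten_sevenths_le.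
have -> : 10 / 7 = 1 + 3 / 7 :> R by lra.
have i2 : 0 <= i / 2 <= 1 by lra.
have := @bernoulli_le _ (i / 2) (3 / 7) i2; lra.
Qed.

(** The power c^(-i) is a gain left over when norms on [tbdry] are compared with norms on the whole
    boundary; it offsets the growth in [i] of the factor for removing a mean. *)
Lemma kappa_conductance_le c i : 0 < c -> 0 <= i <= 1 ->
  (7 / 10)^-1 `^ ((1 + i) / 2) * c `^ (- i) <= 6 / 5 * (6 / 5 / c) `^ i.
Proof.
move=> c0 i01; rewrite invf_div.
have -> : (1 + i) / 2 = 2^-1 + 2^-1 * i by field.
have ic0 : 0 <= c^-1 by rewrite invr_ge0 ltW.
rewrite powRD; last by apply/implyP => _; rewrite gt_eqF//; lra.
rewrite powRrM -mulrA powRN -(powRV _ (ltW c0)) -(powRM _ (powR_ge0 _ _) ic0).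
have sq := sqrt_ten_sevenths_le.
apply: ler_pM; rewrite ?powR_ge0//; apply: powR_leq; first by case/andP: i01.
  by rewrite mulr_ge0// powR_ge0.
exact: ler_wpM2r.
Qed.

Lemma kappa_conductance_le65 c i : 6 / 5 <= c -> 0 <= i <= 1 ->
  (7 / 10)^-1 `^ ((1 + i) / 2) * c `^ (- i) <= 6 / 5.
Proof.
move=> c17 i01; have c0 : 0 < c by lra.
apply: le_trans (kappa_conductance_le c0 i01) _.
rewrite -[leRHS]mulr1; apply: ler_wpM2l; first by lra.
apply: powR_le1; last by lra.
by rewrite divr_ge0 ?ler_pdivrMr ?(ltW c0)//; lra.
Qed.

Lemma kappa_conductance_le2 c x : 2 <= c -> 0 <= x <= 1 ->
  (7 / 10)^-1 `^ ((1 + x / 2) / 2) * c `^ (- (x / 2)) <= 6 / 5 * (1 - x / 5).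
Proof.
move=> c2 x01; have c0 : 0 < c by lra.
have i01 : 0 <= x / 2 <= 1 by lra.
apply: le_trans (kappa_conductance_le c0 i01) _.
apply: ler_wpM2l; first by lra.
have q0 : 0 <= 6 / 5 / c by rewrite divr_ge0 ?(ltW c0)//; lra.
have s45 : (6 / 5 / c) `^ 2^-1 <= 4 / 5.
  apply: (@ler_powR_root _ _ _ 2); rewrite ?powR_ge0//; try lra.
  rewrite (powRVK _ q0) ?pnatr_eq0// powR_mulrn; last by lra.
  by rewrite ler_pdivrMr//; lra.
have -> : x / 2 = 2^-1 * x by rewrite mulrC.
rewrite powRrM; apply: le_trans (powR_leq _ (powR_ge0 _ _) s45) _; first by lra.
have -> : 4 / 5 = 1 + - (1 / 5) :> R by lra.
have := @bernoulli_le _ x (- (1 / 5)) x01; lra.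
Qed.

(** Divided by [c], the left side is nonincreasing in [c]. *)
Lemma total_affine F c c0 t1 t2 K : c0 <= c -> 0 <= F -> 0 <= t1 -> 0 <= t2 -> 0 <= c0 ->
  0 < c0 -> F * (t1 + (1 + c0) * t2) <= K * c0 -> F * (t1 + (1 + c) * t2) <= K * c.
Proof.
move=> cc F0 t10 t20 _ c00 h.
have Ft1 : 0 <= F * (t1 + t2) by rewrite mulr_ge0// addr_ge0.
have : F * t2 <= K.
  by rewrite -(ler_pM2r c00); apply: le_trans h; lra.
nra.
Qed.

(** Once the powers are linearised, with a rational [sM] above the root of [M], only a polynomial
    inequality at c = c0 is left. *)
Lemma fine_total f F M sM Y c c0 x z Z K : 1 <= M -> 1 <= sM -> M <= sM ^+ 2 -> 1 <= Y ->
  0 <= x <= 1 -> 0 <= z -> z <= Z -> 0 <= f -> f <= F -> 0 < c0 -> c0 <= c ->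
  F * ((1 + x * (M - 1)) * (1 + x * (Y - 1)) +
    (1 + c0) * ((1 - x) * (19 / 8 * (1 + x * (sM - 1))) + x * Z)) <= K * c0 ->
  f * ((M * Y) `^ x + (1 + c) * ((19 / 8 * M `^ (x / 2)) `^ (1 - x) * z `^ x)) <= K * c.
Proof.
move=> M1 sM1 MsM Y1 x01 z0 zZ f0 fF c00 cc hK.
have /andP[x0 x1] := x01.
have Z0 := le_trans z0 zZ.
have F0 := le_trans f0 fF.
set t1 := (1 + x * (M - 1)) * (1 + x * (Y - 1)) in hK *.
set t2 := (1 - x) * (19 / 8 * (1 + x * (sM - 1))) + x * Z in hK *.
have xM : 0 <= x * (M - 1) by rewrite mulr_ge0 ?subr_ge0.
have xY : 0 <= x * (Y - 1) by rewrite mulr_ge0 ?subr_ge0.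
have xsM : 0 <= x * (sM - 1) by rewrite mulr_ge0 ?subr_ge0.
have t10 : 0 <= t1 by rewrite mulr_ge0//; lra.
have t20 : 0 <= t2.
  rewrite addr_ge0 ?mulr_ge0//; lra.
apply: le_trans (total_affine cc F0 t10 t20 (ltW c00) c00 hK).
apply: ler_pM => //.
  by rewrite addr_ge0 ?mulr_ge0 ?powR_ge0//; lra.
apply: lerD.
  rewrite powRM; try lra.
  by apply: ler_pM; rewrite ?powR_ge0//;
    have := @bernoulli_le _ x _ x01; [move=> /(_ (M - 1))|move=> /(_ (Y - 1))];
    rewrite addrCA subrr addr0; apply; lra.
apply: ler_wpM2l; first by lra.
have -> : M `^ (x / 2) = (M `^ 2^-1) `^ x by rewrite -powRrM mulrC.
have sq : M `^ 2^-1 <= sM.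
  apply: (@ler_powR_root _ _ _ 2); rewrite ?powR_ge0//; try lra.
  by rewrite powRVK ?pnatr_eq0// ?powR_mulrn//; lra.
apply: le_trans (_ : (19 / 8 * sM `^ x) `^ (1 - x) * z `^ x <= _).
  apply: ler_wpM2r; first exact: powR_ge0.
  apply: powR_leq; first by lra.
    by rewrite mulr_ge0 ?powR_ge0//; lra.
  by apply: ler_wpM2l; [lra|apply: powR_leq => //; exact: powR_ge0].
apply: le_trans (interpolated_le sM1 x01 x01 z0) _.
by rewrite lerD2l; apply: ler_wpM2l.
Qed.

(** 56/27 is 2 times 7/6 over 9/8: the first and last factors of [energy_factor] are at most 2 and
    7/6. *)
Lemma crude_factor_le (D : nat) u0 r Y : D%:R^-1 <= u0 -> 0 <= r < 1 ->
  D%:R * r / 2 <= 1 -> 0 <= Y ->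
  1 + 2 * (56 / 27 * (1 + 2 * u0)) ^+ 2 <= Y ^+ 2 ->
  1 + 2 * (energy_factor D 2^-1 r / (9 / 8)) ^+ 2 <= Y ^+ 2.
Proof.
move=> uD r01 Dr1 Y0 hY.
have k2 := kappa_half_le r01; have /andP[r0 r1] := r01.
have u0_ge0 : 0 <= D%:R^-1 :> R by rewrite invr_ge0.
have Dr : 0 <= D%:R * r / 2 by rewrite !mulr_ge0.
have D0 : 0 <= 1 - r + 2 * D%:R^-1 by lra.
have w := powR_ge0 (2^-1)^-1 ((1 + r) / 2).
have e0 : 0 <= 1 + (1 - D%:R * r / 2) / 6 by lra.
apply: le_trans hY; rewrite lerD2l ler_pM2l//.
have b1 : energy_factor D 2^-1 r <= 2 * (1 + 2 * u0) * (7 / 6).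
  apply: ler_pM => //; first by rewrite mulr_ge0.
    by apply: ler_pM => //; lra.
  by lra.
have b0 : 0 <= energy_factor D 2^-1 r by rewrite !mulr_ge0.
rewrite lerXn2r ?nnegrE//; lra.
Qed.

(** Reduces the case i = j = r to polynomial inequalities in x = D r: [b] bounds the energy factor
    over 9/8, [Z] the base with exponent x, and [F] the outer factor. *)
Lemma fine_regime (D : nat) u0 M sM Y b F Z c c0 K r (x := D%:R * r) :
  (0 < D)%N -> D%:R^-1 <= u0 -> u0 <= 1 -> 0 <= x <= 1 ->
  1 <= M -> 1 <= sM -> M <= sM ^+ 2 -> 1 <= Y -> 0 < c0 -> c0 <= c ->
  (7 / 10)^-1 `^ ((1 + r) / 2) * c `^ (- r) <= F ->
  6 / 5 * (1 + 3 / 14 * (u0 * x)) * (1 + u0 * (2 - x)) * (1 + (1 - x / 2) / 6)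
    <= 9 / 8 * b ->
  1 + 2 * b ^+ 2 <= Y ^+ 2 ->
  (6 / 5 * (1 + 3 / 14 * (u0 * x))) ^+ 2 * (1 + 2 * u0 * (1 - x)) * (1 + (1 - x) / 6) <= Z ->
  F * ((1 + x * (M - 1)) * (1 + x * (Y - 1)) +
    (1 + c0) * ((1 - x) * (19 / 8 * (1 + x * (sM - 1))) + x * Z)) <= K * c0 ->
  1 + 2 * (energy_factor D (7 / 10) r / (9 / 8)) ^+ 2 <= Y ^+ 2 /\
  (7 / 10)^-1 `^ ((1 + r) / 2) * c `^ (- r) *
    ((M * Y) `^ x + (1 + c) * ((19 / 8 * M `^ (D%:R * r / 2)) `^ (1 - x) *
      ((7 / 10)^-1 `^ ((1 + r) / 2) * (7 / 10)^-1 `^ ((1 + r) / 2) *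
       (1 + 2 * D%:R^-1 * (1 - x)) * (1 + (1 - x) / 6)) `^ x)) <= K * c.
Proof.
move=> D0 uD u1 x01 M1 sM1 MsM Y1 c00 cc hF hb hY hZ hK.
have DR : 0 < D%:R :> R by rewrite ltr0n.
have u_gt0 : 0 < D%:R^-1 :> R by rewrite invr_gt0.
have rx : r = D%:R^-1 * x by rewrite /x mulrA mulVf ?mul1r// gt_eqF.
have /andP[x0 x1] := x01.
have r0 : 0 <= r by rewrite rx mulr_ge0// ltW.
have rux : r <= u0 * x by rewrite rx; exact: ler_wpM2r.
have ux1 : u0 * x <= 1 by nra.
have r01 : 0 <= r <= 1 by lra.
have k0 := powR_ge0 (7 / 10 : R)^-1 ((1 + r) / 2).
have kr : (7 / 10)^-1 `^ ((1 + r) / 2) <= 6 / 5 * (1 + 3 / 14 * (u0 * x)).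
  by apply: le_trans (kappa_seven_tenths_le r01) _; lra.
have uxx : D%:R^-1 * (2 - x) <= u0 * (2 - x) by apply: ler_wpM2r => //; lra.
have ux0 : 0 <= D%:R^-1 * (2 - x) by apply: mulr_ge0; [exact: ltW|lra].
have vxx : D%:R^-1 * (1 - x) <= u0 * (1 - x) by apply: ler_wpM2r => //; lra.
have vx0 : 0 <= D%:R^-1 * (1 - x) by apply: mulr_ge0; [exact: ltW|lra].
have g_eq : 1 - r + 2 * D%:R^-1 = 1 + D%:R^-1 * (2 - x) by rewrite rx; ring.
have e0 : 0 <= energy_factor D (7 / 10) r.
  by rewrite /energy_factor -/x g_eq !mulr_ge0//; lra.
split.
  have E : energy_factor D (7 / 10) r <= 9 / 8 * b.
    apply: le_trans hb; rewrite /energy_factor -/x g_eq.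
    have p1 : 0 <= 1 + D%:R^-1 * (2 - x) by rewrite addr_ge0.
    have p2 : 1 + D%:R^-1 * (2 - x) <= 1 + u0 * (2 - x) by rewrite lerD2l.
    have p3 : 0 <= 1 + (1 - x / 2) / 6 by lra.
    exact: ler_wpM2r p3 _ _ (ler_pM k0 p1 kr p2).
  apply: le_trans hY; rewrite lerD2l ler_pM2l// lerXn2r ?nnegrE//; lra.
have -> : D%:R * r / 2 = x / 2 by [].
apply: (fine_total M1 sM1 MsM Y1 x01 _ _ _ hF c00 cc hK).
- by rewrite !mulr_ge0//; lra.
- apply: le_trans hZ; rewrite expr2.
  apply: ler_wpM2r; first by lra.
  apply: ler_pM; [exact: mulr_ge0|lra|exact: ler_pM|lra].
- by rewrite mulr_ge0 ?powR_ge0.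
Qed.

(* A polynomial of degree at most 4 is below a constant on an interval when its
   Bernstein coefficients are: only linear arithmetic remains. *)
Let bernstein4 y z : 0 <= y -> 0 <= z ->
  [/\ 0 <= y ^+ 4, 0 <= y ^+ 3 * z, 0 <= y ^+ 2 * z ^+ 2, 0 <= y * z ^+ 3 & 0 <= z ^+ 4].
Proof. by move=> y0 z0; split; rewrite ?mulr_ge0 ?exprn_ge0. Qed.

(** The case i = j with k = 7/10. The outer factor anticipates what multiplies this estimate in case
    (ii) of the theorem. *)
Let fine_statement (D : nat) M c K r := let x := D%:R * r in
  exists2 Y, 1 <= Y & 1 + 2 * (energy_factor D (7 / 10) r / (9 / 8)) ^+ 2 <= Y ^+ 2 /\
  (7 / 10)^-1 `^ ((1 + r) / 2) * c `^ (- r) *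
    ((M * Y) `^ x + (1 + c) * ((19 / 8 * M `^ (D%:R * r / 2)) `^ (1 - x) *
      ((7 / 10)^-1 `^ ((1 + r) / 2) * (7 / 10)^-1 `^ ((1 + r) / 2) *
       (1 + 2 * D%:R^-1 * (1 - x)) * (1 + (1 - x) / 6)) `^ x)) <= K * c.

Lemma fine_two c r : 2 <= c -> 0 <= 2%:R * r <= 1 -> fine_statement 2 2 c 7 r.
Proof.
move=> c2 x01; have /andP[x0 x1] := x01.
have hF : (7 / 10)^-1 `^ ((1 + r) / 2) * c `^ (- r) <= 6 / 5 * (1 - (2%:R * r) / 5).
  have := kappa_conductance_le2 c2 x01.
  by have -> : 2%:R * r / 2 = r by lra.
(* Each half of the range has its own rational [b], [Y] and [Z]; the remaining polynomial
   inequalities in x are settled by [bernstein4]. *)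
have [xh|xh] := leP (2%:R * r) (1 / 2).
  have y0 : 0 <= 1 / 2 - 2%:R * r by lra.
  exists (366 / 100); first by lra.
  apply: (@fine_regime 2 (1 / 2) 2 (283 / 200) (366 / 100) (2489 / 1000) _ (337 / 100)
    c 2 7 r _ _ _ x01 _ _ _ _ _ c2 hF) => //; try lra;
  move: {hF} (2%:R * r) x0 x1 y0 {x01 xh} => x x0 x1 y0;
  have [? ? ? ? ?] := bernstein4 x0 y0; lra.
have y0 : 0 <= 2%:R * r - 1 / 2 by lra.
exists (329 / 100); first by lra.
apply: (@fine_regime 2 (1 / 2) 2 (283 / 200) (329 / 100) (2213 / 1000) _ (261 / 100)
  c 2 7 r _ _ _ x01 _ _ _ _ _ c2 hF) => //; try lra;
move: {hF} (2%:R * r) x0 x1 y0 {x01 xh} => x x0 x1 y0;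
(have z0 : 0 <= 1 - x by rewrite subr_ge0); have [? ? ? ? ?] := bernstein4 y0 z0; lra.
Qed.

Lemma fine_three (D : nat) c r : (2 < D)%N -> 2 <= c -> 0 <= D%:R * r <= 1 ->
  fine_statement D (11 / 6) c (43 / 6) r.
Proof.
move=> D3 c2 x01; have /andP[x0 x1] := x01.
have uD : D%:R^-1 <= 1 / 3 :> R by rewrite div1r lef_pV2 ?posrE ?ltr0n ?ler_nat//; lia.
have r01 : 0 <= r <= 1.
  have D1 : 1 <= D%:R :> R by rewrite ler1n; lia.
  have r0 : 0 <= r by rewrite -(pmulr_rge0 _ (lt_le_trans ltr01 D1)).
  by rewrite r0; nra.
have D0 : (0 < D)%N by lia.
have hF := kappa_conductance_le65 (le_trans (_ : 6 / 5 <= 2) c2) r01.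
have [xh|xh] := leP (D%:R * r) (1 / 2).
  have y0 : 0 <= 1 / 2 - D%:R * r by lra.
  exists (311 / 100); first by lra.
  apply: (@fine_regime D (1 / 3) (11 / 6) (271 / 200) (311 / 100) (2075 / 1000) _ (281 / 100)
    c 2 (43 / 6) r D0 uD _ x01 _ _ _ _ _ c2 (hF _)) => //; try lra;
  move: {hF uD} (D%:R * r) x0 x1 y0 {x01 xh} => x x0 x1 y0;
  have [? ? ? ? ?] := bernstein4 x0 y0; lra.
have y0 : 0 <= D%:R * r - 1 / 2 by lra.
exists (283 / 100); first by lra.
apply: (@fine_regime D (1 / 3) (11 / 6) (271 / 200) (283 / 100) (1865 / 1000) _ (224 / 100)
  c 2 (43 / 6) r D0 uD _ x01 _ _ _ _ _ c2 (hF _)) => //; try lra;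
move: {hF uD} (D%:R * r) x0 x1 y0 {x01 xh} => x x0 x1 y0;
(have z0 : 0 <= 1 - x by rewrite subr_ge0); have [? ? ? ? ?] := bernstein4 y0 z0; lra.
Qed.

Lemma fine_eight (D : nat) c r : (7 < D)%N -> 17 / 10 <= c -> 0 <= D%:R * r <= 1 ->
  fine_statement D (17 / 12) c (643 / 100) r.
Proof.
move=> D3 c2 x01; have /andP[x0 x1] := x01.
have uD : D%:R^-1 <= 1 / 8 :> R by rewrite div1r lef_pV2 ?posrE ?ltr0n ?ler_nat//; lia.
have r01 : 0 <= r <= 1.
  have D1 : 1 <= D%:R :> R by rewrite ler1n; lia.
  have r0 : 0 <= r by rewrite -(pmulr_rge0 _ (lt_le_trans ltr01 D1)).
  by rewrite r0; nra.
have D0 : (0 < D)%N by lia.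
have hF := kappa_conductance_le65 (le_trans (_ : 6 / 5 <= 17 / 10) c2) r01.
exists (1209 / 500); first by lra.
apply: (@fine_regime D (1 / 8) (17 / 12) (1191 / 1000) (1209 / 500) (1556 / 1000) _ (21 / 10)
  c (17 / 10) (643 / 100) r D0 uD _ x01 _ _ _ _ _ c2 (hF _)) => //; try lra;
move: {hF uD} (D%:R * r) x0 x1 {x01} => x x0 x1;
(have z0 : 0 <= 1 - x by rewrite subr_ge0); have [? ? ? ? ?] := bernstein4 x0 z0; lra.
Qed.

Let crude_statement (D : nat) M c K i j := let x := D%:R * (i + j) / 2 in
  exists2 Y, 1 <= Y & [/\ 1 + 2 * (energy_factor D 2^-1 i / (9 / 8)) ^+ 2 <= Y ^+ 2,
    1 + 2 * (energy_factor D 2^-1 j / (9 / 8)) ^+ 2 <= Y ^+ 2 &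
    (M * Y) `^ x + (1 + c) * ((19 / 8 * M `^ (D%:R * j / 2)) `^ (1 - x) *
      ((2^-1)^-1 `^ ((1 + i) / 2) * (2^-1)^-1 `^ ((1 + j) / 2) *
       (1 + 2 * D%:R^-1 * (1 - x)) * (1 + (1 - x) / 6)) `^ x) <= K * c].

Lemma crude_regime (D : nat) u0 M Y T c K i j : D%:R^-1 <= u0 -> 1 <= M -> 1 <= Y -> 0 <= c ->
  0 <= i < 1 -> 0 <= j < 1 -> D%:R * (i + j) / 2 <= 1 ->
  1 + 2 * (56 / 27 * (1 + 2 * u0)) ^+ 2 <= Y ^+ 2 ->
  (forall x, 0 <= x <= 1 ->
    (1 - x) * (19 / 8 * (1 + x * (M - 1))) +
      x * (4 * (1 + 2 * u0 * (1 - x)) * (1 + (1 - x) / 6)) <= T) ->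
  M * Y + (1 + c) * T <= K * c -> crude_statement D M c K i j.
Proof.
move=> uD M1 Y1 c0 i01 j01 x1 hY hT hK.
have /andP[i0 i1] := i01; have /andP[j0 j1] := j01.
have D0 : 0 <= D%:R :> R := ler0n _ _.
have Di := mulr_ge0 D0 i0; have Dj := mulr_ge0 D0 j0.
have Y0 : 0 <= Y by lra.
have u_ge0 : 0 <= D%:R^-1 :> R by rewrite invr_ge0.
exists Y => //; split; [apply: crude_factor_le hY => //; lra|apply: crude_factor_le hY => //; lra|].
set x := D%:R * (i + j) / 2 in x1 *.
have x01 : 0 <= x <= 1 by rewrite x1 andbT /x; lra.
have jx : 0 <= D%:R * j / 2 <= x by rewrite /x; lra.
have z04 : 0 <= (2^-1)^-1 `^ ((1 + i) / 2) * (2^-1)^-1 `^ ((1 + j) / 2) <= 4.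
  rewrite mulr_ge0 ?powR_ge0//= (_ : 4 = 2 * 2); last by ring.
  by apply: ler_pM; rewrite ?powR_ge0//; exact: kappa_half_le.
apply: le_trans hK; apply: (crude_total M1 Y1 jx x01 u_ge0 z04 c0).
apply: le_trans (hT x x01); rewrite lerD2l.
have /andP[x0 _] := x01.
apply: ler_wpM2l => //; apply: ler_wpM2r; first by lra.
rewrite ler_pM2l// lerD2l; apply: ler_wpM2r; first by lra.
by rewrite ler_pM2l.
Qed.

(** From D to D + 1 the left side grows by 1 + 1/D <= 1 + 1/D0 <= M. This bounds the D-th root of
    the mean degree by [M] uniformly in D. *)
Lemma linear_le_pow (D0 D : nat) M : (0 < D0)%N -> (D0 <= D)%N -> 1 + D0%:R^-1 <= M ->
  2 * D0%:R <= M ^+ D0 -> 2 * D%:R <= M ^+ D.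
Proof.
move=> D00 DD hM h; rewrite -(subnK DD); elim: (D - D0)%N => [//|m IH].
rewrite addSn exprS; have M0 : 0 <= M by apply: le_trans hM; rewrite addr_ge0.
apply: le_trans (ler_wpM2l M0 IH).
have D0R : 0 < D0%:R :> R by rewrite ltr0n.
apply: le_trans (ler_wpM2r _ hM); last by rewrite mulr_ge0.
rewrite mulrDl mul1r -natr1 natrD.
have : 1 <= D0%:R^-1 * (m%:R + D0%:R) :> R.
  by rewrite ler_pdivlMl// mulr1 lerDr.
lra.
Qed.

(** Gives (2 D / md)^(1/D) <= 7/6, as the mean degree is at least D + 1; nearly sharp at D = 2. *)
Lemma ratio_le_pow (D : nat) : (1 < D)%N -> 2 * D%:R <= (7 / 6) ^+ D * (D%:R + 1) :> R.
Proof.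
elim: D => [//|D IH]; case: D IH => [//|[|D]] IH _; first by lra.
have {}IH := IH isT; rewrite exprS -[D.+3%:R]natr1.
set p := (7 / 6) ^+ _ in IH *.
have y2 : 2 <= D.+2%:R :> R by rewrite ler_nat.
move: (D.+2%:R) IH y2 => y IH y2.
have y1 : 0 < y + 1 by lra.
rewrite -(ler_pM2r y1).
have h : 7 / 6 * (y + 2) * (2 * y) <= 7 / 6 * (y + 2) * (p * (y + 1)).
  by apply: ler_wpM2l => //; lra.
have e : 0 <= (y - 2) * (y - 2) by rewrite -expr2 sqr_ge0.
lra.
Qed.

Lemma root_le (D : nat) (a M : R) : (0 < D)%N -> 0 <= a -> 0 <= M -> a <= M ^+ D ->
  a `^ D%:R^-1 <= M.
Proof.
move=> D0 a0 M0 h; apply: (@ler_powR_root _ _ _ D%:R); rewrite ?powR_ge0 ?ltr0n//.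
by rewrite powRVK ?powR_mulrn// pnatr_eq0; lia.
Qed.

Lemma conductance_powers c c0 K Phi : 0 < c0 -> c0 <= c -> 0 < K ->
  K * (1 + c0 ^+ 3) <= 8 * c0 ^+ 5 -> K <= (8 - Phi) * c0 ^+ 4 ->
  K * (c ^+ 3 + c ^+ 6) <= 8 * c ^+ 8 /\ K * c ^+ 4 + Phi * c ^+ 8 <= 8 * c ^+ 8.
Proof.
move=> c00 cc K0 h1 h2; have c0p := lt_le_trans c00 cc.
have pw k : c0 ^+ k <= c ^+ k by rewrite lerXn2r ?nnegrE ?(ltW c00) ?(ltW c0p).
have p0 k : 0 < c ^+ k by rewrite exprn_gt0.
have q0 k : 0 < c0 ^+ k by rewrite exprn_gt0.
split.
  have -> : c ^+ 3 + c ^+ 6 = c ^+ 3 * (1 + c ^+ 3) by ring.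
  have -> : 8 * c ^+ 8 = c ^+ 3 * (8 * c ^+ 5) by ring.
  rewrite mulrCA; apply: ler_wpM2l; first exact: ltW.
  rewrite -(ler_pM2l (q0 3)).
  apply: (@le_trans _ _ (c ^+ 3 * (8 * c0 ^+ 5))).
    apply: (@le_trans _ _ (c ^+ 3 * (K * (1 + c0 ^+ 3)))).
      by have := mulr_ge0 (ltW K0) (_ : 0 <= c ^+ 3 - c0 ^+ 3); rewrite subr_ge0 pw; nra.
    by apply: ler_wpM2l => //; exact: ltW.
  have -> : c ^+ 3 * (8 * c0 ^+ 5) = 8 * c0 ^+ 3 * c ^+ 3 * c0 ^+ 2 by ring.
  have -> : c0 ^+ 3 * (8 * c ^+ 5) = 8 * c0 ^+ 3 * c ^+ 3 * c ^+ 2 by ring.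
  by apply: ler_wpM2l => //; rewrite !mulr_ge0// ltW.
have P0 : 0 <= 8 - Phi.
  by rewrite -(pmulr_lge0 _ (q0 4)); apply: le_trans h2; exact: ltW.
have : K <= (8 - Phi) * c ^+ 4 by apply: le_trans h2 _; exact: ler_wpM2l.
have -> : c ^+ 8 = c ^+ 4 * c ^+ 4 by ring.
have := p0 4; nra.
Qed.

(** Three ranges: D = 2; D >= 3 with c >= 2; D >= 8 with c >= 17/10. [K] serves arbitrary i and j,
    in terms that leave powers of [c] to spare; [Phi] serves i = j and is multiplied by the full
    c^8, hence must stay below 8, which calls for the finer constants. *)
Lemma smoothing_regime (D : nat) c : (1 < D)%N ->
  2 <= c \/ (7 < D)%N /\ 17 / 10 <= c ->
  exists M K Phi, [/\ 0 < K /\ 2 * D%:R <= M ^+ D /\ 1 <= M,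
    forall i j, 0 <= i < 1 -> 0 <= j < 1 -> D%:R * (i + j) / 2 <= 1 ->
      crude_statement D M c K i j,
    forall r, 0 <= D%:R * r <= 1 -> fine_statement D M c Phi r,
    K * (c ^+ 3 + c ^+ 6) <= 8 * c ^+ 8 &
    K * c ^+ 4 + Phi * c ^+ 8 <= 8 * c ^+ 8].
Proof.
move=> D1 hc.
have [D2|D2] := leqP D 2.
  have {D1 D2 hc} [-> c2] : D = 2%N /\ 2 <= c.
    by case: hc => [c2|[]]; [split=> //|]; lia.
  exists 2, 14, 7.
  have [|||||h1 h2] := @conductance_powers c 2 14 7 => //; try lra.
  split=> //; [split=> //; split; lra| |by move=> r; exact: fine_two].
  move=> i j i01 j01 x1.
  apply: (@crude_regime 2 (1 / 2) 2 6 (16 / 3)) => //; try lra.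
  move=> x /andP[x0]; rewrite -subr_ge0 => z0.
  have [|/ltW] := leP x (1 / 2); rewrite -subr_ge0 => y0.
    by have [? ? ? ? ?] := bernstein4 x0 y0; lra.
  by have [? ? ? ? ?] := bernstein4 y0 z0; lra.
have uD : D%:R^-1 <= 1 / 3 :> R by rewrite div1r lef_pV2 ?posrE ?ltr0n ?ler_nat//; lia.
have [c2|c2] := leP 2 c.
  exists (11 / 6), 13, (43 / 6).
  have [|||||h1 h2] := @conductance_powers c 2 13 (43 / 6) => //; try lra.
  split=> //; last by move=> r; exact: fine_three.
    split=> //; split; last by lra.
    apply: (@linear_le_pow 3) => //; lra.
  move=> i j i01 j01 x1.
  apply: (@crude_regime D (1 / 3) (11 / 6) 5 5) => //; try lra.
  move=> x /andP[x0]; rewrite -subr_ge0 => z0.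
  have [|/ltW] := leP x (1 / 2); rewrite -subr_ge0 => y0.
    by have [? ? ? ? ?] := bernstein4 x0 y0; lra.
  by have [? ? ? ? ?] := bernstein4 y0 z0; lra.
have [D7 c17] : (7 < D)%N /\ 17 / 10 <= c by case: hc => [|//]; rewrite leNgt c2.
exists (17 / 12), 13, (643 / 100).
have [|||||h1 h2] := @conductance_powers c (17 / 10) 13 (643 / 100) => //; try lra.
split=> //; last by move=> r; exact: fine_eight.
  split=> //; split; last by lra.
  apply: (@linear_le_pow 8) => //; lra.
move=> i j i01 j01 x1.
apply: (@crude_regime D (1 / 3) (17 / 12) 5 5) => //; try lra.
move=> x /andP[x0]; rewrite -subr_ge0 => z0.
  have [|/ltW] := leP x (1 / 2); rewrite -subr_ge0 => y0.
    by have [? ? ? ? ?] := bernstein4 x0 y0; lra.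
  by have [? ? ? ? ?] := bernstein4 y0 z0; lra.
Qed.
End SmoothingNumerics.

(** * Smoothing on the boundary for d >= 3 *)

Section BoundarySmoothing.
Variables (R : realType) (d n : nat) (c r0 : R).
Hypothesis d_gt2 : (2 < d)%N.
Hypothesis n_gt0 : (0 < n)%N.
Hypothesis c_gt1 : 1 < c.
Notation X := (bdry d n).
Notation e := (@bdry_rel d n).
Notation em := (@emeasure R X (@bdry_rel d n)).
Notation vm := (@vmeasure R X).
Notation D := (d.-1).
Notation sobolev r := (sobolev_inequality e D (c * n%:R) r).
Hypothesis r0_lt1 : 0 <= r0 < 1.
Hypothesis sob0 : sobolev r0.
Hypothesis card_le : #|` X|%:R <= c * #|` tbdry d n|%:R.

Let d_gt1 : (1 < d)%N := ltnW d_gt2.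
Let d_gt0 : (0 < d)%N := ltnW d_gt1.

Lemma conductance_dichotomy : 2 <= c \/ (7 < D)%N /\ 17 / 10 <= c.
Proof.
have c0 : 0 < c by apply: lt_trans c_gt1.
have /andP[r00 r01] := r0_lt1.
have P2 : 2 <= 2 / (1 - r0) by rewrite ler_pdivlMr; lra.
have al : (((1 - r0) / 2 + D%:R^-1)^-1)^-1 = (2 / (1 - r0))^-1 + D%:R^-1.
  by rewrite invrK invf_div.
have [d9|d9] := ltnP d 9.
  left; apply: (sobolev_constant_ge2 d_gt1 n_gt0 c0 P2 al) => //.
  by rewrite d_gt2.
right; split; first by lia.
exact: (sobolev_constant_ge17 d_gt1 n_gt0 c0 P2 al).
Qed.

(** The properties of the map taking f to the norm of f - S f that matter: closeness on regular
    functions and boundedness on rough ones. *)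
Definition smoothing_seminorm (eps i : R) (Phi : (X -> R) -> R) :=
  [/\ forall f h, Phi (fun x => f x + h x) <= Phi f + Phi h,
      forall f, Phi f <= c * n%:R * eps * wnorm em (2 / (1 - i)) (ediff f) &
      forall f, Phi f <= (1 + c) * wnorm vm (2 / (1 - i)) f].

Lemma smoothing_seminorm_sub eps i Phi f a : 0 <= i < 1 -> smoothing_seminorm eps i Phi ->
  Phi (fun x => f x - a) = Phi f.
Proof.
move=> /andP[i0 i1] [PhiD Phi1 _].
have P0 : 2 / (1 - i) != 0 by rewrite gt_eqF// divr_gt0//; lra.
have cst b : Phi (fun=> b) <= 0.
  apply: le_trans (Phi1 _) _.
  rewrite wnormE big1 ?powR0 ?invr_eq0 ?mulr0// => p _.
  by rewrite /ediff subrr normr0 powR0// mulr0.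
apply/eqP; rewrite eq_le; apply/andP; split.
  by have := PhiD f (fun=> - a); have := cst (- a); lra.
have := PhiD (fun x => f x - a) (fun=> a); have := cst a.
have -> : (fun x => f x - a + a) = f by apply/funext => x; rewrite subrK.
lra.
Qed.

Lemma bdry_smoothing : exists K Psi : R,
  [/\ 0 < K, K * (c ^+ 3 + c ^+ 6) <= 8 * c ^+ 8, K * c ^+ 4 + Psi * c ^+ 8 <= 8 * c ^+ 8,
  forall eps i j Phi, 0 < eps < 1 -> 0 <= i < 1 -> 0 <= j < 1 -> D%:R * (i + j) / 2 <= 1 ->
    sobolev i -> sobolev j -> smoothing_seminorm eps i Phi ->
    forall u, Phi u <= K * c ^+ 2 * n%:R * eps `^ (1 - D%:R * (i + j) / 2)
      * wnorm em (2 / (1 + j)) (ediff u) &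
  forall r, 0 <= r < 1 -> D%:R * r <= 1 -> sobolev r ->
    exists k nu q, [/\ 0 < k <= 1, 0 <= nu /\ 0 <= q, centering k nu (2 / (1 + r)),
      k^-1 `^ ((1 + r) / 2) * c `^ (- r) * q <= Psi &
      forall eps Phi u, 0 < eps < 1 -> smoothing_seminorm eps r Phi ->
        Phi u <= q * c ^+ 2 * n%:R * eps `^ (1 - D%:R * r)
          * wnorm em (2 / (1 + r)) (ediff u)]].
Proof.
have c0 : 0 < c by apply: lt_trans c_gt1.
have nR : 0 < n%:R :> R by rewrite ltr0n.
have D1 : (1 < D)%N by lia.
have DR : 0 < D%:R :> R by rewrite ltr0n; lia.
have D2 : 2 <= D%:R :> R by rewrite ler_nat.
have X0 := card_bdry_gt0 d_gt1 n_gt0.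
have E0 := @sum_degree_gt0 R _ _ d_gt1 n_gt0.
have mdl := @mean_degree_le R _ _ d_gt1 n_gt0.
have mdg : D%:R + 1 <= mean_degree R e.
  have := @mean_degree_ge R _ _ d_gt1 n_gt0 _ c0 card_le.
  have := natr_pred R d_gt1.
  have d3 : 0 <= (d%:R - 2) / c by rewrite divr_ge0 ?(ltW c0)// subr_ge0 ler_nat.
  lra.
have deg x : degree R e x <= 2 * D%:R.
  by rewrite -natr_pred//; exact: degree_le.
have cn0 : 0 < c * n%:R by rewrite mulr_gt0.
have [M [K [Psi [[K0 [MD M1]] crude fine hK hPsi]]]] := smoothing_regime D1 conductance_dichotomy.
rewrite natr_pred// in mdl.
have md0 : 0 < mean_degree R e by lra.
have M0 : 0 <= M by lra.
have md_root : mean_degree R e `^ D%:R^-1 <= M.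
  exact: root_le (ltnW D1) (ltW md0) M0 (le_trans mdl MD).
have rho_root : (2 * D%:R / mean_degree R e) `^ D%:R^-1 <= 7 / 6.
  have q0 : 0 <= 2 * D%:R / mean_degree R e by rewrite divr_ge0 ?(ltW md0)// mulr_ge0.
  have q1 : 0 <= 7 / 6 :> R by lra.
  refine (root_le (ltnW D1) q0 q1 _).
  rewrite ler_pdivrMr//; apply: le_trans (ratio_le_pow R D1) _.
  by apply: ler_wpM2l => //; rewrite exprn_ge0.
exists K, Psi; split=> //.
  move=> eps i j Phi /andP[e0 e1] i01 j01 x1 sobi sobj sem u.
  have [Y Y1 [Yi Yj tot]] := crude i j i01 j01 x1.
  have /andP[i0 i1] := i01; have /andP[j0 j1] := j01.
  have h01 : 0 < (2^-1 : R) <= 1 by lra.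
  have e01 : 0 < eps <= 1 by rewrite e0 ltW.
  have ij : i + j <= 2 * D%:R^-1.
    by rewrite -(ler_pM2l DR) mulrCA divff ?mulr1 ?gt_eqF//; lra.
  have cj : centering 2^-1 (2 / (1 + j) / 2) (2 / (1 + j)).
    by apply: centering_half; rewrite ler_pdivlMr ?ler_pdivrMr; lra.
  have ci : centering 2^-1 (2 / (1 + i) / 2) (2 / (1 + i)).
    by apply: centering_half; rewrite ler_pdivlMr ?ler_pdivrMr; lra.
  have nj : 0 <= 2 / (1 + j) / 2 by rewrite !divr_ge0//; lra.
  have ni : 0 <= 2 / (1 + i) / 2 by rewrite !divr_ge0//; lra.
  have [PhiD Phi1 Phi2] := sem.
  have c10 : 0 <= 1 + c by lra.
  have Y0 : 0 <= Y by lra.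
  apply: le_trans (smoothing_estimate (@bdry_rel_sym d n) X0 E0 (transport_coupling n d_gt0 R)
    D1 deg md_root rho_root cn0 e01 h01 i0 j0 i1 j1 u ij sobi sobj nj cj ni ci Y0 Yi Yj c10 PhiD
    (fun f a => smoothing_seminorm_sub f a i01 sem) Phi1 Phi2) _.
  apply: ler_wpM2r; first exact: wnorm_ge0.
  set E := eps `^ _.
  have -> : K * c ^+ 2 * n%:R * E = c * n%:R * E * (K * c) by ring.
  by apply: ler_wpM2l => //; rewrite mulr_ge0 ?powR_ge0 ?ltW.
move=> r r01 x1 sob; have /andP[ra rb] := r01.
have x01 : 0 <= D%:R * r <= 1 by rewrite x1 mulr_ge0.
have [Y Y1 [Yr tot]] := fine r x01.
(* So 2/(1 + r) >= 4/3, as [centering_seven_tenths] requires. *)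
have r2 : r <= 1 / 2 by nra.
set z := ((_ `^ _ + _) : R) in tot.
(* The estimate carries one factor [c] from the Sobolev constant, the claim c^2: hence the
   division. *)
exists (7 / 10), (23 / 25), (z / c).
have h01 : 0 < (7 / 10 : R) <= 1 by lra.
have n0 : 0 <= 23 / 25 :> R by lra.
have cent : centering (7 / 10) (23 / 25) (2 / (1 + r)).
  by apply: centering_seven_tenths; rewrite ler_pdivlMr ?ler_pdivrMr; lra.
split=> //.
- split=> //; rewrite divr_ge0 ?(ltW c0)// /z.
  by rewrite addr_ge0 ?powR_ge0// mulr_ge0 ?mulr_ge0 ?powR_ge0//; lra.
- by rewrite [leLHS]mulrA ler_pdivrMr.
move=> eps Phi u /andP[e0 e1] sem; have [PhiD Phi1 Phi2] := sem.
have e01 : 0 < eps <= 1 by rewrite e0 ltW.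
have rr : r + r <= 2 * D%:R^-1.
  by rewrite -(ler_pM2l DR) mulrCA divff ?mulr1 ?gt_eqF//; lra.
have c10 : 0 <= 1 + c by lra.
have Y0 : 0 <= Y by lra.
have xx : D%:R * (r + r) / 2 = D%:R * r by field.
have := smoothing_estimate (@bdry_rel_sym d n) X0 E0 (transport_coupling n d_gt0 R)
  D1 deg md_root rho_root cn0 e01 h01 ra ra rb rb u rr sob sob n0 cent n0 cent Y0 Yr Yr c10 PhiD
  (fun f a => smoothing_seminorm_sub f a r01 sem) Phi1 Phi2.
rewrite xx -/z => /le_trans; apply.
apply: ler_wpM2r; first exact: wnorm_ge0.
set E := eps `^ _; rewrite le_eqVlt; apply/orP; left; apply/eqP.
by field; rewrite gt_eqF.
Qed.
End BoundarySmoothing.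

(** * Cycles: smoothing by truncation of the derivative *)

Section CycleGraph.
Variables (R : realType) (V : finType) (e : rel V) (next : V -> V) (ind : V -> nat).
Hypothesis V_gt0 : (0 < #|V|)%N.
Hypothesis next_inj : injective next.
Hypothesis next2_neq : forall x, next (next x) != x.
Hypothesis e_next : forall x y, e x y = (y == next x) || (x == next y).
Hypothesis ind_inj : injective ind.
Hypothesis ind_next : forall x, ind (next x) = (ind x).+1 \/
  ind (next x) = 0%N /\ forall y, (ind y <= ind x)%N.
Implicit Types (u f g : V -> R).
Notation vm := (@vmeasure R V).
Notation em := (@emeasure R V e).

Lemma sum_next f : \sum_x f (next x) = \sum_x f x.
Proof. by rewrite [RHS](reindex_inj next_inj). Qed.

Lemma sum_cycle_edges (G : V -> V -> R) :
  \sum_x \sum_(y | e x y) G x y = \sum_x (G x (next x) + G (next x) x).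
Proof.
have split x : \sum_(y | e x y) G x y = G x (next x) + \sum_(y | x == next y) G x y.
  rewrite (bigD1 (next x))/=; last by rewrite e_next eqxx.
  congr (_ + _); apply: eq_bigl => y; rewrite e_next.
  have [->|ne] := eqVneq y (next x); last by rewrite andbT.
  by rewrite andbF; apply/esym/negbTE; rewrite eq_sym next2_neq.
under eq_bigr do rewrite split.
rewrite !big_split/=; congr (_ + _).
rewrite (exchange_big_dep predT)//=; apply: eq_bigr => y _.
by rewrite big_pred1_eq.
Qed.

Lemma degree_cycle x : degree R e x = 2.
Proof.
rewrite /degree (bigD1 (next x))/=; last by rewrite e_next eqxx.
have [y yx] : exists y, next y = x.
  by have /codomP[y ->] : x \in codom next; [rewrite (inj_card_onto next_inj)|exists y].
rewrite (bigD1 y)/=; last first.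
  rewrite e_next yx eqxx orbT/=; apply/eqP => yn.
  by have := next2_neq y; rewrite yx -yn eqxx.
rewrite big1 ?addr0// => z /andP[/andP[]].
rewrite e_next -yx (inj_eq next_inj) yx => /orP[/eqP -> |/eqP ->]; rewrite eqxx//.
Qed.

Lemma enorm_cycle s u : s != 0 ->
  wnorm em s (ediff u) = wnorm vm s (fun x => u (next x) - u x).
Proof.
move=> s0.
have V0 : #|V|%:R != 0 :> R by rewrite pnatr_eq0 -lt0n.
rewrite !wnormE; congr (_ `^ _).
have := wsum_emeasure e (fun x y => `|u y - u x| `^ s).
rewrite /wsum /ediff => ->; rewrite sum_cycle_edges -mulr_sumr.
under eq_bigr do rewrite degree_cycle.
rewrite sumr_const -mulr_natl /vmeasure.
rewrite (eq_bigr (fun x => 2 * `|u (next x) - u x| `^ s)) => [|x _].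
  by rewrite -mulr_sumr; field.
by rewrite (distrC (u x)); ring.
Qed.

(** Sums of [f] over the preceding positions; the vanishing total is used only at the step that
    closes the cycle. *)
Lemma cycle_primitive f : \sum_x f x = 0 -> exists u, forall x, u (next x) - u x = f x.
Proof.
move=> f0; exists (fun x => \sum_(y | (ind y < ind x)%N) f y) => x.
case: (ind_next x) => [->|[-> mx]].
  rewrite (bigD1 x)//= [X in _ + X - _](eq_bigl (fun y => (ind y < ind x)%N)).
    by rewrite addrK.
  by move=> y; rewrite ltnS ltn_neqAle andbC (inj_eq ind_inj).
rewrite big_pred0_eq sub0r.
move: f0; rewrite (bigD1 x)//= => f0.
rewrite (eq_bigl (fun y => y != x)) => [|y]; first by lra.
by rewrite ltn_neqAle mx andbT (inj_eq ind_inj).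
Qed.

Lemma norm_sub_mean_le s f : 1 <= s ->
  wnorm vm s (fun x => f x - wsum vm f) <= 2 * wnorm vm s f.
Proof.
move=> s1; have s0 : 0 < s by lra.
have vs := vmeasure_sum1 R V_gt0; have v0 := @vmeasure_ge0 R V.
have mean_le : `|wsum vm f| <= wnorm vm s f.
  apply: le_trans (wnorm_mono v0 f vs ltr01 s1).
  rewrite wnormE invr1 powRr1; last first.
    by apply: sumr_ge0 => x _; rewrite mulr_ge0 ?powR_ge0.
  apply: le_trans (ler_norm_sum _ _ _) _; apply: ler_sum => x _.
  by rewrite normrM ger0_norm// powRr1.
have cst : wnorm vm s (fun=> - wsum vm f) = `|wsum vm f|.
  by rewrite wnormN (wnorm1 _ _ vs)// gt_eqF.
have [s1'|s1'] := ltP 1 s.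
  have := minkowski_wnorm v0 f (fun=> - wsum vm f) s1'; lra.
have -> : s = 1 by lra.
have se : s = 1 by lra.
rewrite se in mean_le cst *.
have e1 g : wnorm vm 1 g = \sum_x vm x * `|g x|.
  rewrite wnormE invr1 powRr1; last first.
    by apply: sumr_ge0 => x _; rewrite mulr_ge0 ?powR_ge0.
  by apply: eq_bigr => x _; rewrite powRr1.
have : wnorm vm 1 (fun x => f x - wsum vm f) <= wnorm vm 1 f + wnorm vm 1 (fun=> - wsum vm f).
  rewrite !e1 -big_split/=; apply: ler_sum => x _; rewrite -mulrDr.
  by apply: ler_wpM2l => //; exact: ler_normD.
lra.
Qed.

(** The derivative F along the cycle is cut at height t into G, bounded by t, and H. After removal
    of the means, at the cost of a factor 2, both have primitives a and b with u = a + b. G is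
    measured in L^P and a by its gradient; H is measured in L^1 and b by the Sobolev inequality. The
    height is chosen so that both contributions are of order eps^th, a balance expressed by the
    equation for [th]. *)
Lemma cutoff_smoothing (C c2 B eps P s th : R) (Phi : (V -> R) -> R) u :
  0 < eps <= 1 -> 1 < s -> s <= P -> 0 <= C -> 0 <= c2 -> 0 <= B -> 0 <= th ->
  1 - th / (s - 1) * (1 - s / P) = th ->
  (forall u L, (forall a, L <= wnorm vm P (fun x => u x - a)) ->
    L <= B * wnorm em 1 (ediff u)) ->
  (forall f h, Phi (fun x => f x + h x) <= Phi f + Phi h) ->
  (forall f a, Phi (fun x => f x - a) = Phi f) ->
  (forall f, Phi f <= C * eps * wnorm em P (ediff f)) ->
  (forall f, Phi f <= c2 * wnorm vm P f) ->
  Phi u <= (2 * C + 2 * c2 * B) * eps `^ th * wnorm em s (ediff u).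
Proof.
move=> /andP[e0 e1] s1 sP C0 c20 B0 th0 thE sob PhiD Phisub Phi1 Phi2.
have s0 : 0 < s by lra. have P1 : 1 < P by lra. have P0 : 0 < P by lra.
have v0 := @vmeasure_ge0 R V; have vs := vmeasure_sum1 R V_gt0.
pose F x := u (next x) - u x.
rewrite (enorm_cycle _ (lt0r_neq0 s0)) -/F; set A := wnorm vm s F.
have A0 : 0 <= A by exact: wnorm_ge0.
have F0 : \sum_x F x = 0 by rewrite sumrB sum_next subrr.
pose t := eps `^ (- (th / (s - 1))) * A.
have t0 : 0 <= t by rewrite mulr_ge0 ?powR_ge0.
pose G x := if `|F x| <= t then F x else 0.
pose H x := if `|F x| <= t then 0 else F x.
have FGH x : F x = G x + H x by rewrite /G /H; case: ifP; rewrite ?addr0 ?add0r.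
have As : A `^ s = \sum_x vm x * `|F x| `^ s.
  exact: (wnorm_powR v0 F (lt0r_neq0 s0)).
have GP : wnorm vm P G <= t `^ (1 - s / P) * A `^ (s / P).
  apply: (@ler_powR_root _ _ _ P) => //; rewrite ?wnorm_ge0 ?mulr_ge0 ?powR_ge0//.
  rewrite (wnorm_powR v0 G (lt0r_neq0 P0)) powRM ?powR_ge0// -!powRrM.
  have -> : (1 - s / P) * P = P - s by rewrite mulrBl mul1r divfK// gt_eqF.
  rewrite divfK ?gt_eqF// As mulr_sumr; apply: ler_sum => x _.
  rewrite mulrCA; apply: ler_wpM2l => //; rewrite /G; case: ifP => [Ft|_]; last first.
    by rewrite normr0 powR0 ?gt_eqF// mulr_ge0 ?powR_ge0.
  have -> : `|F x| `^ P = `|F x| `^ (P - s) * `|F x| `^ s.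
    by rewrite -powRD ?subrK// (gt_eqF P0).
  by apply: ler_wpM2r; [exact: powR_ge0|apply: powR_leq => //; rewrite subr_ge0].
have H1 : wnorm vm 1 H <= t `^ (1 - s) * A `^ s.
  rewrite wnormE invr1 powRr1; last first.
    by apply: sumr_ge0 => x _; rewrite mulr_ge0 ?powR_ge0.
  rewrite As mulr_sumr; apply: ler_sum => x _.
  rewrite mulrCA; apply: ler_wpM2l => //; rewrite /H powRr1//; case: ifP => [_|Ft].
    by rewrite normr0 mulr_ge0 ?powR_ge0.
  have {}Ft : t < `|F x| by rewrite ltNge Ft.
  have Fp : 0 < `|F x| by exact: le_lt_trans Ft.
  have tp : 0 < t.
    rewrite lt_neqAle t0 andbT eq_sym mulf_eq0 gt_eqF ?powR_gt0//=.
    apply/negP => /eqP Az; have := wnorm_eq0 v0 s0 Az; move=> /(_ x) Fx0; move: Fp.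
    rewrite Fx0 ?normr0 ?ltxx// /vmeasure invr_eq0 pnatr_eq0 -lt0n//.
  have Fs : `|F x| = `|F x| `^ (1 - s) * `|F x| `^ s.
    by rewrite -powRD ?subrK ?powRr1// oner_eq0.
  rewrite [leLHS]Fs; apply: ler_wpM2r; first exact: powR_ge0.
  rewrite -opprB !powRN lef_pV2 ?posrE ?powR_gt0//.
  by apply: powR_leq => //; [rewrite subr_ge0 ltW|exact: ltW].
have [a ha] : exists a, forall x, a (next x) - a x = G x - wsum vm G.
  apply: cycle_primitive; rewrite sumrB sumr_const wsum_vmeasure -[_ *+ _]mulr_natl.
  by rewrite mulrA divff ?mul1r ?subrr// pnatr_eq0 -lt0n.
pose b x := u x - a x.
have hb x : b (next x) - b x = H x - wsum vm H.
  have : wsum vm G + wsum vm H = 0.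
    by rewrite !wsum_vmeasure -mulrDr -big_split/= -(eq_bigr _ (fun x _ => FGH x)) F0 mulr0.
  by have := ha x; have := FGH x; rewrite /b /F; lra.
have Phia : Phi a <= C * eps * (2 * wnorm vm P G).
  apply: le_trans (Phi1 _) _; apply: ler_wpM2l; first by rewrite mulr_ge0// ltW.
  rewrite (enorm_cycle _ (lt0r_neq0 P0)).
  have -> : wnorm vm P (fun x => a (next x) - a x) = wnorm vm P (fun x => G x - wsum vm G).
    by apply: wnorm_eq => x _; rewrite ha.
  by apply: norm_sub_mean_le; exact: ltW.
have Phib : Phi b <= c2 * (B * (2 * wnorm vm 1 H)).
  have [c2p|c2p] := ltP 0 c2; last first.
    have -> : c2 = 0 by lra.
    by rewrite mul0r; apply: le_trans (Phi2 _) _; have -> : c2 = 0 by [lra]; rewrite mul0r.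
  rewrite -ler_pdivrMl//.
  have : c2^-1 * Phi b <= B * wnorm em 1 (ediff b).
    by apply: sob => z; rewrite ler_pdivrMl// -(Phisub b z).
  move=> /le_trans; apply; apply: ler_wpM2l => //.
  rewrite (enorm_cycle _ (oner_neq0 _)).
  have -> : wnorm vm 1 (fun x => b (next x) - b x) = wnorm vm 1 (fun x => H x - wsum vm H).
    by apply: wnorm_eq => x _; rewrite hb.
  exact: norm_sub_mean_le.
have k0 : 0 <= eps `^ (- (th / (s - 1))) by exact: powR_ge0.
have split_powR r : A `^ (1 - r) * A `^ r = A.
  by rewrite -powRD ?subrK ?powRr1// oner_eq0.
have tG : eps * (t `^ (1 - s / P) * A `^ (s / P)) = eps `^ th * A.
  rewrite (powRM _ k0 A0) -[_ * _ * A `^ _]mulrA split_powR mulrA -powRrM.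
  by rewrite -[X in X * _ * A](powRr1 (ltW e0)) -powRD ?(gt_eqF e0) ?implybT// mulNr thE.
have tH : t `^ (1 - s) * A `^ s = eps `^ th * A.
  rewrite (powRM _ k0 A0) -mulrA split_powR -powRrM; congr (_ `^ _ * _).
  by field; rewrite subr_eq0 gt_eqF.
have -> : u = fun x => a x + b x by apply/funext => x; rewrite /b addrC subrK.
apply: le_trans (PhiD _ _) _.
have X1 : eps * wnorm vm P G <= eps `^ th * A.
  by rewrite -tG; apply: ler_wpM2l => //; exact: ltW.
have X2 : wnorm vm 1 H <= eps `^ th * A by rewrite -tH.
have := ler_wpM2l C0 X1; have := ler_wpM2l (mulr_ge0 c20 B0) X2; lra.
Qed.
End CycleGraph.

(* Counterclockwise successor and position along the square |(a, b)|_oo = n,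
   starting from the corner (-n, -n). *)
Definition square_next (n : nat) (p : int * int) : int * int :=
  let: (a, b) := p in
  if (b == - n%:Z) && (a < n%:Z) then (a + 1, b)
  else if (a == n%:Z) && (b < n%:Z) then (a, b + 1)
  else if (b == n%:Z) && (- n%:Z < a) then (a - 1, b) else (a, b - 1).

Definition square_pos (n : nat) (p : int * int) : nat :=
  let: (a, b) := p in
  if (b == - n%:Z) && (a < n%:Z) then `|(a + n%:Z)%R|%N
  else if (a == n%:Z) && (b < n%:Z) then `|(b + (3 * n)%N%:Z)%R|%N
  else if (b == n%:Z) && (- n%:Z < a) then `|((5 * n)%N%:Z - a)%R|%N else `|((7 * n)%N%:Z - b)%R|%N.

Arguments square_next : simpl never.
Arguments square_pos : simpl never.

Definition square (n : nat) (p : int * int) : bool :=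
  [&& `|p.1| <= n, `|p.2| <= n & (`|p.1| == n) || (`|p.2| == n)]%N.

(** * The boundary of a square as a cycle *)

Section Square.
Variable n : nat.
Hypothesis n_gt0 : (0 < n)%N.
Implicit Types (p q : int * int).

(** Each side contains its first corner but not its last, so the sides partition the square and
    positions run from 0 to 8n - 1. *)
Variant square_spec p : Prop :=
| SquareBottom of p.2 = - n%:Z & - n%:Z <= p.1 & p.1 < n%:Z &
    (square_pos n p)%:Z = p.1 + n%:Z & square_next n p = (p.1 + 1, p.2)
| SquareRight of p.1 = n%:Z & - n%:Z <= p.2 & p.2 < n%:Z &
    (square_pos n p)%:Z = p.2 + 3 * n%:Z & square_next n p = (p.1, p.2 + 1)
| SquareTop of p.2 = n%:Z & - n%:Z < p.1 & p.1 <= n%:Z &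
    (square_pos n p)%:Z = 5 * n%:Z - p.1 & square_next n p = (p.1 - 1, p.2)
| SquareLeft of p.1 = - n%:Z & - n%:Z < p.2 & p.2 <= n%:Z &
    (square_pos n p)%:Z = 7 * n%:Z - p.2 & square_next n p = (p.1, p.2 - 1).

Lemma squareP p : square n p -> square_spec p.
Proof.
case: p => a b; rewrite /square /= => sq.
have [/andP[h1 h2]|h1] := boolP ((b == - n%:Z) && (a < n%:Z)).
  by apply: SquareBottom; rewrite /square_pos /square_next /= ?h1 ?h2 /= //; lia.
have [/andP[h2 h3]|h2] := boolP ((a == n%:Z) && (b < n%:Z)).
  by apply: SquareRight; rewrite /square_pos /square_next /= ?(negbTE h1) ?h2 ?h3 /= //; lia.
have [/andP[h3 h4]|h3] := boolP ((b == n%:Z) && (- n%:Z < a)).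
  apply: SquareTop; rewrite /square_pos /square_next /= ?(negbTE h1) ?(negbTE h2) ?h3 ?h4 /= //; lia.
apply: SquareLeft; rewrite /square_pos /square_next /= ?(negbTE h1) ?(negbTE h2) ?(negbTE h3) /= //;
  lia.
Qed.

Lemma square_next_mem p : square n p -> square n (square_next n p).
Proof. by case/squareP => h1 h2 h3 _ ->; rewrite /square /=; lia. Qed.

Lemma square_pos_inj p q : square n p -> square n q ->
  square_pos n p = square_pos n q -> p = q.
Proof.
case: p q => a b [a' b'] /squareP sp /squareP sq h.
have [-> ->] : a = a' /\ b = b'; last by [].
by case: sp => /= ? ? ? k _; case: sq => /= ? ? ? k' _; lia.
Qed.

Lemma square_pos_next p : square n p ->
  (square_pos n (square_next n p) == (square_pos n p).+1) ||
  ((square_pos n (square_next n p) == 0)%N && ((square_pos n p).+1 == 8 * n)%N).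
Proof.
move=> sp; have /squareP sq := square_next_mem sp.
by case/squareP: sp => /= ? ? ? k nx; rewrite nx in sq *;
  case: sq => /= ? ? ? k' _; lia.
Qed.

Lemma square_pos_lt p : square n p -> (square_pos n p < 8 * n)%N.
Proof. by case/squareP => /= ? ? ? k _; lia. Qed.

Lemma square_next2 p : square n p -> square_next n (square_next n p) != p.
Proof.
move=> sp; have /squareP sq := square_next_mem sp; apply/eqP.
case: p sp sq => a b /squareP[] /= ? ? ? k nx; rewrite nx => -[] /= ? ? ? k' ->;
  case; lia.
Qed.

Lemma square_next_inj p q : square n p -> square n q ->
  square_next n p = square_next n q -> p = q.
Proof.
move=> sp sq h; apply: square_pos_inj => //.
have := square_pos_next sp; have := square_pos_next sq; rewrite h.
move: (square_pos n p) (square_pos n q) (square_pos n _) => a b c; lia.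
Qed.

Lemma square_adjacent p q : square n p -> square n q ->
  ((`|(p.1 - q.1)%R| == 1)%N && (p.2 == q.2)) || ((p.1 == q.1) && (`|(p.2 - q.2)%R| == 1)%N)
  = (q == square_next n p) || (p == square_next n q).
Proof.
case: p q => a b [a' b'] /squareP sp /squareP sq.
by case: sp => /= ? ? ? _ ->; case: sq => /= ? ? ? _ ->; rewrite !xpair_eqE; lia.
Qed.
End Square.

(** * Transfer of the cycle structure to [bdry 2 n] *)

Section SquareBoundary.
Variables (R : realType) (n : nat).
Hypothesis n_gt0 : (0 < n)%N.
Notation X := (bdry 2 n).
Notation e := (@bdry_rel 2 n).
Notation vm := (@vmeasure R X).
Notation em := (@emeasure R X e).
Implicit Types (x y : X).

Definition coords (v : Zd 2) : int * int := (v 0 0, v 0 1).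

Definition of_coords (p : int * int) : Zd 2 := \row_j (if j == 0 then p.1 else p.2).

Lemma of_coordsK : cancel of_coords coords.
Proof. by case=> a b; rewrite /coords !mxE. Qed.

Lemma ord2_case (j : 'I_2) : j = 0 \/ j = 1.
Proof. by case: j => [[|[|//]] h]; [left|right]; apply: val_inj. Qed.

Lemma coordsK : cancel coords of_coords.
Proof. by move=> v; apply/rowP => j; rewrite !mxE; case: (ord2_case j) => ->. Qed.

Lemma square_bdry (v : Zd 2) : (v \in X) = square n (coords v).
Proof.
apply/(bdryP n (ltn0Sn 1))/idP.
  case=> le [k hk]; rewrite /square /= !le /=.
  by case: (ord2_case k) hk => -> ->; rewrite eqxx ?orbT.
case/and3P => /= h1 h2 h3; split=> [i|]; first by case: (ord2_case i) => ->.
by case/orP: h3 => /eqP h; [exists 0|exists 1].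
Qed.

Lemma adjacent_coords (v v' : Zd 2) : adjacent v v' =
  ((`|((coords v).1 - (coords v').1)%R| == 1)%N && ((coords v).2 == (coords v').2)) ||
  (((coords v).1 == (coords v').1) && (`|((coords v).2 - (coords v').2)%R| == 1)%N).
Proof.
apply/idP/idP => [/adjacentP[i hi hj]|].
  case: (ord2_case i) hi hj => -> hi hj.
    by rewrite /= hi (hj 1)// !eqxx.
  by rewrite /= hi (hj 0)// !eqxx orbT.
case/orP => /andP[/eqP h1 /eqP h2]; [apply: (@adjacentI _ _ _ 0)|apply: (@adjacentI _ _ _ 1)] => //;
  by move=> j; case: (ord2_case j) => ->.
Qed.

Lemma coords_mem x : square n (coords (val x)).
Proof. by rewrite -square_bdry fsvalP. Qed.

Definition bdry_next x : X := insubd x (of_coords (square_next n (coords (val x)))).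

Lemma coords_next x : coords (val (bdry_next x)) = square_next n (coords (val x)).
Proof.
rewrite val_insubd square_bdry of_coordsK square_next_mem ?coords_mem//.
exact: of_coordsK.
Qed.

Definition bdry_pos x : nat := square_pos n (coords (val x)).

Lemma coords_val_inj x y : coords (val x) = coords (val y) -> x = y.
Proof. by move=> /(can_inj coordsK) /val_inj. Qed.

Lemma bdry_next_inj : injective bdry_next.
Proof.
move=> x y h; apply: coords_val_inj.
apply: (square_next_inj n_gt0 (coords_mem x) (coords_mem y)).
by rewrite -!coords_next h.
Qed.

Lemma bdry_next2 x : bdry_next (bdry_next x) != x.
Proof.
apply/eqP => h; have := square_next2 n_gt0 (coords_mem x).
by rewrite -!coords_next h eqxx.
Qed.

Lemma bdry_rel_next x y : bdry_rel x y = (y == bdry_next x) || (x == bdry_next y).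
Proof.
rewrite /bdry_rel adjacent_coords (square_adjacent n_gt0 (coords_mem x) (coords_mem y)).
have eqc z t : (coords (val z) == square_next n (coords (val t))) = (z == bdry_next t).
  rewrite -coords_next; apply/eqP/eqP => [/coords_val_inj//|-> //].
by rewrite !eqc.
Qed.

Lemma bdry_pos_inj : injective bdry_pos.
Proof.
move=> x y h; apply: coords_val_inj.
exact: (square_pos_inj n_gt0 (coords_mem x) (coords_mem y) h).
Qed.

Lemma bdry_pos_next x : bdry_pos (bdry_next x) = (bdry_pos x).+1 \/
  bdry_pos (bdry_next x) = 0%N /\ forall y, (bdry_pos y <= bdry_pos x)%N.
Proof.
rewrite /bdry_pos coords_next.
case/orP: (square_pos_next n_gt0 (coords_mem x)) => [/eqP ->|/andP[/eqP -> /eqP h]]; first by left.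
right; split=> // y; rewrite -ltnS h.
exact: square_pos_lt (coords_mem y).
Qed.

(** Opposite values on the two halves of the cycle, exchanged by the antipode: the distance to every
    constant is at least 1, while the function changes at two steps only. *)
Definition half_test x : R := if (bdry_pos x < 4 * n)%N then 1 else -1.

Definition antipode x : X := insubd x (of_coords (- (coords (val x)).1, - (coords (val x)).2)).

Lemma coords_antipode x :
  coords (val (antipode x)) = (- (coords (val x)).1, - (coords (val x)).2).
Proof.
rewrite val_insubd square_bdry of_coordsK ifT ?of_coordsK//.
have := coords_mem x; rewrite /square /=; lia.
Qed.

Lemma half_test_antipode x : half_test (antipode x) = - half_test x.
Proof.
suff h : (bdry_pos (antipode x) < 4 * n)%N = ~~ (bdry_pos x < 4 * n)%N.
  by rewrite /half_test h; case: (_ < _)%N; rewrite ?opprK.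
have sx := coords_mem x; have sa := coords_mem (antipode x).
rewrite /bdry_pos; move: sa; rewrite coords_antipode.
case: (coords (val x)) sx => a b sx sa.
case/(squareP n_gt0): sx => /= ? ? ? k _; case/(squareP n_gt0): sa => /= ? ? ? k' _; lia.
Qed.

Lemma half_test_grad : \sum_x `|half_test (bdry_next x) - half_test x| <= 4.
Proof.
pose at_pos k x : R := (bdry_pos x == k)%:R.
have at_le k : \sum_x at_pos k x <= 1.
  have [x0 hx0|none] := pickP (fun x => bdry_pos x == k).
    rewrite (bigD1 x0)//= big1 ?addr0 => [|x xx0]; first by rewrite /at_pos hx0.
    by rewrite /at_pos -(eqP hx0) (inj_eq bdry_pos_inj) (negbTE xx0).
  by rewrite big1// => x _; rewrite /at_pos none.
have le x : `|half_test (bdry_next x) - half_test x|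
    <= 2 * at_pos (4 * n).-1 x + 2 * at_pos (8 * n).-1 x.
  rewrite /half_test /at_pos /bdry_pos coords_next.
  have lt := square_pos_lt n_gt0 (coords_mem x).
  case/orP: (square_pos_next n_gt0 (coords_mem x)) => [/eqP ->|/andP[/eqP -> /eqP h]].
    case: (ltnP (square_pos n (coords (val x))).+1 (4 * n)) => h1.
      have h2 : (square_pos n (coords (val x)) < 4 * n)%N by lia.
      by rewrite h2 subrr normr0 addr_ge0 ?mulr_ge0.
    case: (ltnP (square_pos n (coords (val x))) (4 * n)) => h2.
      have -> : (square_pos n (coords (val x)) == (4 * n).-1) by lia.
      have -> : `|- 1 - 1| = 2 :> R by rewrite -opprD normrN ger0_norm//; lra.
      by rewrite mulr1 lerDl mulr_ge0.
    by rewrite subrr normr0 addr_ge0 ?mulr_ge0.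
  have -> : (square_pos n (coords (val x)) == (8 * n).-1) by lia.
  have -> : (square_pos n (coords (val x)) < 4 * n)%N = false by lia.
  have -> : (0 < 4 * n)%N by lia.
  have -> : `|1 - - 1| = 2 :> R by rewrite opprK ger0_norm//; lra.
  by rewrite mulr1 lerDr mulr_ge0.
apply: le_trans (ler_sum _ (fun x _ => le x)) _.
rewrite big_split/= -!mulr_sumr.
by have := at_le (4 * n).-1; have := at_le (8 * n).-1; lra.
Qed.
End SquareBoundary.

(** This and [smoothing_exponent] are [alpha] and [theta] in terms of 1/p and 1/q, so that infinite
    exponents become the value 0. *)
Definition sobolev_exponent (R : realType) (d : nat) (r : R) : R :=
  if (2 < d)%N then ((1 - r) / 2 + d.-1%:R^-1)^-1 else 1.

Definition smoothing_exponent (R : realType) (d : nat) (i j : R) : R :=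
  if (2 < d)%N then 1 - d.-1%:R * (i + j) / 2 else (1 - j) / (1 + i).

Definition boundary_sobolev (R : realType) (d n : nat) (c r : R) :=
  forall (u : bdry d n -> R) (L : R),
    (forall a, L <= wnorm (@vmeasure R (bdry d n)) (2 / (1 - r)) (fun x => u x - a)) ->
    L <= c * n%:R * wnorm (@emeasure R (bdry d n) (@bdry_rel d n)) (sobolev_exponent d r) (ediff u).

(** * Smoothing on the boundary for d = 2 *)

Section SquareSmoothing.
Variables (R : realType) (n : nat) (c r0 : R).
Hypothesis n_gt0 : (0 < n)%N.
Hypothesis c_gt0 : 0 < c.
Notation X := (bdry 2 n).
Notation e := (@bdry_rel 2 n).
Notation em := (@emeasure R X (@bdry_rel 2 n)).
Notation vm := (@vmeasure R X).
Hypothesis r0_lt1 : 0 <= r0 < 1.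
Hypothesis sob0 : boundary_sobolev 2 n c r0.

Let X_gt0 : (0 < #|{: X}|)%N := card_bdry_gt0 (ltnSn 1) n_gt0.
Let enorm := @enorm_cycle R X e _ X_gt0 (bdry_next_inj n_gt0) (bdry_next2 n_gt0)
  (bdry_rel_next n_gt0).

Lemma half_test_dist P a : 1 <= P -> 1 <= wnorm vm P (fun x => half_test R x - a).
Proof.
move=> P1; have P0 : 0 < P by lra.
apply: (@ler_powR_root _ _ _ P) => //; first exact: wnorm_ge0.
rewrite powR1 vnorm_powR ?gt_eqF//.
set N := #|{: X}|%:R; have N0 : 0 < N :> R by rewrite ltr0n.
rewrite ler_pdivlMl// mulr1.
have anti : \sum_(x : X) `|half_test R x - a| `^ P = \sum_(x : X) `|half_test R x + a| `^ P.
  have antipode_inv : involutive (@antipode n).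
    move=> x; apply: coords_val_inj; rewrite !coords_antipode//.
    by case: (coords (val x)) => b b' /=; rewrite !opprK.
  rewrite (reindex_inj (inv_inj antipode_inv))/=; apply: eq_bigr => x _.
  by rewrite half_test_antipode// -opprD normrN.
suff : N * 2 <= \sum_(x : X) (`|half_test R x - a| `^ P + `|half_test R x + a| `^ P).
  by rewrite big_split/= -anti; lra.
have -> : N * 2 = \sum_(x : X) 2 by rewrite sumr_const mulr_natl.
apply: ler_sum => x _.
have := powR_half_convex P1 (normr_ge0 (half_test R x - a)) (normr_ge0 (half_test R x + a)).
suff : 1 <= ((`|half_test R x - a| + `|half_test R x + a|) / 2) `^ P by lra.
apply: powR_ge1; last by lra.
rewrite ler_pdivlMr// mul1r; have := ler_normD (half_test R x - a) (half_test R x + a).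
have -> : half_test R x - a + (half_test R x + a) = half_test R x *+ 2 by rewrite mulr2n; ring.
rewrite normrMn; have -> : `|half_test R x| = 1.
  by rewrite /half_test; case: ifP => _; rewrite ?normrN normr1.
lra.
Qed.

(** The Sobolev exponent is 1, and [half_test] has total variation at most 4 over at least 8n
    vertices, so 1 <= 4 c n / (8 n). *)
Lemma square_conductance_ge2 : 2 <= c.
Proof.
have /andP[ra rb] := r0_lt1.
have P1 : 1 <= 2 / (1 - r0) by rewrite ler_pdivlMr; lra.
have := sob0 (fun a => half_test_dist a P1).
rewrite /sobolev_exponent/= (enorm _ (oner_neq0 _)).
pose N : R := #|{: X}|%:R; have N0 : 0 < N by rewrite ltr0n.
rewrite wnormE invr1 powRr1; last first.
  by apply: sumr_ge0 => x _; rewrite mulr_ge0 ?powR_ge0 ?vmeasure_ge0.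
under eq_bigr do rewrite powRr1//.
rewrite -mulr_sumr /vmeasure -/N mulrA => h.
have N8 : 8 * n%:R <= N.
  by have := @card_bdry_ge 2 n isT n_gt0; rewrite -(ler_nat R) cardfE expn1 -mul2n !natrM; lra.
have : 1 <= c * n%:R * N^-1 * 4.
  apply: (le_trans h); apply: ler_wpM2l; last exact: half_test_grad.
  by rewrite !mulr_ge0 ?invr_ge0// ltW.
have -> : c * n%:R * N^-1 * 4 = c * n%:R * 4 / N by ring.
rewrite ler_pdivlMr// mul1r => h2.
have nR : 0 < n%:R :> R by rewrite ltr0n.
have : 8 * n%:R <= c * 4 * n%:R by lra.
by rewrite ler_pM2r//; lra.
Qed.

Lemma square_smoothing eps i j Phi u : 0 < eps < 1 -> 0 <= i < 1 -> 0 <= j < 1 ->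
  boundary_sobolev 2 n c i -> smoothing_seminorm c eps i Phi ->
  Phi u <= 4 * c ^+ 2 * n%:R * eps `^ ((1 - j) / (1 + i)) * wnorm em (2 / (1 + j)) (ediff u).
Proof.
move=> /andP[e0 e1] i01 j01 sob sem; have [PhiD Phi1 Phi2] := sem.
have /andP[i0 i1] := i01; have /andP[j0 j1] := j01.
have c2 := square_conductance_ge2.
have e01 : 0 < eps <= 1 by rewrite e0 ltW.
have s1 : 1 < 2 / (1 + j) by rewrite ltr_pdivlMr; lra.
have sP : 2 / (1 + j) <= 2 / (1 - i) by rewrite ler_pM2l// lef_pV2 ?posrE; lra.
have cn0 : 0 <= c * n%:R by rewrite mulr_ge0// ltW.
have c1 : 0 <= 1 + c by lra.
have th0 : 0 <= (1 - j) / (1 + i) by rewrite divr_ge0; lra.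
have thE : 1 - (1 - j) / (1 + i) / (2 / (1 + j) - 1) * (1 - 2 / (1 + j) / (2 / (1 - i)))
    = (1 - j) / (1 + i).
  have -> : 2 / (1 + j) - 1 = (1 - j) / (1 + j) by field; rewrite gt_eqF; lra.
  by field; rewrite !gt_eqF; lra.
have := cutoff_smoothing X_gt0 (bdry_next_inj n_gt0) (bdry_next2 n_gt0)
  (bdry_rel_next n_gt0) (@bdry_pos_inj n n_gt0) (bdry_pos_next n_gt0) u e01 s1 sP cn0 c1 cn0
  th0 thE sob PhiD (fun f a => smoothing_seminorm_sub f a i01 sem) Phi1 Phi2.
move=> /le_trans; apply; apply: ler_wpM2r; first exact: wnorm_ge0.
apply: ler_wpM2r; first exact: powR_ge0.
(* Since c >= 2, 4 c + 2 c^2 is at most 4 c^2. *)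
have -> : 2 * (c * n%:R) + 2 * (1 + c) * (c * n%:R) = (4 * c + 2 * c ^+ 2) * n%:R by ring.
by apply: ler_wpM2r => //; nra.
Qed.
End SquareSmoothing.

(** * Smoothing on the boundary in all dimensions *)

Section BoundarySmoothingBounds.
Variables (R : realType) (d n : nat) (c r0 : R).
Hypothesis d_gt1 : (1 < d)%N.
Hypothesis n_gt0 : (0 < n)%N.
Hypothesis c_gt1 : 1 < c.
Notation X := (bdry d n).
Notation em := (@emeasure R X (@bdry_rel d n)).
Hypothesis r0_lt1 : 0 <= r0 < 1.
Hypothesis sob0 : boundary_sobolev d n c r0.
Hypothesis card_le : #|` X|%:R <= c * #|` tbdry d n|%:R.

(** [K] is for two different exponents. With equal exponents the constant [q] is controlled only
    together with the factors that it meets in case (ii), and their product is at most [Psi]. *)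
Lemma boundary_smoothing : exists K Psi : R,
  [/\ 0 < K, K * (c ^+ 3 + c ^+ 6) <= 8 * c ^+ 8, K * c ^+ 4 + Psi * c ^+ 8 <= 8 * c ^+ 8,
  forall eps i j Phi, 0 < eps < 1 -> 0 <= i < 1 -> 0 <= j < 1 -> i + j <= 2 / d.-1%:R ->
    boundary_sobolev d n c i -> boundary_sobolev d n c j ->
    @smoothing_seminorm R d n c eps i Phi ->
    forall u, Phi u <= K * c ^+ 2 * n%:R * eps `^ smoothing_exponent d i j
      * wnorm em (2 / (1 + j)) (ediff u) &
  forall r, 0 <= r < 1 -> r + r <= 2 / d.-1%:R -> boundary_sobolev d n c r ->
    exists k nu q, [/\ 0 < k <= 1, 0 <= nu /\ 0 <= q, centering k nu (2 / (1 + r)),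
      k^-1 `^ ((1 + r) / 2) * c `^ (- r) * q <= Psi &
      forall eps Phi u, 0 < eps < 1 -> @smoothing_seminorm R d n c eps r Phi ->
        Phi u <= q * c ^+ 2 * n%:R * eps `^ smoothing_exponent d r r
          * wnorm em (2 / (1 + r)) (ediff u)]].
Proof.
have c0 : 0 < c by apply: lt_trans c_gt1.
have DR : 0 < d.-1%:R :> R by rewrite ltr0n; lia.
have [d2|d2] := ltnP 2 d.
  have toD r : boundary_sobolev d n c r -> sobolev_inequality (@bdry_rel d n) d.-1 (c * n%:R) r.
    by move=> h u L /h; rewrite /sobolev_exponent d2.
  have [K [Psi [K0 hK hPsi crude fine]]] := bdry_smoothing d2 n_gt0 c_gt1 r0_lt1 (toD _ sob0) card_le.
  exists K, Psi; split=> //.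
    move=> eps i j Phi he hi hj ij si sj sem u; rewrite /smoothing_exponent d2.
    apply: crude => //; [|exact: toD|exact: toD].
    by move: ij; rewrite ler_pdivlMr//; lra.
  move=> r hr rr sr.
  have Dr : d.-1%:R * r <= 1 by move: rr; rewrite ler_pdivlMr//; lra.
  have [k [nu [q [k01 nuq cent hq fn]]]] := fine r hr Dr (toD _ sr).
  exists k, nu, q; split=> // eps Phi u he sem; rewrite /smoothing_exponent d2.
  have -> : d.-1%:R * (r + r) / 2 = d.-1%:R * r by field.
  exact: fn.
have de : d = 2%N by lia.
move: sob0 card_le; rewrite de => sob card; clear DR.
have c2 : 2 <= c := square_conductance_ge2 n_gt0 c0 r0_lt1 sob.
(* 17/3 is 4 times 17/12, and 17/12 bounds the square root of 2. *)
exists 4, (17 / 3).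
have [|||||h1 h2] := @conductance_powers _ c 2 4 (17 / 3) => //; try lra.
split=> //.
  move=> eps i j Phi he hi hj _ si _ sem u.
  exact: (square_smoothing n_gt0 c0 hi si u he hi hj si sem).
move=> r hr _ sr; have /andP[ra rb] := hr.
exists 2^-1, (2 / (1 + r) / 2), 4; split.
- by lra.
- by split=> //; rewrite !divr_ge0//; lra.
- by apply: centering_half; rewrite ler_pdivlMr ?ler_pdivrMr; lra.
- rewrite invrK; have -> : (1 + r) / 2 = 2^-1 + 2^-1 * r by field.
  have ic0 : 0 <= c^-1 by rewrite invr_ge0 ltW.
  rewrite powRD; last by apply/implyP => _; rewrite gt_eqF.
  rewrite powRrM -[_ * _ * c `^ _]mulrA powRN -(powRV _ (ltW c0)) -(powRM _ (powR_ge0 _ _) ic0).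
  have sq : 2 `^ 2^-1 <= 17 / 12 :> R.
    apply: (@ler_powR_root _ _ _ 2); rewrite ?powR_ge0//; try lra.
    by rewrite powRVK ?pnatr_eq0// powR_mulrn; lra.
  have : (2 `^ 2^-1 / c) `^ r <= 1.
    apply: powR_le1 => //; rewrite divr_ge0 ?powR_ge0 ?(ltW c0)//= ler_pdivrMr//; lra.
  have := powR_ge0 (2 : R) 2^-1; have := powR_ge0 (2 `^ 2^-1 / c) r.
  nra.
move=> eps Phi u he sem.
exact: (square_smoothing n_gt0 c0 hr sr u he hr hr sr sem).
Qed.
End BoundarySmoothingBounds.

(** * Exponents, normal edges and boundary operators *)

Section Exponents.
Variable R : realType.
Implicit Types p q : \bar R.

Lemma einv_bounds p : (1 < p)%E -> 0 <= einv p < 1.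
Proof.
case: p => [r| |]//=; last by rewrite lexx ltr01.
rewrite lte_fin => r1; rewrite invr_ge0 invf_lt1; lra.
Qed.

Lemma over_p1E p : (1 < p)%E -> 2 * over_p1 p = 2 / (1 + einv p).
Proof.
case: p => [r| |]//=; last by rewrite addr0 invr1.
rewrite lte_fin => r1; field; rewrite ?gt_eqF//; lra.
Qed.

Lemma over_m1E p : (1 < p)%E -> 2 * over_m1 p = 2 / (1 - einv p).
Proof.
case: p => [r| |]//=; last by rewrite subr0 invr1.
rewrite lte_fin => r1; field; rewrite ?gt_eqF//; lra.
Qed.

Lemma einv_le p q : (1 < p)%E -> (p <= q)%E -> einv q <= einv p.
Proof.
case: p => [r| |]//; case: q => [s| |]//=; rewrite ?lee_fin ?lte_fin => r1 rs.
  by rewrite lef_pV2 ?posrE//; lra.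
by rewrite invr_ge0; lra.
Qed.

Lemma alphaE d p : (0 < d)%N -> (1 < p)%E -> alpha d p = sobolev_exponent d (einv p).
Proof.
move=> d0 p1; rewrite /alpha /sobolev_exponent; case: ifP => // _.
by rewrite over_m1E// invf_div -subn1 natrB.
Qed.

Lemma thetaE d p q : (0 < d)%N -> theta d p q = smoothing_exponent d (einv p) (einv q).
Proof.
move=> d0; rewrite /theta /smoothing_exponent; case: ifP => // _.
by rewrite -subn1 natrB//; field.
Qed.

(** As eps < 1, an estimate with two equal larger exponents is at least as good as one with exponent
    theta(p, q). *)
Lemma smoothing_exponent_anti d (i j i' j' : R) : 0 <= i -> 0 <= j -> i < 1 -> j' < 1 ->
  i <= i' -> j <= j' -> smoothing_exponent d i' j' <= smoothing_exponent d i j.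
Proof.
move=> i0 j0 i1 j1 ii jj; rewrite /smoothing_exponent; case: ifP => _.
  rewrite lerD2l lerN2 ler_pM2r ?invr_gt0//; apply: ler_wpM2l => //; lra.
by apply: ler_pM; rewrite ?invr_ge0 ?lef_pV2 ?posrE; lra.
Qed.
End Exponents.

Section NormalEdges.
Variables (R : realType) (d n : nat).
Notation X := (bdry d n).
Notation T := (tbdry d n).
Notation vt := (@vmeasure R T).
Notation vm := (@vmeasure R X).

Lemma tbdry_bdry (y : Zd d) : y \in T -> y \in X.
Proof. by rewrite in_fset/= => /andP[]. Qed.

Lemma tbdry_norm_le (c P : R) (f : Zd d -> R) : 0 < P -> 0 <= c -> (0 < #|{: T}|)%N ->
  #|` X|%:R <= c * #|` T|%:R ->
  wnorm vt P (fun y => f (val y)) <= c `^ P^-1 * wnorm vm P (fun x => f (val x)).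
Proof.
move=> P0 c0 T0 card.
have X0 : (0 < #|{: X}|)%N.
  by have /card_gt0P[y _] := T0; apply/card_gt0P; exists [` tbdry_bdry (fsvalP y)].
have tR : 0 < #|{: T}|%:R :> R by rewrite ltr0n.
have xR : 0 < #|{: X}|%:R :> R by rewrite ltr0n.
apply: (@ler_powR_root _ _ _ P) => //; rewrite ?mulr_ge0 ?powR_ge0 ?wnorm_ge0//.
rewrite powRM ?powR_ge0 ?wnorm_ge0// powRVK ?gt_eqF// !vnorm_powR ?gt_eqF//.
rewrite mulrA; apply: ler_pM; rewrite ?invr_ge0 ?ler0n//.
- by apply: sumr_ge0 => y _; exact: powR_ge0.
- by rewrite ler_pdivlMr// mulrC ler_pdivrMr// -!cardfE.
rewrite -(big_seq_fsetE _ T predT (fun y => `|f y| `^ P))/=.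
rewrite (@sum_fset_bij R X _ (fun x => val x \in T) (fun x => val x)) => //.
- by rewrite [leRHS](bigID (fun x : X => val x \in T))/= lerDl sumr_ge0.
- exact: val_inj.
- move=> k kt; by exists [` tbdry_bdry kt].
Qed.

Lemma homogenized_bounds (c : R) (ah : 'M[R]_d) (wh : {fset Zd d} -> R) (x y : Zd d) :
  (forall i : 'I_d, c^-1 <= ah i i <= c) ->
  (forall (x : Zd d) (i : 'I_d), wh [fset x; x + unitv i] = ah i i) ->
  adjacent x y -> c^-1 <= wh [fset x; y] <= c.
Proof.
move=> hah hwh /adjacent_stepP[i [b ->]].
have st : unitv i = step i true.
  by apply/rowP => j; rewrite !mxE; case: (j == i).
case: b; first by rewrite -st hwh.
have -> : [fset x; x + step i false] = [fset (x + step i false); (x + step i false) + unitv i].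
  rewrite fsetUC; congr ([fset _; _]).
  by apply/rowP => j; rewrite st !mxE; case: (j == i); rewrite ?addr0 ?addrNK.
by rewrite hwh.
Qed.
End NormalEdges.

Section BoundaryOperators.
Variables (R : realType) (d n : nat).
Notation X := (bdry d n).
Notation T := (tbdry d n).
Notation vt := (@vmeasure R T).
Notation vm := (@vmeasure R X).
Notation em := (@emeasure R X (@bdry_rel d n)).
Variables S M : {linear {ffun X -> R^o} -> {ffun X -> R^o}}.

Lemma ext_linear_sum (I : finType) (P : pred I) (a : I -> R) (f : I -> {ffun X -> R^o}) z :
  ext (\sum_(i | P i) a i *: f i) z = \sum_(i | P i) a i * ext (f i) z.
Proof.
rewrite /ext; case: insubP => [x _ _|_] /=; last by rewrite big1// => i _; rewrite mulr0.
by rewrite sum_ffunE; apply: eq_bigr => i _; rewrite ffunE.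
Qed.

(** [M f] depends only on [f] on [tbdry], so it expands in the images of the indicators that define
    [Sstar]. *)
Lemma Sstar_adjoint (f : {ffun X -> R^o}) (g : {ffun T -> R^o}) :
  (forall h : {ffun X -> R^o}, (forall x, x \in T -> ext h x = 0) -> M h = 0) ->
  \sum_(x : T) ext f (val x) * ext (Sstar S M g) (val x) =
  \sum_(y : T) g y * ext (S (M f)) (val y).
Proof.
move=> M0.
have Mf : M f = \sum_(x : T) ext f (val x) *: M (indic1 R X (val x)).
  apply/eqP; rewrite -subr_eq0; apply/eqP.
  rewrite -(eq_bigr _ (fun x _ => linearZ _ _)) -linear_sum -linearB; apply: M0 => z zT.
  have zX := tbdry_bdry zT.
  rewrite (ext_in _ zX) !ffunE sum_ffunE (bigD1 [` zT])//= big1 => [|x xz].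
    rewrite !ffunE eqxx/= addr0 (ext_in _ zX).
    by rewrite /GRing.scale/= mulr1 subrr.
  rewrite !ffunE/=; have -> : z == fsval x = false.
    by apply/negbTE; apply: contra xz => /eqP zx; apply/eqP/val_inj.
  by rewrite scaler0.
rewrite Mf linear_sum.
under [RHS]eq_bigr => y _.
  rewrite (eq_bigr _ (fun x _ => linearZ _ _)) ext_linear_sum mulr_sumr.
  over.
rewrite exchange_big/=; apply: eq_bigr => x _.
rewrite (ext_restr _ (fsvalP x)) big_seq_fsetE/= mulr_sumr; apply: eq_bigr => y _.
by rewrite ext_val mulrCA.
Qed.

Lemma operator_seminorm (c eps i : R) : 0 <= i < 1 ->
  (forall u : {ffun X -> R^o}, wnorm vm (2 / (1 - i)) (fun x => u x - S u x)
    <= c * eps * n%:R * wnorm em (2 / (1 - i)) (ediff u)) ->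
  (forall u : {ffun X -> R^o}, wnorm vm (2 / (1 - i)) (S u) <= c * wnorm vm (2 / (1 - i)) u) ->
  smoothing_seminorm c eps i
    (fun f : X -> R => wnorm vm (2 / (1 - i)) (fun x => f x - S [ffun y => f y] x)).
Proof.
move=> i01 close bdd; have P1 : 1 < 2 / (1 - i) by rewrite ltr_pdivlMr; lra.
have P0 : 0 <= 2 / (1 - i) by lra.
have v0 := @vmeasure_ge0 R X.
have ff (f : X -> R) : wnorm vm (2 / (1 - i)) [ffun y => f y : R^o] = wnorm vm (2 / (1 - i)) f.
  by apply: wnorm_eq => x _; rewrite ffunE.
split=> [f h|f|f].
- apply: le_trans (minkowski_wnorm v0 _ _ P1); apply: ler_wnorm => // x _.
  have -> : [ffun y => f y + h y : R^o] = [ffun y => f y] + [ffun y => h y : R^o].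
    by apply/ffunP => y; rewrite !ffunE.
  rewrite linearD ffunE le_eqVlt; apply/orP; left; apply/eqP; congr (`|_|).
  by rewrite opprD addrACA.
- have := close [ffun y => f y].
  have -> : wnorm vm (2 / (1 - i)) (fun x => [ffun y => f y : R^o] x - S [ffun y => f y] x) =
    wnorm vm (2 / (1 - i)) (fun x => f x - S [ffun y => f y] x).
    by apply: wnorm_eq => x _; rewrite ffunE.
  have -> : wnorm em (2 / (1 - i)) (ediff [ffun y => f y : R^o]) = wnorm em (2 / (1 - i)) (ediff f).
    by apply: wnorm_eq => x _; rewrite /ediff !ffunE.
  by have -> : c * eps * n%:R = c * n%:R * eps by ring.
have := minkowski_wnorm v0 f (fun x => - S [ffun y => f y] x) P1.
rewrite wnormN => /le_trans; apply.
by have := bdd [ffun y => f y]; rewrite ff; lra.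
Qed.
End BoundaryOperators.

(** * The estimates of the two forms *)

Theorem corollary6p10 (R : realType) (d : nat) (hd : (2 <= d)%N)
  (eps c : R) (heps : 0 < eps < 1) (hc : 1 < c)
  (p q : \bar R) (hp : (1 < p)%E) (hq : (1 < q)%E)
  (n : nat) (hn : (0 < n)%N)
  (w : {fset Zd d} -> R) (hw : environment w)
  (ah : 'M[R]_d) (hah_diag : is_diag_mx ah)
  (hah : forall i : 'I_d, c^-1 <= ah i i <= c)
  (wh : {fset Zd d} -> R) (hwh : environment wh)
  (hwh_ah : forall (x : Zd d) (i : 'I_d),
    wh [fset x; x + unitv i] = ah i i)
  (hcard1 : #|` bdry d n|%:R / #|` tbdry d n|%:R <= c)
  (hcard2 : #|` tbdry d n|%:R / #|` edges d n|%:R <= c / n%:R)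
  (S M : {linear {ffun bdry d n -> R^o} -> {ffun bdry d n -> R^o}})
  (hM_id : forall (f : {ffun bdry d n -> R^o}) (x : Zd d),
    x \in tbdry d n -> ext (M f) x = ext f x)
  (hS_close : forall (u : {ffun bdry d n -> R^o}) (r : \bar R),
    r \in [:: p; q] ->
    anorm (2 * over_m1 r) (bdry d n) (fun x => ext u x - ext (S u) x)
      <= c * eps * n%:R * anorm (2 * over_m1 r) (tedges d n) (grad (ext u)))
  (hS_bdd : forall (u : {ffun bdry d n -> R^o}) (r : \bar R),
    r \in [:: p; q] ->
    anorm (2 * over_m1 r) (bdry d n) (ext (S u))
      <= c * anorm (2 * over_m1 r) (bdry d n) (ext u))
  (hS_p : forall u : {ffun bdry d n -> R^o},
    anorm (2 * over_m1 p) (bdry d n) (ext (S u))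
      <= eps `^ (- ((d%:R - 1) * (2 * over_p1 p)^-1))
         * anorm 1 (bdry d n) (ext u))
  (hS_q : forall u : {ffun bdry d n -> R^o},
    maxnorm (bdry d n) (ext (S u))
      <= eps `^ (- ((d%:R - 1) * (2 * over_p1 q)^-1))
         * anorm (2 * over_p1 q) (bdry d n) (ext u))
  (hS_grad : forall u : {ffun bdry d n -> R^o},
    anorm (2 * over_p1 q) (tedges d n) (grad (ext (S u)))
      <= c * anorm (2 * over_p1 q) (tedges d n) (grad (ext u)))
  (hM_grad : forall (u : {ffun bdry d n -> R^o}) (r : \bar R),
    r \in [:: p; q] ->
    anorm (2 * over_p1 r) (tedges d n) (grad (ext (M u)))
      <= c * anorm (2 * over_p1 r) (tedges d n) (grad (ext u)))
  (hM_p : forall u : {ffun bdry d n -> R^o},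
    anorm (2 * over_m1 p) (bdry d n) (ext (M u))
      <= c * anorm (2 * over_m1 p) (tbdry d n) (ext u))
  (hM_1 : forall u : {ffun bdry d n -> R^o},
    anorm 1 (bdry d n) (ext (M u)) <= c * anorm 1 (tbdry d n) (ext u))
  (D : {ffun box d n -> R^o} -> {ffun box d n -> R^o})
  (hD_harm : forall (u : {ffun box d n -> R^o}) (x : Zd d),
    x \in obox d n -> divgrad ah (ext (D u)) x = 0)
  (hD_bdry : forall (u : {ffun box d n -> R^o}) (x : Zd d),
    x \in bdry d n -> ext (D u) x = ext (S (restr (bdry d n) (ext u))) x)
  (N : {ffun box d n -> R^o} -> {ffun box d n -> R^o})
  (hN_harm : forall (u : {ffun box d n -> R^o}) (x : Zd d),
    x \in obox d n -> divgrad ah (ext (N u)) x = 0)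
  (hN_flux : forall (u : {ffun box d n -> R^o}) (x : Zd d),
    x \in tbdry d n ->
    flux wh (ext (N u)) (normal n x)
      = ext (Sstar S M (along_normal n (flux w (ext u)))) x
        - (#|` tbdry d n|%:R)^-1
          * \sum_(y <- tbdry d n)
              ext (Sstar S M (along_normal n (flux w (ext u)))) y)
  (hN_mean : forall u : {ffun box d n -> R^o},
    \sum_(y <- tbdry d n) (ext u y - ext (N u) y) = 0)
  (hN_tn : forall (u : {ffun box d n -> R^o}) (r : \bar R),
    r \in [:: p; q] ->
    anorm (2 * over_p1 r) (tedges d n) (grad (ext (N u)))
      <= c * anorm (2 * over_p1 r) (nedges d n) (grad (ext (N u))))
  (hD_nt : forall (u : {ffun box d n -> R^o}) (r : \bar R),
    r \in [:: p; q] ->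
    anorm (2 * over_p1 r) (nedges d n) (grad (ext (D u)))
      <= c * anorm (2 * over_p1 r) (tedges d n) (grad (ext (D u))))
  (m : R) (hm : m = Num.max (4 * over_m1 p) (4 * over_m1 q))
  (hD_m : forall u : {ffun box d n -> R^o},
    anorm m (edges d n) (grad (ext (D u)))
      <= c * anorm m (tedges d n) (grad (ext (D u))))
  (hN_m : forall u : {ffun box d n -> R^o},
    anorm m (edges d n) (grad (ext (N u)))
      <= c * anorm m (nedges d n) (grad (ext (N u))))
  (hSobolev : forall (r : \bar R) (u : {ffun bdry d n -> R^o}),
    r \in [:: p; q] ->
    inf (range (fun a : R =>
          anorm (2 * over_m1 r) (bdry d n) (fun x => ext u x - a)))
      <= c * n%:R * anorm (alpha d r) (tedges d n) (grad (ext u)))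
  (u : {ffun box d n -> R^o})
  (hpq : einv p + einv q <= 2 / (d%:R - 1)) :
  ((p <= q)%E ->
    `|Bform w wh u (D u)| <= 8 * c ^+ 8 * n%:R * eps `^ theta d p q
                             * Lambda p q w u) /\
  ((q <= p)%E ->
    `|Bform w wh u (N u)| <= 8 * c ^+ 8 * n%:R * eps `^ theta d p q
                             * Lambda p q w u).

Proof.
have d_gt0 : (0 < d)%N := ltnW hd.
have c0 : 0 < c by apply: lt_trans hc.
have nR : 0 < n%:R :> R by rewrite ltr0n.
set X := bdry d n; set T := tbdry d n.
have v0 := @vmeasure_ge0 R X; have t0 := @vmeasure_ge0 R T.
pose em := @emeasure R X (@bdry_rel d n).
pose vm := @vmeasure R X; pose vt := @vmeasure R T.
have Lam0 : 0 <= Lambda p q w u by exact: sqr_ge0.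
have rhs0 : 0 <= 8 * c ^+ 8 * n%:R * eps `^ theta d p q * Lambda p q w u.
  by apply: mulr_ge0 => //; rewrite !mulr_ge0 ?exprn_ge0 ?powR_ge0 ?(ltW c0).
(* If [tbdry] is empty both forms are 0; afterwards the ratio in [hcard1] is a genuine quotient. *)
have [/eqP T0|T0] := eqVneq (#|{: T}|) 0%N.
  have B0 v : `|Bform w wh u v| = 0.
    by rewrite /Bform cardfE -/T (eqP T0) invr0 mul0r normr0.
  by rewrite !B0.
have {}T0 : (0 < #|{: T}|)%N by rewrite lt0n.
have X0 : (0 < #|{: X}|)%N := card_bdry_gt0 hd hn.
have E0 := @sum_degree_gt0 R _ _ hd hn.
have card : #|` X|%:R <= c * #|` T|%:R by rewrite -ler_pdivrMr// cardfE ltr0n.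
have r1 r : r \in [:: p; q] -> (1 < r)%E by rewrite !inE => /orP[] /eqP ->.
have rb r : r \in [:: p; q] -> 0 <= einv r < 1 by move=> /r1 /einv_bounds.
have pin : p \in [:: p; q] by rewrite !inE eqxx.
have qin : q \in [:: p; q] by rewrite !inE eqxx orbT.
have sgt1 r : r \in [:: p; q] -> 1 < 2 / (1 + einv r).
  by move=> /rb rr; rewrite ltr_pdivlMr; lra.
have Pgt1 r : r \in [:: p; q] -> 1 < 2 / (1 - einv r).
  by move=> /rb rr; rewrite ltr_pdivlMr; lra.
have conj r : r \in [:: p; q] -> (2 / (1 - einv r))^-1 + (2 / (1 + einv r))^-1 = 1.
  by move=> /rb rr; rewrite !invf_div; lra.
have P0 r : r \in [:: p; q] -> 0 < 2 / (1 - einv r).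
  by move=> /Pgt1; apply: lt_trans.
have s0 r : r \in [:: p; q] -> 0 < 2 / (1 + einv r).
  by move=> /sgt1; apply: lt_trans.
have ext_ff (g : {ffun X -> R^o}) s : wnorm em s (ediff (fun x : X => ext g (val x))) = wnorm em s (ediff g).
  by apply: wnorm_eq => z _; rewrite /ediff !ext_val.
have tedgesE (g : Zd d -> R) s : 0 < s ->
    anorm s (tedges d n) (grad g) = wnorm em s (ediff (fun x : X => g (val x))).
  by move=> s_gt0; rewrite anorm_tedges// gt_eqF.
have sob r : r \in [:: p; q] -> boundary_sobolev d n c (einv r).
  move=> rin f L hL; have := hSobolev r [ffun x => f x] rin.
  have al0 : 0 < sobolev_exponent d (einv r).
    rewrite /sobolev_exponent; case: ifP => // _; rewrite invr_gt0.
    have := rb _ rin => rr; have : 0 <= d.-1%:R^-1 :> R by rewrite invr_ge0.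
    lra.
  rewrite (alphaE d_gt0 (r1 _ rin)) (tedgesE _ _ al0) ext_ff (over_m1E (r1 _ rin)).
  have -> : wnorm em (sobolev_exponent d (einv r)) (ediff [ffun x => f x : R^o]) =
      wnorm em (sobolev_exponent d (einv r)) (ediff f).
    by apply: wnorm_eq => z _; rewrite /ediff !ffunE.
  apply: le_trans; apply: lb_le_inf; first by eexists; exists 0.
  move=> _ [a _ <-]; apply: (le_trans (hL a)); rewrite anormE.
  have -> : wnorm (@vmeasure R X) (2 / (1 - einv r)) (fun x => f x - a) =
    wnorm (@vmeasure R X) (2 / (1 - einv r)) (fun x : X => ext [ffun x => f x : R^o] (val x) - a).
    by apply: wnorm_eq => z _; rewrite ext_val ffunE.
  exact: lexx.
have [K [Psi [K0 hK hPsi crude fine]]] :=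
  boundary_smoothing hd hn hc (rb _ pin) (sob _ pin) card.
pose Phi r f := wnorm vm (2 / (1 - einv r)) (fun x => f x - S [ffun y => f y] x).
have bdd r : r \in [:: p; q] -> forall f : {ffun X -> R^o},
    wnorm vm (2 / (1 - einv r)) (S f) <= c * wnorm vm (2 / (1 - einv r)) f.
  move=> rin f; have := hS_bdd f r rin; rewrite (over_m1E (r1 _ rin)) !anormE.
  have h (g : {ffun X -> R^o}) : wnorm vm (2 / (1 - einv r)) (fun x : X => ext g (val x)) =
      wnorm vm (2 / (1 - einv r)) g by apply: wnorm_eq => z _; rewrite ext_val.
  by rewrite !h.
have sem r : r \in [:: p; q] -> smoothing_seminorm c eps (einv r) (Phi r).
  move=> rin; apply: operator_seminorm; [exact: rb| |exact: bdd].
  move=> f; have := hS_close f r rin.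
  rewrite (over_m1E (r1 _ rin)) anormE (tedgesE _ _ (P0 _ rin)) ext_ff.
  have -> // : wnorm (@vmeasure R X) (2 / (1 - einv r)) (fun x : X => ext f (val x) - ext (S f) (val x)) =
    wnorm (@vmeasure R X) (2 / (1 - einv r)) (fun x => f x - S f x).
  by apply: wnorm_eq => z _; rewrite !ext_val.
pose Fl (v : Zd d -> R) wt (y : T) := flux wt v (normal n (val y)).
have BformE v : Bform w wh u v = wsum vt (fun y : T =>
    (ext u (val y) - ext v (val y)) * (Fl (ext u) w y - Fl (ext v) wh y)).
  by rewrite /Bform big_seq_fsetE/= mulr_sumr /wsum /vt /vmeasure -cardfE.
have tnorm r f : r \in [:: p; q] -> wnorm vt (2 / (1 - einv r)) (fun y : T => f (val y)) <=
    c `^ ((1 - einv r) / 2) * wnorm vm (2 / (1 - einv r)) (fun x : X => f (val x)).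
  move=> rin; have := tbdry_norm_le f (P0 _ rin) (ltW c0) T0 card.
  by rewrite invf_div.
have adj (y : T) : adjacent (normal n (val y)).1 (normal n (val y)).2.
  by have := normal_nedges (fsvalP y); rewrite mem_nedges => /and3P[].
have whb (y : T) : c^-1 <= wh [fset (normal n (val y)).1; (normal n (val y)).2] <= c.
  exact: homogenized_bounds hah hwh_ah (adj y).
have ci0 : 0 < c^-1 by rewrite invr_gt0.
have flux_le s (v : Zd d -> R) : 0 < s ->
    wnorm vt s (Fl v wh) <= c * anorm s (nedges d n) (grad v).
  move=> s_gt0; rewrite anorm_nedges -[X in X * _](ger0_norm (ltW c0)).
  rewrite -(wnormZ t0 _ _ (lt0r_neq0 s_gt0)).
  apply: (ler_wnorm t0 (ltW s_gt0)) => y _; have /andP[w1 w2] := whb y.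
  rewrite /Fl /flux !normrM; apply: ler_wpM2r => //.
  by rewrite !ger0_norm// ?(ltW c0)// (le_trans _ w1)// ltW.
have flux_ge s (v : Zd d -> R) : 0 < s ->
    anorm s (nedges d n) (grad v) <= c * wnorm vt s (Fl v wh).
  move=> s_gt0; rewrite anorm_nedges -[X in X * _](ger0_norm (ltW c0)).
  rewrite -(wnormZ t0 _ _ (lt0r_neq0 s_gt0)).
  apply: (ler_wnorm t0 (ltW s_gt0)) => y _; have /andP[w1 w2] := whb y.
  rewrite /Fl /flux !normrM mulrA -[leLHS]mul1r; apply: ler_wpM2r => //.
  by rewrite !ger0_norm// ?(ltW c0)// ?(le_trans (ltW ci0) w1)// mulrC -ler_pdivrMr// mul1r.
pose mx := Num.max
    (Num.max (anorm (2 * over_p1 p) (tedges d n) (flux w (ext u)))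
             (anorm (2 * over_p1 p) (nedges d n) (flux w (ext u))))
    (Num.max (anorm (2 * over_p1 q) (tedges d n) (grad (ext u)))
             (anorm (2 * over_p1 q) (nedges d n) (grad (ext u)))).
have LamE : Lambda p q w u = mx ^+ 2 by [].
have mxP (a1 a2 a3 a4 : R) : a2 <= Num.max (Num.max a1 a2) (Num.max a3 a4) /\
    a3 <= Num.max (Num.max a1 a2) (Num.max a3 a4).
  by rewrite !le_max !lexx !orbT.
have ug : wnorm vt (2 / (1 + einv p)) (Fl (ext u) w) <= mx.
  have [h _] := mxP (anorm (2 * over_p1 p) (tedges d n) (flux w (ext u)))
    (anorm (2 * over_p1 p) (nedges d n) (flux w (ext u)))
    (anorm (2 * over_p1 q) (tedges d n) (grad (ext u)))
    (anorm (2 * over_p1 q) (nedges d n) (grad (ext u))).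
  by apply: le_trans h; rewrite (over_p1E hp) anorm_nedges.
have ut : wnorm em (2 / (1 + einv q)) (ediff (fun x : X => ext u (val x))) <= mx.
  have [_ h] := mxP (anorm (2 * over_p1 p) (tedges d n) (flux w (ext u)))
    (anorm (2 * over_p1 p) (nedges d n) (flux w (ext u)))
    (anorm (2 * over_p1 q) (tedges d n) (grad (ext u)))
    (anorm (2 * over_p1 q) (nedges d n) (grad (ext u))).
  by apply: le_trans h; rewrite (over_p1E hq) (tedgesE _ _ (s0 _ qin)).
have mx0 : 0 <= mx by apply: le_trans ut; exact: wnorm_ge0.
have c1 : 1 <= c := ltW hc.
have eps0 : 0 < eps by case/andP: heps.
have iD : einv p + einv q <= 2 / d.-1%:R by move: hpq; rewrite natr_pred.
have thpq : theta d p q = smoothing_exponent d (einv p) (einv q) by rewrite thetaE.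
pose A := c ^+ 2 * n%:R * eps `^ theta d p q.
have A0 : 0 <= A by rewrite !mulr_ge0 ?exprn_ge0 ?powR_ge0 ?(ltW c0).
have eps_le a b : a <= b -> eps `^ b <= eps `^ a.
  by move=> ab; apply: ger_powR => //; rewrite eps0 ltW//; case/andP: heps.
have chalf r : r \in [:: p; q] -> c `^ ((1 - einv r) / 2) <= c.
  move=> /rb rr; rewrite -[leRHS]powRr1 ?(ltW c0)//.
  by apply: ler_powR => //; lra.
have KA0 : 0 <= K * A by rewrite mulr_ge0 ?(ltW K0).
have coefA (a E : R) : 0 <= a -> E <= eps `^ theta d p q -> a * c ^+ 2 * n%:R * E <= a * A.
  move=> a0 hE; have -> : a * A = a * c ^+ 2 * n%:R * eps `^ theta d p q by rewrite /A; ring.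
  by apply: ler_wpM2l => //; rewrite !mulr_ge0 ?exprn_ge0 ?(ltW c0).
pose uX := restr X (ext u).
have uXE (x : X) : ext uX (val x) = ext u (val x) by rewrite ext_restr ?fsvalP.
have wsumB f g h : wsum vt (fun y => f y * (g y - h y)) =
    wsum vt (fun y => f y * g y) - wsum vt (fun y => f y * h y).
  by rewrite /wsum -sumrB; apply: eq_bigr => y _; rewrite !mulrBr.
have Rp : 0 <= einv p < 1 := rb _ pin.
have Rq : 0 <= einv q < 1 := rb _ qin.
split=> le_pq.
  have ji := einv_le hp le_pq.
  set v := D u.
  have vX (x : X) : ext v (val x) = S uX x by rewrite hD_bdry ?fsvalP// ext_val.
  (* By [vX] this is u - S u on [tbdry]. *)
  pose delta (y : T) := ext u (val y) - ext v (val y).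
  have delta_le r : r \in [:: p; q] -> wnorm vt (2 / (1 - einv r)) delta <=
      c `^ ((1 - einv r) / 2) * Phi r (fun x : X => ext u (val x)).
    move=> rin; apply: le_trans (tnorm r (fun z => ext u z - ext v z) rin) _.
    apply: ler_wpM2l; first exact: powR_ge0.
    rewrite le_eqVlt; apply/orP; left; apply/eqP.
    by apply: wnorm_eq => x _; rewrite vX.
  have Phip : Phi p (fun x : X => ext u (val x)) <= K * A * mx.
    apply: le_trans (crude eps (einv p) (einv q) (Phi p) heps Rp Rq iD
      (sob _ pin) (sob _ qin) (sem _ pin) _) _.
    by apply: ler_pM => //; rewrite ?wnorm_ge0 ?mulr_ge0 ?exprn_ge0 ?powR_ge0 ?(ltW K0) ?(ltW c0)//;
      apply: coefA; rewrite ?(ltW K0)// thpq.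
  (* The flux of [D u] is controlled with the exponent of q, so its partner is estimated with the
     pair (q, q); as p <= q the resulting power of eps is at most eps^theta(p, q). *)
  have Phiq : Phi q (fun x : X => ext u (val x)) <= K * A * mx.
    have jD : einv q + einv q <= 2 / d.-1%:R by lra.
    apply: le_trans (crude eps (einv q) (einv q) (Phi q) heps Rq Rq jD
      (sob _ qin) (sob _ qin) (sem _ qin) _) _.
    apply: ler_pM => //; rewrite ?wnorm_ge0 ?mulr_ge0 ?exprn_ge0 ?powR_ge0 ?(ltW K0) ?(ltW c0)//.
    apply: coefA; rewrite ?(ltW K0)// thpq; apply: eps_le.
    have /andP[? ?] := Rp; have /andP[? ?] := Rq.
    exact: smoothing_exponent_anti.
  (* One factor [c] each from the conductances, from passing to tangential gradients of [D u], and
     from the gradient bound of [S]. *)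
  have fv : wnorm vt (2 / (1 + einv q)) (Fl (ext v) wh) <= c ^+ 3 * mx.
    apply: le_trans (flux_le _ _ (s0 _ qin)) _.
    rewrite exprS -mulrA; apply: ler_wpM2l; first exact: ltW.
    have := hD_nt u q qin; rewrite (over_p1E hq) => /le_trans; apply.
    rewrite exprS -mulrA; apply: ler_wpM2l; first exact: ltW.
    rewrite expr1 (tedgesE _ _ (s0 _ qin)).
    have -> : wnorm em (2 / (1 + einv q)) (ediff (fun x : X => ext (D u) (val x))) =
        wnorm em (2 / (1 + einv q)) (ediff (S uX)).
      by apply: wnorm_eq => z _; rewrite /ediff -/v !vX.
    have := hS_grad uX; rewrite (over_p1E hq) !(tedgesE _ _ (s0 _ qin)) !ext_ff.
    move=> /le_trans; apply; apply: ler_wpM2l; first exact: ltW.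
    apply: le_trans ut; rewrite le_eqVlt; apply/orP; left; apply/eqP.
    by apply: wnorm_eq => z _; rewrite /ediff -!uXE !ext_val.
  have b1 : `|wsum vt (fun y => delta y * Fl (ext u) w y)| <= c * (K * A * mx) * mx.
    apply: le_trans (hoelder_wsum t0 _ _ (P0 _ pin) (s0 _ pin) (conj _ pin)) _.
    apply: ler_pM; rewrite ?wnorm_ge0//.
    apply: le_trans (delta_le _ pin) _; apply: ler_pM; rewrite ?powR_ge0 ?wnorm_ge0//.
    exact: chalf.
  have b2 : `|wsum vt (fun y => delta y * Fl (ext v) wh y)| <= c * (K * A * mx) * (c ^+ 3 * mx).
    apply: le_trans (hoelder_wsum t0 _ _ (P0 _ qin) (s0 _ qin) (conj _ qin)) _.
    apply: ler_pM; rewrite ?wnorm_ge0//.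
    apply: le_trans (delta_le _ qin) _; apply: ler_pM; rewrite ?powR_ge0 ?wnorm_ge0//.
    exact: chalf.
  rewrite BformE wsumB; apply: le_trans (ler_normB _ _) _.
  apply: le_trans (lerD b1 b2) _; rewrite LamE.
  have -> : c * (K * A * mx) * mx + c * (K * A * mx) * (c ^+ 3 * mx) =
      K * (c ^+ 3 + c ^+ 6) * (n%:R * eps `^ theta d p q * mx ^+ 2) by rewrite /A; ring.
  have -> : 8 * c ^+ 8 * n%:R * eps `^ theta d p q * mx ^+ 2 =
      8 * c ^+ 8 * (n%:R * eps `^ theta d p q * mx ^+ 2) by ring.
  by apply: ler_wpM2r => //; rewrite !mulr_ge0 ?powR_ge0 ?exprn_ge0.
have ij := einv_le hq le_pq.
set v := N u.
have pD : einv p + einv p <= 2 / d.-1%:R by lra.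
have [k [nu [q' [k01 [nu0 q0] cent hq' fn]]]] := fine (einv p) Rp pD (sob _ pin).
pose kap := k^-1 `^ ((1 + einv p) / 2).
have kap0 : 0 <= kap := powR_ge0 _ _.
pose ch := c `^ ((1 - einv p) / 2).
have ch0 : 0 <= ch := powR_ge0 _ _.
pose g : {ffun T -> R^o} := along_normal n (flux w (ext u)).
have gE (y : T) : g y = Fl (ext u) w y by rewrite ffunE.
have gn : wnorm vt (2 / (1 + einv p)) g <= mx.
  apply: le_trans ug; rewrite le_eqVlt; apply/orP; left; apply/eqP.
  by apply: wnorm_eq => y _; rewrite gE.
pose h := Sstar S M g.
(* The norm bound [hM_p] annihilates functions that vanish on [tbdry]; this is what [Sstar_adjoint]
   asks for. *)
have MT (f : {ffun X -> R^o}) : (forall x, x \in T -> ext f x = 0) -> M f = 0.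
  move=> f0; have := hM_p f; rewrite (over_m1E hp) !anormE.
  have -> : wnorm (@vmeasure R (tbdry d n)) (2 / (1 - einv p)) (fun x : T => ext f (val x)) = 0.
    rewrite wnormE big1 ?powR0 ?invr_eq0 ?(gt_eqF (P0 _ pin))// => y _.
    by rewrite f0 ?fsvalP// normr0 powR0 ?mulr0// (gt_eqF (P0 _ pin)).
  rewrite mulr0 => M0; apply/ffunP => x; rewrite -ext_val.
  rewrite (wnorm_eq0 v0 (P0 _ pin) (f := fun x : X => ext (M f) (val x))) ?ffunE//.
    by apply/eqP; rewrite eq_le M0 wnorm_ge0.
  by rewrite /vmeasure invr_eq0 pnatr_eq0 -lt0n.
have adjoint f : wsum vt (fun y : T => ext f (val y) * ext h (val y)) =
    wsum vt (fun y : T => g y * ext (S (M f)) (val y)).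
  by rewrite /vt !wsum_vmeasure (Sstar_adjoint S f g MT).
(* By duality [h] inherits the bounds of [S] and [M]; [ch] is the cost of restricting a norm to
   [tbdry]. *)
have hn_le : wnorm vt (2 / (1 + einv p)) (fun y : T => ext h (val y)) <= mx * (ch * (c * c)).
  apply: (wnorm_dual t0 (sgt1 _ pin) (P0 _ pin)); first by rewrite addrC conj.
    by rewrite !mulr_ge0 ?(ltW c0).
  move=> g'; pose f := restr X (ext [ffun y : T => g' y : R^o]).
  have fE (y : T) : ext f (val y) = g' y.
    by rewrite ext_restr ?ext_val ?ffunE//; exact: tbdry_bdry (fsvalP y).
  have -> : wsum vt (fun y : T => ext h (val y) * g' y) =
      wsum vt (fun y : T => ext f (val y) * ext h (val y)).
    by apply: eq_bigr => y _; rewrite fE [g' y * _]mulrC.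
  rewrite adjoint; apply: le_trans (ler_norm _) _.
  apply: le_trans (hoelder_wsum t0 _ _ (s0 _ pin) (P0 _ pin) _) _; first by rewrite addrC conj.
  rewrite -!mulrA; apply: ler_pM; rewrite ?wnorm_ge0//.
  apply: le_trans (tnorm p _ pin) _; apply: ler_wpM2l => //.
  have -> : wnorm vm (2 / (1 - einv p)) (fun x : X => ext (S (M f)) (val x)) =
      wnorm vm (2 / (1 - einv p)) (S (M f)) by apply: wnorm_eq => x _; rewrite ext_val.
  apply: le_trans (bdd _ pin _) _; apply: ler_wpM2l; first exact: ltW.
  have := hM_p f; rewrite (over_m1E hp) !anormE.
  have -> : wnorm (@vmeasure R (bdry d n)) (2 / (1 - einv p)) (fun x : X => ext (M f) (val x)) =
      wnorm vm (2 / (1 - einv p)) (M f) by apply: wnorm_eq => x _; rewrite ext_val.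
  move=> /le_trans; apply; apply: ler_wpM2l; first exact: ltW.
  by rewrite le_eqVlt; apply/orP; left; apply/eqP; apply: wnorm_eq => y _; rewrite fE.
pose mean := wsum vt (fun y : T => ext h (val y)).
have FvE (y : T) : Fl (ext v) wh y = ext h (val y) - mean.
  rewrite /Fl hN_flux ?fsvalP//; congr (_ - _).
  by rewrite /mean /vt wsum_vmeasure -cardfE big_seq_fsetE.
(* Subtracting the mean costs [kap], with the same [k] that [fine] provides. *)
have Fv_le : wnorm vt (2 / (1 + einv p)) (Fl (ext v) wh) <= kap * (mx * (ch * (c * c))).
  have -> : wnorm vt (2 / (1 + einv p)) (Fl (ext v) wh) =
      wnorm vt (2 / (1 + einv p)) (fun y : T => ext h (val y) - mean).
    by apply: wnorm_eq => y _; rewrite FvE.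
  apply: le_trans (wnorm_sub_mean t0 _ (sgt1 _ pin) k01 nu0 cent (vmeasure_sum1 R T0)) _.
  by rewrite invf_div; apply: ler_wpM2l.
pose vX := restr X (ext v).
have vXE (x : X) : ext vX (val x) = ext v (val x) by rewrite ext_restr ?fsvalP.
have gradv : wnorm em (2 / (1 + einv p)) (ediff vX) <= c * (c * (kap * (mx * (ch * (c * c))))).
  have -> : wnorm em (2 / (1 + einv p)) (ediff vX) =
      anorm (2 * over_p1 p) (tedges d n) (grad (ext (N u))).
    rewrite (over_p1E hp) (tedgesE _ _ (s0 _ pin)).
    by apply: wnorm_eq => z _; rewrite /ediff -!vXE !ext_val.
  apply: le_trans (hN_tn u p pin) _; apply: ler_wpM2l; first exact: ltW.
  rewrite (over_p1E hp); apply: le_trans (flux_ge _ _ (s0 _ pin)) _.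
  by apply: ler_wpM2l; first exact: ltW.
pose psi (f : {ffun X -> R^o}) (y : T) := ext (M f) (val y) - ext (S (M f)) (val y).
have psi_le f : wnorm vt (2 / (1 - einv p)) (psi f) <=
    ch * Phi p (fun x : X => ext (M f) (val x)).
  apply: le_trans (tnorm p (fun z => ext (M f) z - ext (S (M f)) z) pin) _.
  apply: ler_wpM2l => //; rewrite le_eqVlt; apply/orP; left; apply/eqP.
  apply: wnorm_eq => x _.
  have -> : [ffun y : X => ext (M f) (val y) : R^o] = M f.
    by apply/ffunP => y; rewrite ffunE ext_val.
  by rewrite [ext (S _) _]ext_val.
have gradM r f : r \in [:: p; q] ->
    wnorm em (2 / (1 + einv r)) (ediff (fun x : X => ext (M f) (val x))) <=
    c * wnorm em (2 / (1 + einv r)) (ediff f).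
  move=> rin; have := hM_grad f r rin.
  by rewrite (over_p1E (r1 _ rin)) !(tedgesE _ _ (s0 _ rin)) (ext_ff f).
have PhiU : Phi p (fun x : X => ext (M uX) (val x)) <= K * A * (c * mx).
  apply: le_trans (crude eps (einv p) (einv q) (Phi p) heps Rp Rq iD
    (sob _ pin) (sob _ qin) (sem _ pin) _) _.
  apply: ler_pM; rewrite ?wnorm_ge0 ?mulr_ge0 ?exprn_ge0 ?powR_ge0 ?(ltW K0) ?(ltW c0)//.
    by apply: coefA; rewrite ?(ltW K0)// thpq.
  apply: le_trans (gradM _ _ qin) _; apply: ler_wpM2l; first exact: ltW.
  apply: le_trans ut; rewrite le_eqVlt; apply/orP; left; apply/eqP.
  by apply: wnorm_eq => z _; rewrite /ediff -!uXE !ext_val.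
have PhiV : Phi p (fun x : X => ext (M vX) (val x)) <=
    q' * A * (c * (c * (c * (kap * (mx * (ch * (c * c))))))).
  apply: le_trans (fn eps (Phi p) _ heps (sem _ pin)) _.
  apply: ler_pM; rewrite ?wnorm_ge0 ?mulr_ge0 ?exprn_ge0 ?powR_ge0 ?(ltW c0)//.
    apply: coefA => //; rewrite thpq; apply: eps_le.
    have /andP[? ?] := Rp; have /andP[? ?] := Rq.
    exact: smoothing_exponent_anti.
  apply: le_trans (gradM _ _ pin) _; apply: ler_wpM2l; first exact: ltW.
  exact: gradv.
(* As [u - v] has mean zero on [tbdry], the mean in the flux of [v] drops out; moving [Sstar] to the
   other factor, and [M f = f] on [tbdry], leave the pairing of [g] with [M f - S (M f)]. *)
have BE : Bform w wh u v = wsum vt (fun y => g y * psi uX y) - wsum vt (fun y => g y * psi vX y).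
  have extB (a b : {ffun X -> R^o}) (y : T) : ext (a - b) (val y) = ext a (val y) - ext b (val y).
    have yX := tbdry_bdry (fsvalP y).
    by rewrite !(ext_in _ yX) !ffunE.
  have uT (y : T) : ext uX (val y) = ext u (val y).
    by rewrite ext_restr//; exact: tbdry_bdry (fsvalP y).
  have vT (y : T) : ext vX (val y) = ext v (val y).
    by rewrite ext_restr//; exact: tbdry_bdry (fsvalP y).
  have dE (y : T) : ext u (val y) - ext v (val y) = ext (uX - vX) (val y).
    by rewrite extB uT vT.
  have sum0 : wsum vt (fun y : T => ext (uX - vX) (val y)) = 0.
    rewrite /vt wsum_vmeasure; have := hN_mean u; rewrite big_seq_fsetE/= => z0.
    by rewrite -(eq_bigr _ (fun y _ => dE y)) z0 mulr0.
  have Bv : wsum vt (fun y : T => (ext u (val y) - ext v (val y)) * Fl (ext v) wh y) =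
      wsum vt (fun y : T => ext (uX - vX) (val y) * ext h (val y)).
    have -> : wsum vt (fun y : T => (ext u (val y) - ext v (val y)) * Fl (ext v) wh y) =
        wsum vt (fun y : T => ext (uX - vX) (val y) * (ext h (val y) - mean)).
      by apply: eq_bigr => y _; rewrite dE FvE.
    rewrite wsumB; have -> : wsum vt (fun y : T => ext (uX - vX) (val y) * mean) = 0.
      rewrite /wsum (eq_bigr _ (fun y _ => mulrA _ _ _)) -mulr_suml.
      by move: sum0; rewrite /wsum => ->; rewrite mul0r.
    by rewrite subr0.
  rewrite BformE wsumB; apply: etrans (congr1 (fun z => _ - z) Bv) _.
  rewrite adjoint linearB linearB /wsum -!sumrB; apply: eq_bigr => y _.
  rewrite -!mulrBr; congr (_ * _); rewrite dE gE /psi.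
  rewrite extB [ext (_ - _) _]extB !hM_id ?fsvalP//; ring.
have b1 : `|wsum vt (fun y => g y * psi uX y)| <= mx * (c * (K * A * (c * mx))).
  apply: le_trans (hoelder_wsum t0 _ _ (s0 _ pin) (P0 _ pin) _) _; first by rewrite addrC conj.
  apply: ler_pM; rewrite ?wnorm_ge0//.
  apply: le_trans (psi_le _) _; apply: ler_pM; rewrite ?wnorm_ge0//.
  exact: chalf.
have b2 : `|wsum vt (fun y => g y * psi vX y)| <=
    mx * (ch * (q' * A * (c * (c * (c * (kap * (mx * (ch * (c * c))))))))).
  apply: le_trans (hoelder_wsum t0 _ _ (s0 _ pin) (P0 _ pin) _) _; first by rewrite addrC conj.
  apply: ler_pM; rewrite ?wnorm_ge0//.
  by apply: le_trans (psi_le _) _; apply: ler_wpM2l.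
rewrite BE; apply: le_trans (ler_normB _ _) _.
apply: le_trans (lerD b1 b2) _; rewrite LamE.
(* The two restrictions to [tbdry] cost c^(1 - 1/p) together; the power c^(-1/p) is the one in the
   bound [hq']. *)
have chch : ch * ch = c * c `^ (- einv p).
  rewrite /ch -powRD; last by rewrite (gt_eqF c0) implybT.
  have -> : (1 - einv p) / 2 + (1 - einv p) / 2 = 1 + - einv p by field.
  by rewrite powRD ?(gt_eqF c0) ?implybT// (powRr1 (ltW c0)).
set Q := n%:R * eps `^ theta d p q * mx ^+ 2.
have Q0 : 0 <= Q by rewrite !mulr_ge0 ?powR_ge0 ?exprn_ge0.
have -> : mx * (c * (K * A * (c * mx))) +
    mx * (ch * (q' * A * (c * (c * (c * (kap * (mx * (ch * (c * c)))))))))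
    = (K * c ^+ 4 + kap * c `^ (- einv p) * q' * c ^+ 8) * Q.
  have -> : mx * (ch * (q' * A * (c * (c * (c * (kap * (mx * (ch * (c * c)))))))))
    = ch * ch * (mx * (q' * A * (c * (c * (c * (kap * (mx * (c * c)))))))) by ring.
  by rewrite chch /A /Q; ring.
have -> : 8 * c ^+ 8 * n%:R * eps `^ theta d p q * mx ^+ 2 = 8 * c ^+ 8 * Q by rewrite /Q; ring.
apply: ler_wpM2r => //; apply: le_trans hPsi; rewrite lerD2l.
by apply: ler_wpM2r => //; rewrite exprn_ge0// ltW.
Qed.
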